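(* Let $K\ge1$, $\alpha\in[1,2]$, $t\in[0,1]$ and $m\in\mathbb{N}$. Let $R_{K,m,t,\alpha}\in(0,1)$ be the unique root in $(0,1)$ of the equation $$t f_{\alpha}(r^m)+\frac{2K(1-t)}{K+1}f_{\alpha}(r)-\frac{1}{2\alpha}=0,\qquad f_\alpha(z)=\frac{1}{2\alpha}\left[\left(\frac{1+z}{1-z}\right)^\alpha-1\right].$$ Suppose that $f(z)=h(z)+\overline{g(z)}=\sum_{n=0}^{\infty}a_nz^n+\overline{\sum_{n=1}^{\infty}b_nz^n}$ is a sense-preserving $K$-quasiconformal harmonic mapping in $\mathbb{D}$ and $h\prec\phi$, where $\phi\in\widehat{\mathcal{C}_0}(\alpha)$. Then (with $b_0=0$) $$t|h(z^m)|+(1-t)\sum_{n=0}^{\infty}(|a_n|+|b_n|)r^n\le|\phi(0)|+d(\phi(0),\partial\phi(\mathbb{D}))$$ for $|z|=r\le\min\{1/3,R_{K,m,t,\alpha}\}$. Moreover, if $R_{K,m,t,\alpha}\le1/3$, the radius $R_{K,m,t,\alpha}$ is sharp, i.e. it cannot be replaced by any larger number in this statement (over all admissible $f$ and $\phi$).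
   Context: $\mathbb{D}=\{z\in\mathbb{C}:|z|<1\}$. For $\alpha\in[1,2]$, $\widehat{\mathcal{C}_0}(\alpha)$ (concave univalent functions with opening angle $\pi\alpha$) is the class of analytic functions $\phi$ in $\mathbb{D}$ such that: (1) $\phi$ maps $\mathbb{D}$ conformally onto $\phi(\mathbb{D})$; (2) $\phi(1)=\infty$; (3) the set $(\mathbb{C}\cup\{\infty\})\setminus\phi(\mathbb{D})$ is convex, and the opening angle of $\phi(\mathbb{D})$ at infinity is less than or equal to $\pi\alpha$. $d(\phi(0),\partial\phi(\mathbb{D}))$ is the Euclidean distance from $\phi(0)$ to the boundary of $\phi(\mathbb{D})$. For analytic $h,\phi$ in $\mathbb{D}$, $h\prec\phi$ ($h$ is subordinate to $\phi$) means $h=\phi\circ w$ for some analytic $w:\mathbb{D}\to\mathbb{D}$ with $w(0)=0$. A harmonic mapping $f=h+\overline g$ in $\mathbb{D}$ ($h,g$ analytic) is sense-preserving $K$-quasiconformal if it is locally univalent and sense-preserving (i.e. $h'\ne0$ and $|\omega|<1$ in $\mathbb{D}$, where $\omega=g'/h'$) and $|\omega(z)|\le k<1$ in $\mathbb{D}$, where $K=(1+k)/(1-k)\ge1$, i.e. $k=(K-1)/(K+1)$. *)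

(* Defs.v *)
From HB Require Import structures.
From mathcomp Require Import all_boot all_order all_algebra.
From mathcomp Require Import all_classical all_reals all_analysis.
From mathcomp Require Import complex.

Set Implicit Arguments.
Unset Strict Implicit.
Unset Printing Implicit Defensive.

Import Order.TTheory GRing.Theory Num.Theory.
Import numFieldNormedType.Exports.

Local Open Scope classical_set_scope.
Local Open Scope ring_scope.
Local Open Scope complex_scope.

HB.instance Definition _ (R : rcfType) := NormedModule.copy R[i] R[i]^o.

(* The modulus with values in R: the library norm `|z| lives in R[i]. *)
Notation cmod := ComplexField.Normc.normc.

Section BohrConcave.
Context {R : realType}.
Implicit Types (f g h phi w : R[i] -> R[i]) (a b : nat -> R[i]).
Implicit Types (W : set R[i]).

Definition disk : set R[i] := [set z | cmod z < 1].

(* Complex differentiability at every point of the disk. *)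
Definition analytic f : Prop := forall z, disk z -> derivable f z 1.

Definition power_series a f : Prop :=
  forall z, disk z -> series (fun n => a n * z ^+ n) @ \oo --> f z.

Definition subordinate h phi : Prop :=
  exists w, [/\ analytic w, w 0 = 0, forall z, disk z -> disk (w z) &
    forall z, disk z -> h z = phi (w z)].

Definition boundary W : set R[i] := closure W `\` W°.

Definition dist_to (z : R[i]) W : R := inf [set cmod (z - p) | p in W].

Definition polar (rho theta : R) : R[i] :=
  (rho * cos theta) +i* (rho * sin theta).

(* The angular size of the part of the circle of radius rho that lies in W. *)
Definition arc_measure W (rho : R) : \bar R :=
  lebesgue_measure [set theta : R | - pi < theta <= pi /\ W (polar rho theta)].

(* An opening at infinity presupposes that the complement of W reaches
   infinity; its angle is the limiting angular size of W on large circles. *)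
Definition opening_angle_at_infinity W (beta : R) : Prop :=
  (forall M : R, exists2 p, ~ W p & M < cmod p) /\
  arc_measure W rho @[rho --> +oo] --> beta%:E.

(* In the last clause, infinity belongs to the complement of phi(D) in the
   sphere, so convexity bears on the finite part of that complement. The type
   Rcomplex R is R[i] as a vector space over R. *)
Definition concave_univalent (alpha : R) phi : Prop :=
  [/\ analytic phi /\ set_inj disk phi,
      cmod (phi z) @[z --> within disk (nbhs (1 : R[i]))] --> +oo,
      convex_set (~` (phi @` disk) : set (convex_lmodType (Rcomplex R))) &
      exists2 beta, opening_angle_at_infinity (phi @` disk) beta &
                    beta <= pi * alpha].

Definition dilatation h g (z : R[i]) : R[i] := derive1 g z / derive1 h z.

Definition sense_preserving_qc (K : R) h g : Prop :=
  forall z, disk z ->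
    [/\ derive1 h z != 0, cmod (dilatation h g z) < 1 &
        cmod (dilatation h g z) <= (K - 1) / (K + 1)].

Definition qc_harmonic (K : R) f h g a b : Prop :=
  [/\ forall z, disk z -> f z = h z + (g z)^*,
      analytic h /\ power_series a h,
      [/\ analytic g, power_series b g & b 0%N = 0] &
      sense_preserving_qc K h g].

Definition f_ (alpha x : R) : R :=
  (2 * alpha)^-1 * (((1 + x) / (1 - x)) `^ alpha - 1).

Definition is_radius (K : R) (m : nat) (t alpha r : R) : Prop :=
  0 < r < 1 /\
  t * f_ alpha (r ^+ m) + 2 * K * (1 - t) / (K + 1) * f_ alpha r
    - (2 * alpha)^-1 = 0.

(* The Bohr-type inequality for all admissible f and phi and all z in the disk
   with |z| <= rho. *)
Definition bohr_inequality (K : R) (m : nat) (t alpha rho : R) : Prop :=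
  forall f h g a b phi,
    qc_harmonic K f h g a b ->
    concave_univalent alpha phi ->
    subordinate h phi ->
    forall z, disk z -> cmod z <= rho ->
    ((t * cmod (h (z ^+ m)))%:E +
       (1 - t)%:E *
       (\sum_(0 <= n <oo) ((cmod (a n) + cmod (b n)) * cmod z ^+ n)%:E)
     <= (cmod (phi 0) + dist_to (phi 0) (boundary (phi @` disk)))%:E)%E.

End BohrConcave.

(* Main.v *)
(* Fix a boundary point q of W = phi(D).  Since the complement of W is convex
   and W fills at most the angle pi * alpha of large circles, a branch of
   log ((h - q) / (h 0 - q)) maps D into a horizontal strip of width
   pi * alpha: a larger width would put an arc longer than pi * alpha of every
   large circle into W.  Mapping the strip to the disk gives
   (h - q) / (h 0 - q) = ((1 + y w) / (1 - w)) `^ alpha with |y| = 1, |w| <= 1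
   and w 0 = 0.  For r <= 1/3, Caratheodory's coefficient inequality yields
   sum |w_n| r^n <= r, and the coefficients of ((1 + y z) / (1 - z)) `^ alpha
   are dominated, in the same weighted sum, by those for y = 1; hence
     sum_(n > 0) |a_n| r^n <= |h 0 - q| (((1 + r) / (1 - r)) `^ alpha - 1).
   In the same way |g' / h'| <= k gives sum |b_n| r^n <= k sum_(n > 0) |a_n| r^n,
   where 1 + k = 2 K / (K + 1).  Taking the infimum over q proves the
   inequality.  For h = phi = ((1 + z) / (1 - z)) `^ alpha and g = k (h - 1) the
   domain is a sector with vertex 0, all coefficients are nonnegative, and
   positive z violate the inequality beyond the radius.

   Taylor expansions of all orders at a point play the part of Cauchy's
   integral: the maximum principle follows by averaging a second order
   expansion over four points, the coefficient inequality by averaging over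
   roots of unity. *)

Require Import Defs.
From mathcomp Require Import all_boot all_order all_algebra.
From mathcomp Require Import all_classical all_reals all_analysis.
From mathcomp Require Import complex ring lra.

Import Order.TTheory GRing.Theory Num.Theory.
Import numFieldNormedType.Exports.

Set Implicit Arguments.
Unset Strict Implicit.
Unset Printing Implicit Defensive.

Local Open Scope classical_set_scope.
Local Open Scope ring_scope.

(** The value h 0 need not lie in the middle of the sector, which is why y differs from 1: y = exp
    (2 i mu), where alpha mu is the height of the middle of the strip above L 0 = 0. For such y the
    coefficients of index at least 2 are estimated up to an excess proportional to u = 1 - Re y. The
    first coefficient has a deficit proportional to the same u, and for r <= 1/3 this deficit pays
    for all the excesses; hence domination is proved for the weighted sum and not term by term. The
    number 1/3 itself comes from 2 r / (1 - r) <= 1 in Bohr's inequality for bounded functions.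
    Quotients such as w z / z come without a power series of their own, so the Schwarz and
    Caratheodory lemmas ask for smoothness off 0, with separate information at 0. That ((1 + z) / (1
    - z))^alpha is the sum of its Taylor series is derived from the equation (1 - z^2) f' = 2 alpha
    f. Convexity of the complement enters twice: it yields a ray that misses the domain, hence a
    branch of the logarithm, and it carries directions seen from q to large circles about 0. *)

Local Notation Re := complex.Re.
Local Notation Im := complex.Im.

(** * Modulus, real part and imaginary part *)

Section Modulus.
Context {R : realType}.
Local Open Scope complex_scope.
Implicit Types (z w : R[i]) (x y : R).

Lemma cmod_ge0 z : 0 <= cmod z.
Proof. by case: z => a b /=; exact: sqrtr_ge0. Qed.

Lemma cmod0 : cmod (0 : R[i]) = 0.
Proof. exact: ComplexField.Normc.normc0. Qed.

Lemma cmod1 : cmod (1 : R[i]) = 1.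
Proof. exact: ComplexField.Normc.normc1. Qed.

Lemma cmodM z w : cmod (z * w) = cmod z * cmod w.
Proof. exact: ComplexField.Normc.normcM. Qed.

Lemma cmodV z : cmod z^-1 = (cmod z)^-1.
Proof. exact: ComplexField.Normc.normcV. Qed.

Lemma cmod_div z w : cmod (z / w) = cmod z / cmod w.
Proof. by rewrite cmodM cmodV. Qed.

Lemma cmodN z : cmod (- z) = cmod z.
Proof. exact: normcN. Qed.

Lemma cmodD z w : cmod (z + w) <= cmod z + cmod w.
Proof. exact: le_normcD. Qed.

Lemma cmodB z w : cmod (z - w) <= cmod z + cmod w.
Proof. by rewrite (le_trans (cmodD _ _))// cmodN. Qed.

Lemma cmodC z w : cmod (z - w) = cmod (w - z).
Proof. by rewrite -cmodN opprB. Qed.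

Lemma cmod_ge_sub z w : cmod z - cmod w <= cmod (z + w).
Proof. by rewrite lerBlDr -{1}[z](addrK w) cmodB. Qed.

Lemma cmod_triangle z w u : cmod (z - w) <= cmod (z - u) + cmod (u - w).
Proof. by rewrite -(subrKA u) cmodD. Qed.

Lemma cmod_dist z w : `|cmod z - cmod w| <= cmod (z - w).
Proof.
rewrite ler_norml; apply/andP; split.
  by rewrite lerNl opprB lerBlDr cmodC -{1}[w](subrK z) cmodD.
by rewrite lerBlDr -{1}[z](subrK w) cmodD.
Qed.

Lemma cmodX z n : cmod (z ^+ n) = cmod z ^+ n.
Proof. by elim: n => [|n ih]; rewrite ?cmod1// !exprS cmodM ih. Qed.

Lemma cmod_eq0 z : (cmod z == 0) = (z == 0).
Proof.
by apply/eqP/eqP => [/ComplexField.Normc.eq0_normc//|->]; exact: cmod0.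
Qed.

Lemma cmod_gt0 z : (0 < cmod z) = (z != 0).
Proof. by rewrite lt_def cmod_ge0 andbT cmod_eq0. Qed.

Lemma cmod_real x : cmod x%:C = `|x|.
Proof. by rewrite /= expr0n addr0 sqrtr_sqr. Qed.

Lemma cmod_nat n : cmod (n%:R : R[i]) = n%:R.
Proof. by rewrite -(rmorph_nat (real_complex R)) cmod_real normr_nat. Qed.

Lemma cmod_sqr z : cmod z ^+ 2 = Re z ^+ 2 + Im z ^+ 2.
Proof. by case: z => a b /=; rewrite sqr_sqrtr// addr_ge0 ?sqr_ge0. Qed.

Lemma cmod_ge_Re z : `|Re z| <= cmod z.
Proof.
by rewrite -(ler_pXn2r (ltn0Sn 1)) ?nnegrE ?cmod_ge0// cmod_sqr real_normK
  ?num_real// lerDl sqr_ge0.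
Qed.

Lemma cmod_ge_Im z : `|Im z| <= cmod z.
Proof.
by rewrite -(ler_pXn2r (ltn0Sn 1)) ?nnegrE ?cmod_ge0// cmod_sqr real_normK
  ?num_real// lerDr sqr_ge0.
Qed.

Lemma cmod_le_ReIm z : cmod z <= `|Re z| + `|Im z|.
Proof.
rewrite -(ler_pXn2r (ltn0Sn 1)) ?nnegrE ?cmod_ge0 ?addr_ge0//.
rewrite cmod_sqr sqrrD !real_normK ?num_real// lerD2r lerDl.
by rewrite mulrn_wge0// mulr_ge0.
Qed.

Lemma cmod_conj z : cmod (z^*) = cmod z.
Proof. by case: z => a b /=; rewrite sqrrN. Qed.

Lemma cmod_sum (I : Type) (r : seq I) (P : pred I) (F : I -> R[i]) :
  cmod (\sum_(i <- r | P i) F i) <= \sum_(i <- r | P i) cmod (F i).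
Proof.
elim/big_rec2: _ => [|i y z _ le]; first by rewrite cmod0.
by rewrite (le_trans (cmodD _ _))// lerD2l.
Qed.

Lemma reD z w : Re (z + w) = Re z + Re w.
Proof. by case: z w => [a b] [c d]. Qed.

Lemma imD z w : Im (z + w) = Im z + Im w.
Proof. by case: z w => [a b] [c d]. Qed.

Lemma reN z : Re (- z) = - Re z.
Proof. by case: z. Qed.

Lemma imN z : Im (- z) = - Im z.
Proof. by case: z. Qed.

Lemma reM z w : Re (z * w) = Re z * Re w - Im z * Im w.
Proof. by case: z w => [a b] [c d]. Qed.

Lemma imM z w : Im (z * w) = Re z * Im w + Im z * Re w.
Proof. by case: z w => [a b] [c d]. Qed.

Lemma Re_le_cmod z : Re z <= cmod z.
Proof. exact: le_trans (ler_norm _) (cmod_ge_Re z). Qed.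

Lemma complex_ext z w : Re z = Re w -> Im z = Im w -> z = w.
Proof. by case: z w => [a b] [c d] /= -> ->. Qed.

Lemma realC_inj : injective (real_complex R).
Proof. by move=> x y []. Qed.

Lemma exists_phase z : exists eta, cmod eta = 1 /\ eta * z = (cmod z)%:C.
Proof.
have [->|z0] := eqVneq z 0.
  by exists 1; rewrite cmod1 cmod0 mulr0.
exists ((cmod z)%:C / z); split.
  by rewrite cmod_div cmod_real ger0_norm ?cmod_ge0// divff// cmod_eq0.
by rewrite divfK.
Qed.

End Modulus.

(** * Taylor expansions of finite order at a point *)

Section Jets.
Context {R : realType}.
Local Open Scope complex_scope.
Implicit Types (f g e u v : R[i] -> R[i]) (z w : R[i]) (p q : {poly R[i]}).

(** The bound includes s = 0, so for n > 0 it forces e 0 = 0; through this a jet knows the value of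
    its function ([jet_at]). *)
Definition bigO_at0 n e := exists C d : R, [/\ 0 <= C, 0 < d &
  forall s, cmod s < d -> cmod (e s) <= C * cmod s ^+ n].

Lemma bigO_eq n e u (d : R) : 0 < d ->
  (forall s, cmod s < d -> e s = u s) -> bigO_at0 n u -> bigO_at0 n e.
Proof.
move=> d0 eu [C [d' [C0 d'0 H]]]; exists C, (Num.min d d'); split => //.
  by rewrite lt_min d0.
by move=> s; rewrite lt_min => /andP[sd sd']; rewrite eu// H.
Qed.

Lemma bigOD n e u : bigO_at0 n e -> bigO_at0 n u ->
  bigO_at0 n (fun s => e s + u s).
Proof.
move=> [C [d [C0 d0 H]]] [C' [d' [C'0 d'0 H']]].
exists (C + C'), (Num.min d d'); split; rewrite ?addr_ge0 ?lt_min ?d0//.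
move=> s; rewrite lt_min => /andP[sd sd']; rewrite (le_trans (cmodD _ _))// mulrDl.
by rewrite lerD ?H ?H'.
Qed.

Lemma bigON n e : bigO_at0 n e -> bigO_at0 n (fun s => - e s).
Proof. by move=> [C [d [? ? H]]]; exists C, d; split => // s /H; rewrite cmodN. Qed.

Lemma bigOB n e u : bigO_at0 n e -> bigO_at0 n u ->
  bigO_at0 n (fun s => e s - u s).
Proof. by move=> ? ?; apply: bigOD => //; exact: bigON. Qed.

Lemma bigOM n m e u : bigO_at0 n e -> bigO_at0 m u ->
  bigO_at0 (n + m) (fun s => e s * u s).
Proof.
move=> [C [d [C0 d0 H]]] [C' [d' [C'0 d'0 H']]].
exists (C * C'), (Num.min d d'); split; rewrite ?mulr_ge0 ?lt_min ?d0//.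
move=> s; rewrite lt_min => /andP[sd sd']; rewrite cmodM exprD mulrACA.
by rewrite ler_pM ?cmod_ge0 ?H ?H'.
Qed.

Lemma bigO_le n m e : (m <= n)%N -> bigO_at0 n e -> bigO_at0 m e.
Proof.
move=> mn [C [d [C0 d0 H]]]; exists C, (Num.min d 1); split => //.
  by rewrite lt_min d0 ltr01.
move=> s; rewrite lt_min => /andP[sd s1]; rewrite (le_trans (H _ sd))//.
by rewrite ler_wpM2l// ler_wiXn2l ?cmod_ge0 ?ltW.
Qed.

Lemma bigO_comp n e u : bigO_at0 n e -> bigO_at0 1 u ->
  bigO_at0 n (fun s => e (u s)).
Proof.
move=> [C [d [C0 d0 H]]] [C' [d' [C'0 d'0 H']]].
have C1 : 0 < C' + 1 by rewrite ltr_wpDl.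
exists (C * (C' + 1) ^+ n), (Num.min d' (d / (C' + 1))); split.
- by rewrite mulr_ge0// exprn_ge0// ltW.
- by rewrite lt_min d'0 divr_gt0.
move=> s; rewrite lt_min => /andP[sd' sd].
have us : cmod (u s) <= (C' + 1) * cmod s.
  rewrite (le_trans (H' _ sd'))// expr1 ler_wpM2r ?cmod_ge0//.
  by rewrite lerDl.
have usd : cmod (u s) < d.
  by rewrite (le_lt_trans us)// mulrC -ltr_pdivlMr.
rewrite (le_trans (H _ usd))// -mulrA -exprMn ler_wpM2l//.
by rewrite lerXn2r ?nnegrE ?cmod_ge0// mulr_ge0 ?cmod_ge0// ltW.
Qed.

Lemma bigO_cst z : bigO_at0 0 (fun _ => z).
Proof.
exists (cmod z), 1; split; rewrite ?cmod_ge0// => s _.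
by rewrite expr0 mulr1.
Qed.

Lemma bigO_id : bigO_at0 1 (fun s => s).
Proof. by exists 1, 1; split => // s _; rewrite mul1r expr1. Qed.

Lemma bigO_exp n : bigO_at0 n (fun s => s ^+ n).
Proof. by exists 1, 1; split => // s _; rewrite mul1r cmodX. Qed.

Lemma bigO_poly p : bigO_at0 0 (fun s => p.[s]).
Proof.
elim/poly_ind: p => [|p c ih].
  apply: (@bigO_eq _ _ (fun=> 0) 1) => [//|s _|]; first by rewrite horner0.
  exact: bigO_cst.
apply: (@bigO_eq _ _ (fun s => p.[s] * s + c) 1) => // [s _|].
  by rewrite !hornerE.
apply: bigOD; last exact: bigO_cst.
by apply: (@bigO_le (0 + 1)) => //; apply: bigOM ih _; exact: bigO_id.
Qed.

Lemma bigO_poly_comp p u : bigO_at0 0 u -> bigO_at0 0 (fun s => p.[u s]).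
Proof.
move=> Ou; elim/poly_ind: p => [|p c ih].
  apply: (@bigO_eq _ _ (fun=> 0) 1) => [//|s _|]; first by rewrite horner0.
  exact: bigO_cst.
apply: (@bigO_eq _ _ (fun s => p.[u s] * u s + c) 1) => // [s _|].
  by rewrite !hornerE.
by apply: bigOD; [exact: (bigOM ih Ou) | exact: bigO_cst].
Qed.

Lemma bigO_polyB n p u v : bigO_at0 0 u -> bigO_at0 0 v ->
  bigO_at0 n (fun s => u s - v s) ->
  bigO_at0 n (fun s => p.[u s] - p.[v s]).
Proof.
move=> Ou Ov Ouv; elim/poly_ind: p => [|p c ih].
  apply: (@bigO_eq _ _ (fun s => 0 * (u s - v s)) 1) => [//|s _|].
    by rewrite !horner0 subrr mul0r.
  by have := bigOM (bigO_cst 0) Ouv; rewrite add0n.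
apply: (@bigO_eq _ _ (fun s => (p.[u s] - p.[v s]) * u s +
  p.[v s] * (u s - v s)) 1) => // [s _|].
  by rewrite !hornerE; ring.
apply: bigOD; first by have := bigOM ih Ou; rewrite addn0.
exact: (bigOM (bigO_poly_comp _ Ov) Ouv).
Qed.

(** Only the coefficients of p below n are determined ([jet_unique]); p may have any degree, so that
    sums, products and composites of jets are jets as they stand. *)
Definition jet n f z p := bigO_at0 n (fun s => f (z + s) - p.[s]).

(** A condition at the single point z; required at all points of a disk, it takes the place of
    analyticity. *)
Definition smooth f z := forall n, exists p, jet n f z p.

Lemma jet_le n m f z p : (m <= n)%N -> jet n f z p -> jet m f z p.
Proof. exact: bigO_le. Qed.

Lemma jet_eq_near n f g z p (d : R) : 0 < d ->
  (forall s, cmod s < d -> f (z + s) = g (z + s)) ->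
  jet n g z p -> jet n f z p.
Proof. by move=> d0 fg; apply: (bigO_eq d0) => s sd; rewrite fg. Qed.

Lemma smooth_eq_near f g z (d : R) : 0 < d ->
  (forall s, cmod s < d -> f (z + s) = g (z + s)) -> smooth g z -> smooth f z.
Proof.
by move=> d0 fg gz n; have [p ?] := gz n; exists p; exact: jet_eq_near fg _.
Qed.

Lemma jet_cst n z c : jet n (fun=> c) z c%:P.
Proof.
apply: (@bigO_eq _ _ (fun s => 0 * s ^+ n) 1) => // [s _|].
  by rewrite /= hornerC subrr mul0r.
exact: (bigOM (bigO_cst 0) (bigO_exp n)).
Qed.

Lemma jet_id n z : jet n id z (z%:P + 'X).
Proof.
apply: (@bigO_eq _ _ (fun s => 0 * s ^+ n) 1) => // [s _|].
  by rewrite /= !hornerE subrr.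
exact: (bigOM (bigO_cst 0) (bigO_exp n)).
Qed.

Lemma jetD n f g z p q : jet n f z p -> jet n g z q ->
  jet n (fun x => f x + g x) z (p + q).
Proof.
move=> fp gq; apply: (bigO_eq ltr01 _ (bigOD fp gq)) => s _ /=.
by rewrite hornerD opprD addrACA.
Qed.

Lemma jetN n f z p : jet n f z p -> jet n (fun x => - f x) z (- p).
Proof.
move=> fp; apply: (bigO_eq ltr01 _ (bigON fp)) => s _ /=.
by rewrite hornerN opprD.
Qed.

Lemma jet_bounded n f z p : jet n f z p -> bigO_at0 0 (fun s => f (z + s)).
Proof.
move=> /(@bigO_le n 0 _ (leq0n n)) fp.
apply: (bigO_eq ltr01 _ (bigOD fp (bigO_poly p))) => s _ /=.
by rewrite subrK.
Qed.

Lemma jetM n f g z p q : jet n f z p -> jet n g z q ->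
  jet n (fun x => f x * g x) z (p * q).
Proof.
move=> fp gq; have bf := jet_bounded fp.
have := bigOD (bigOM bf gq) (bigOM (bigO_poly q) fp).
apply: bigO_eq ltr01 _ => s _ /=; rewrite hornerM; ring.
Qed.

Lemma jet_at f z p n : (0 < n)%N -> jet n f z p -> p.[0] = f z.
Proof.
move=> n0 [C [d [_ d0 /(_ 0)]]].
rewrite cmod0 addr0 expr0n -(prednK n0) /= mulr0 => /(_ d0) le0.
apply/esym/eqP; rewrite -subr_eq0 -cmod_eq0 eq_le le0.
exact: cmod_ge0.
Qed.

Lemma smooth_lipschitz f z : smooth f z ->
  bigO_at0 1 (fun s => f (z + s) - f z).
Proof.
move=> /(_ 1) [p fp]; have p0 := jet_at (ltn0Sn 0) fp.
have : bigO_at0 1 (fun s => p.[s] - p.[0]).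
  apply: bigO_polyB; [by apply: bigO_le (ltnW _) bigO_id|exact: bigO_cst|].
  by apply: (bigO_eq ltr01 _ bigO_id) => s _; rewrite subr0.
move=> /(bigOD fp); apply: bigO_eq ltr01 _ => s _ /=.
by rewrite p0; ring.
Qed.

(** Two errors add up: g is replaced by q at the increment f (z + s) - f z, which is O(s), and then
    this increment is replaced by p - f z inside q, a polynomial being Lipschitz on bounded
    arguments. *)
Lemma jet_comp n f g z p q : (0 < n)%N -> jet n f z p -> jet n g (f z) q ->
  jet n (fun x => g (f x)) z (q \Po (p - (f z)%:P)).
Proof.
move=> n0 fp gq; have p0 := jet_at n0 fp.
have Pl : bigO_at0 1 (fun s => p.[s] - f z).
  rewrite -p0; apply: bigO_polyB; [by apply: bigO_le (ltnW _) bigO_id|exact: bigO_cst|].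
  by apply: (bigO_eq ltr01 _ bigO_id) => s _; rewrite subr0.
have ul : bigO_at0 1 (fun s => f (z + s) - f z).
  apply: (bigO_eq ltr01 _ (bigOD (bigO_le n0 fp) Pl)) => s _ /=; ring.
have := bigOD (bigO_comp gq ul)
  (@bigO_polyB n q _ _ (bigO_le (leq0n _) ul) (bigO_le (leq0n _) Pl) _).
move=> H; have {H} := H (bigO_eq ltr01 _ fp).
move=> H; apply: bigO_eq ltr01 _ (H _) => s _ /=.
  by rewrite horner_comp hornerD hornerN hornerC [f z + _]addrC subrK; ring.
by rewrite opprB addrA subrK.
Qed.

Lemma smooth_cst c z : smooth (fun=> c) z.
Proof. by move=> n; exists c%:P; exact: jet_cst. Qed.

Lemma smooth_id z : smooth id z.
Proof. by move=> n; exists (z%:P + 'X); exact: jet_id. Qed.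

Lemma smoothD f g z : smooth f z -> smooth g z -> smooth (fun x => f x + g x) z.
Proof.
move=> fz gz n; have [p ?] := fz n; have [q ?] := gz n.
by exists (p + q); exact: jetD.
Qed.

Lemma smoothN f z : smooth f z -> smooth (fun x => - f x) z.
Proof. by move=> fz n; have [p ?] := fz n; exists (- p); exact: jetN. Qed.

Lemma smoothB f g z : smooth f z -> smooth g z -> smooth (fun x => f x - g x) z.
Proof. by move=> ? ?; apply: smoothD => //; exact: smoothN. Qed.

Lemma smoothM f g z : smooth f z -> smooth g z -> smooth (fun x => f x * g x) z.
Proof.
move=> fz gz n; have [p ?] := fz n; have [q ?] := gz n.
by exists (p * q); exact: jetM.
Qed.

Lemma smooth_exp f z n : smooth f z -> smooth (fun x => f x ^+ n) z.
Proof.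
move=> fz; elim: n => [|n ih].
  by apply: (@smooth_eq_near _ (fun=> 1) _ 1) => //; exact: smooth_cst.
apply: (@smooth_eq_near _ (fun x => f x * f x ^+ n) _ 1) => //.
  by move=> s _; rewrite exprS.
exact: smoothM.
Qed.

Lemma smooth_sum n (F : 'I_n -> R[i] -> R[i]) z :
  (forall i, smooth (F i) z) -> smooth (fun x => \sum_(i < n) F i x) z.
Proof.
move=> FS; elim: n F FS => [|n ih] F FS.
  apply: (@smooth_eq_near _ (fun=> 0) _ 1) => //.
    by move=> s _; rewrite big_ord0.
  exact: smooth_cst.
apply: (@smooth_eq_near _ (fun x => F ord0 x +
  \sum_(i < n) F (lift ord0 i) x) _ 1) => //.
  by move=> s _; rewrite big_ord_recl.
by apply: smoothD => //; exact: ih.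
Qed.

Lemma smooth_comp f g z : smooth f z -> smooth g (f z) ->
  smooth (fun x => g (f x)) z.
Proof.
(* One order more than required, because [jet_comp] wants a positive order. *)
move=> fz gz n; have [p fp] := fz n.+1; have [q gq] := gz n.+1.
by exists (q \Po (p - (f z)%:P)); apply: jet_le (leqnSn n) _; exact: jet_comp.
Qed.

(** The identity 1 / (z + s) = (1 - s / (z + s)) / z turns an expansion of order n into one of order
    n + 1; order 0 is boundedness for |s| < |z| / 2. *)
Lemma smooth_inv z : z != 0 -> smooth (fun x => x^-1) z.
Proof.
move=> z0; elim => [|n [p [C [d [C0 d0 H]]]]].
  exists (z^-1)%:P; have z20 : 0 < cmod z / 2 by rewrite divr_gt0 ?cmod_gt0.
  exists (2 / cmod z + 1 / cmod z), (cmod z / 2); split => //.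
    by rewrite addr_ge0// divr_ge0 ?cmod_ge0.
  move=> s s2; rewrite hornerC expr0 mulr1.
  have zs : cmod z / 2 <= cmod (z + s).
    by apply: le_trans (cmod_ge_sub _ _); lra.
  rewrite (le_trans (cmodB _ _))// !cmodV div1r lerD2r.
  by rewrite -[2 / _]invf_div lef_pV2 ?posrE// (lt_le_trans z20).
pose q := (z^-1)%:P * (1 - 'X * p); exists q.
have z20 : 0 < cmod z by rewrite cmod_gt0.
exists (C / cmod z), (Num.min d (cmod z)); split.
- by rewrite divr_ge0// ltW.
- by rewrite lt_min d0.
move=> s; rewrite lt_min => /andP[sd sz].
have zs0 : z + s != 0.
  by rewrite -cmod_gt0 (lt_le_trans _ (cmod_ge_sub _ _))// subr_gt0.
have -> : (z + s)^-1 - q.[s] = - (z^-1 * s * ((z + s)^-1 - p.[s])).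
  by rewrite !hornerE; field; rewrite z0 zs0.
rewrite cmodN !cmodM cmodV exprS.
have -> : C / cmod z * (cmod s * cmod s ^+ n) =
  (cmod z)^-1 * cmod s * (C * cmod s ^+ n) by ring.
by rewrite ler_wpM2l ?H// mulr_ge0 ?invr_ge0 ?cmod_ge0.
Qed.

Lemma smoothV f z : f z != 0 -> smooth f z -> smooth (fun x => (f x)^-1) z.
Proof.
by move=> fz0 fz; apply: (@smooth_comp f (fun x => x^-1)) => //; exact: smooth_inv.
Qed.

Lemma smooth_div f g z : g z != 0 -> smooth f z -> smooth g z ->
  smooth (fun x => f x / g x) z.
Proof. by move=> g0 fz gz; apply: smoothM => //; exact: smoothV. Qed.

(** Stands in for the limit t -> 0+ wherever an inequality is known up to an error O(t). *)
Lemma le0_of_small (x K d : R) : 0 < d ->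
  (forall t, 0 < t < d -> x <= K * t) -> x <= 0.
Proof.
move=> d0 H; rewrite leNgt; apply/negP => x0.
pose t := Num.min (d / 2) (x / (`|K| + 1) / 2).
have K1 : 0 < `|K| + 1 by rewrite ltr_wpDl.
have t0 : 0 < t by rewrite lt_min !divr_gt0.
have td : t < d by rewrite gt_min; apply/orP; left; lra.
have := H t; rewrite t0 td => /(_ isT); apply/negP; rewrite -ltNge.
have le2 : (`|K| + 1) * t <= x / 2.
  rewrite mulrC -ler_pdivlMr// mulrAC.
  by rewrite ge_min lexx orbT.
have : K * t <= (`|K| + 1) * t.
  by apply: ler_wpM2r; [exact: ltW | rewrite (le_trans (ler_norm K))// lerDl].
lra.
Qed.

(** The bound is asked off 0 only, so that the hypothesis survives division of p by 'X; p vanishes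
    at 0 by continuity. *)
Lemma poly_bigO_coef n p (C d : R) : 0 < d ->
  (forall s, s != 0 -> cmod s < d -> cmod p.[s] <= C * cmod s ^+ n) ->
  forall i, (i < n)%N -> p`_i = 0.
Proof.
move=> d0; elim: n p => [//|n ih] p H.
have [C' [d' [C'0 d'0 H']]] : bigO_at0 1 (fun s => p.[s] - p.[0]).
  apply: bigO_polyB; [by apply: bigO_le (ltnW _) bigO_id|exact: bigO_cst|].
  by apply: (bigO_eq ltr01 _ bigO_id) => s _; rewrite subr0.
have p0 : p.[0] = 0.
  apply/eqP; rewrite -cmod_eq0 eq_le cmod_ge0 andbT.
  pose m := Num.min 1 (Num.min d d').
  have m0 : 0 < m by rewrite !lt_min ltr01 d0.
  apply: (@le0_of_small _ (C' + `|C|) _ m0) => t /andP[t0].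
  rewrite !lt_min => /and3P[t1 td td'].
  have ct : cmod t%:C = t by rewrite cmod_real ger0_norm ?ltW.
  have tn0 : t%:C != 0 by rewrite -cmod_gt0 ct.
  rewrite -[p.[0]](subKr p.[t%:C]) (le_trans (cmodB _ _))// addrC mulrDl lerD//.
    by have := H' t%:C; rewrite ct expr1 => /(_ td').
  have := H t%:C tn0; rewrite ct => /(_ td)/le_trans; apply.
  rewrite (@le_trans _ _ (`|C| * t ^+ n.+1))//.
    by rewrite ler_wpM2r ?exprn_ge0 ?ler_norm// ltW.
  by apply: ler_wpM2l => //; rewrite exprS; apply: ler_piMr; [|apply: exprn_ile1]; exact: ltW.
have [q pq] : exists q, p = q * 'X.
  have : ('X - 0%:P) %| p by rewrite -root_factor_theorem rootE p0.
  by rewrite subr0 => /Pdiv.Field.dvdpP[q ->]; exists q.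
have qn : forall i, (i < n)%N -> q`_i = 0.
  apply: ih => s s0 sd; have := H s s0 sd.
  rewrite pq hornerM hornerX cmodM exprSr mulrA.
  by rewrite ler_pM2r ?cmod_gt0.
move=> [|i] lti; rewrite pq coefMX//=.
exact: qn.
Qed.

Lemma jet_unique n f z p q : jet n f z p -> jet n f z q ->
  forall i, (i < n)%N -> p`_i = q`_i.
Proof.
move=> fp fq i lti; apply/eqP; rewrite -subr_eq0 -coefB; apply/eqP.
have [C [d [C0 d0 H]]] := bigOB fq fp.
apply: (@poly_bigO_coef n (p - q) C d) => // s _ sd.
have := H s sd; congr (cmod _ <= _); rewrite !hornerE; ring.
Qed.

End Jets.

(** * Complex derivatives with quadratic error, and integration of jets *)

Section Derivatives.
Context {R : realType}.
Local Open Scope complex_scope.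
Implicit Types (f g e u v : R[i] -> R[i]) (z w : R[i]) (p q : {poly R[i]}).

(** The quadratic error makes this a jet of order 2 ([sderiv_jet]), so that the product rule is read
    off from coefficients. *)
Definition sderiv f z l := bigO_at0 2 (fun s => f (z + s) - f z - l * s).

Lemma sderiv_jet f z l : sderiv f z l <-> jet 2 f z ((f z)%:P + l *: 'X).
Proof.
by split; apply: bigO_eq ltr01 _ => s _; rewrite !hornerE opprD addrA.
Qed.

Lemma poly_bigO2 p : bigO_at0 2 (fun s => p.[s] - p`_0 - p`_1 * s).
Proof.
elim/poly_ind: p => [|p c _].
  apply: (@bigO_eq _ _ _ (fun s => 0 * s ^+ 2) 1) => // [s _|].
    by rewrite horner0 !coef0 !mul0r !subrr.
  exact: (bigOM (bigO_cst 0) (bigO_exp 2)).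
elim/poly_ind: p => [|p d _].
  apply: (@bigO_eq _ _ _ (fun s => 0 * s ^+ 2) 1) => // [s _|].
    rewrite mul0r add0r hornerC !coefC /=; ring.
  exact: (bigOM (bigO_cst 0) (bigO_exp 2)).
apply: (bigO_eq ltr01 _ (bigOM (bigO_poly p) (bigO_exp 2))) => s _ /=.
rewrite !hornerE !coefD !coefMX !coefC /= !coefD !coefMX !coefC /=; ring.
Qed.

Lemma jet_sderiv f z p n : (1 < n)%N -> jet n f z p -> sderiv f z p`_1.
Proof.
move=> n1 /(jet_le n1) fp; have p0 := jet_at (ltn0Sn 1) fp.
apply: (bigO_eq ltr01 _ (bigOD fp (poly_bigO2 p))) => s _ /=.
by rewrite -p0 horner_coef0; ring.
Qed.

Lemma sderivM f g z l m : sderiv f z l -> sderiv g z m ->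
  sderiv (fun x => f x * g x) z (l * g z + f z * m).
Proof.
move=> /sderiv_jet fl /sderiv_jet gm.
have := jet_sderiv (ltnSn 1) (jetM fl gm).
rewrite coefM !big_ord_recr big_ord0 /= !coefD !coefC !coefZ !coefX /=.
by congr (sderiv _ _ _); ring.
Qed.

Lemma sderivD f g z l m : sderiv f z l -> sderiv g z m ->
  sderiv (fun x => f x + g x) z (l + m).
Proof.
by move=> fl gm; apply: (bigO_eq ltr01 _ (bigOD fl gm)) => s _ /=; ring.
Qed.

Lemma sderivN f z l : sderiv f z l -> sderiv (fun x => - f x) z (- l).
Proof. by move=> fl; apply: (bigO_eq ltr01 _ (bigON fl)) => s _ /=; ring. Qed.

Lemma sderivB f g z l m : sderiv f z l -> sderiv g z m ->
  sderiv (fun x => f x - g x) z (l - m).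
Proof. by move=> fl gm; apply: sderivD => //; exact: sderivN. Qed.

Lemma sderiv_cst c z : sderiv (fun=> c) z 0.
Proof.
apply: (bigO_eq ltr01 _ (bigOM (bigO_cst 0) (bigO_exp 2))) => s _ /=; ring.
Qed.

Lemma sderiv_id z : sderiv id z 1.
Proof.
apply: (bigO_eq ltr01 _ (bigOM (bigO_cst 0) (bigO_exp 2))) => s _ /=; ring.
Qed.

Lemma sderiv_lipschitz f z l : sderiv f z l ->
  bigO_at0 1 (fun s => f (z + s) - f z).
Proof.
move=> fl; have := bigOM (bigO_cst l) (@bigO_id R); rewrite add0n => ls.
apply: (bigO_eq ltr01 _ (bigOD (bigO_le (ltnW (ltnSn 1)) fl) ls)) => s _ /=.
by ring.
Qed.

Lemma sderiv_comp f g z l m : sderiv f z l -> sderiv g (f z) m ->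
  sderiv (fun x => g (f x)) z (m * l).
Proof.
move=> fl gm; have fs := sderiv_lipschitz fl.
have H := bigOD (bigO_comp gm fs) (bigOM (bigO_cst m) fl).
apply: (bigO_eq ltr01 _ H) => s _ /=.
by rewrite [f z + _]addrC subrK; ring.
Qed.

Lemma smooth_sderiv f z : smooth f z -> exists l, sderiv f z l.
Proof. by move=> /(_ 2) [p fp]; exists p`_1; exact: jet_sderiv fp. Qed.

Lemma sderiv_eq_near f g z l (d : R) : 0 < d ->
  (forall s, cmod s < d -> f (z + s) = g (z + s)) ->
  sderiv g z l -> sderiv f z l.
Proof.
move=> d0 fg; apply: (bigO_eq d0) => s sd.
by have := fg 0; rewrite cmod0 addr0 fg// => ->.
Qed.

Lemma sderiv_poly p z : sderiv (fun x => p.[x]) z p^`().[z].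
Proof.
elim/poly_ind: p => [|p c ih].
  apply: (@sderiv_eq_near _ (fun=> 0) _ _ 1) => // [s _|].
    by rewrite horner0.
  by rewrite deriv0 horner0; exact: sderiv_cst.
apply: (@sderiv_eq_near _ (fun x => p.[x] * x + c) _ _ 1) => // [s _|].
  by rewrite !hornerE.
have := sderivD (sderivM ih (sderiv_id z)) (sderiv_cst c z).
by congr (sderiv _ _ _); rewrite derivD derivM derivX derivC !hornerE; ring.
Qed.

(** The bridge to real derivatives, through which the real mean value and intermediate value
    theorems apply along segments. *)
Lemma is_derive_quadratic (u : R -> R) (t l C d : R) : 0 < d ->
  (forall h, `|h| < d -> `|u (t + h) - u t - l * h| <= C * `|h| ^+ 2) ->
  is_derive t 1 u l.
Proof.
move=> d0 H.
have cv : h^-1 *: ((u \o shift t) (h *: 1) - u t) @[h --> 0^'] --> l.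
  apply/cvgrPdist_le => e e0; near=> h.
  have h0 : h != 0 by near: h; exact: nbhs_dnbhs_neq.
  rewrite /= /shift /= [h *: 1]mulr1 /GRing.scale /= [h + t]addrC.
  rewrite distrC.
  have -> : h^-1 * (u (t + h) - u t) - l = h^-1 * (u (t + h) - u t - l * h).
    by field.
  rewrite normrM normfV mulrC ler_pdivrMr ?normr_gt0//.
  have hd : `|h| < d.
    near: h; apply: dnbhs0_lt; exact: d0.
  rewrite (le_trans (H _ hd))// expr2 mulrA ler_wpM2r//.
  have hC : `|h| < e / (`|C| + 1).
    near: h; apply: dnbhs0_lt; rewrite divr_gt0// ltr_wpDl//.
  rewrite ltr_pdivlMr ?ltr_wpDl// in hC.
  apply: le_trans (ltW hC).
  rewrite mulrC ler_wpM2l// (le_trans (ler_norm C))// lerDl//.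
by split; [apply/cvg_ex; exists l | exact: cvg_lim cv].
Unshelve. all: by end_near.
Qed.

(** A rotation eta makes the increment of F real and nonnegative; the real mean value theorem then
    applies to the real part of eta F on the segment. *)
Lemma mean_value_segment (F f : R[i] -> R[i]) (z s : R[i]) (M : R) :
  (forall t : R, 0 <= t <= 1 -> sderiv F (z + t%:C * s) (f (z + t%:C * s)) /\
    cmod (f (z + t%:C * s)) <= M) ->
  cmod (F (z + s) - F z) <= M * cmod s.
Proof.
move=> H; have [eta [eta1 etaE]] := exists_phase (F (z + s) - F z).
pose u (t : R) := Re (eta * F (z + t%:C * s)).
pose du (t : R) := Re (eta * (f (z + t%:C * s) * s)).
have du' (t : R) : 0 <= t <= 1 -> is_derive t 1 u (du t).
  move=> /H[[C [d [C0 d0 dF]]] _].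
  have s1 : 0 < cmod s + 1 by rewrite ltr_wpDl ?cmod_ge0.
  apply: (@is_derive_quadratic u t (du t) (C * cmod s ^+ 2) (d / (cmod s + 1))).
    by rewrite divr_gt0.
  move=> h hd; have hs : cmod (h%:C * s) < d.
    rewrite cmodM cmod_real; rewrite ltr_pdivlMr// in hd.
    by apply: le_lt_trans hd; rewrite ler_wpM2l// lerDl.
  have dF' := dF _ hs.
  apply: le_trans (_ : cmod (eta * (F (z + t%:C * s + h%:C * s) -
    F (z + t%:C * s) - f (z + t%:C * s) * (h%:C * s))) <= _); last first.
    rewrite cmodM eta1 mul1r (le_trans dF')// le_eqVlt; apply/orP; left.
    by apply/eqP; rewrite cmodM cmod_real; ring.
  apply: le_trans (cmod_ge_Re _); rewrite le_eqVlt; apply/orP; left; apply/eqP.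
  congr `| _ |; rewrite /u /du.
  have -> : (t + h)%:C = t%:C + h%:C by rewrite rmorphD.
  rewrite mulrDl addrA !mulrBr !reD !reN; congr (_ - _).
  have -> : eta * (f (z + t%:C * s) * (h%:C * s)) =
    h%:C * (eta * (f (z + t%:C * s) * s)) by ring.
  by rewrite (reM h%:C) /= mul0r subr0 mulrC.
have uc : {within `[0, 1], continuous u}.
  apply/continuous_in_subspaceT => t; rewrite inE/= in_itv/= => /du' ut.
  by apply/differentiable_continuous/derivable1_diffP; case: ut.
have [c c01 E] := @MVT_segment R u du 0 1 ler01
  (fun t t01 => du' t (ltac:(move: t01; rewrite in_itv/= => /andP[? ?]; by rewrite !ltW))) uc.
have Fu : cmod (F (z + s) - F z) = u 1 - u 0.
  rewrite /u !mul1r mul0r addr0 -reN -reD -mulrN -mulrDr etaE.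
  by [].
rewrite Fu E subr0 mulr1 /du (le_trans (Re_le_cmod _))// !cmodM eta1 mul1r.
rewrite ler_wpM2r ?cmod_ge0//; move: c01; rewrite in_itv/= => /H[] //.
Qed.

Lemma deriv_primitive p : exists2 P : {poly R[i]}, P^`() = p & P.[0] = 0.
Proof.
exists (\poly_(i < (size p).+1) (p`_i.-1 / i%:R)).
  apply/polyP => i; rewrite coef_deriv coef_poly ltnS.
  case: ltnP => [ip|pi]; last by rewrite mul0rn nth_default.
  by rewrite -mulrnAl -[_ *+ _]mulr_natr mulfK// pnatr_eq0.
by rewrite horner_coef0 coef_poly /= invr0 mulr0.
Qed.

(** The error F - P has derivative f - p, which is O(s^n), and the mean value inequality on the
    segment from 0 to s gains one power of s. *)
Lemma jet_integrate n (F f : R[i] -> R[i]) z p (d : R) : 0 < d ->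
  (forall s, cmod s < d -> sderiv F (z + s) (f (z + s))) ->
  jet n f z p ->
  exists P, [/\ P^`() = p, P.[0] = F z & jet n.+1 F z P].
Proof.
move=> d0 dF [C [d' [C0 d'0 fp]]]; have [P Pp P0] := deriv_primitive p.
exists (P + (F z)%:P); split.
- by rewrite derivD derivC addr0.
- by rewrite hornerD hornerC P0 add0r.
exists C, (Num.min d d'); split; rewrite ?lt_min ?d0//.
move=> s; rewrite lt_min => /andP[sd sd'].
pose E x := F (z + x) - P.[x].
have -> : F (z + s) - (P + (F z)%:P).[s] = E (0 + s) - E 0.
  by rewrite /E add0r addr0 !hornerE P0; ring.
rewrite exprSr mulrA.
apply: (@mean_value_segment E (fun x => f (z + x) - p.[x])) => t /andP[t0 t1].
rewrite add0r.
have ts : cmod (t%:C * s) <= cmod s.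
  by rewrite cmodM cmod_real ger0_norm// ler_piMl ?cmod_ge0.
split; last first.
  rewrite (le_trans (fp _ _)) ?(le_lt_trans ts)// ler_wpM2l//.
  by rewrite lerXn2r ?nnegrE ?cmod_ge0.
apply: sderivB; last by rewrite -Pp; exact: sderiv_poly.
have := dF _ (le_lt_trans ts sd); apply: bigO_eq ltr01 _ => x _.
by rewrite addrA.
Qed.

Lemma smooth_integrate (F f : R[i] -> R[i]) z (d : R) : 0 < d ->
  (forall s, cmod s < d -> sderiv F (z + s) (f (z + s))) ->
  smooth f z -> smooth F z.
Proof.
move=> d0 dF fz n; have [p fp] := fz n.
have [P [_ _ FP]] := jet_integrate d0 dF fp.
by exists P; apply: jet_le (leqnSn n) FP.
Qed.

End Derivatives.

(** * Second order estimates for real sine, cosine and exponential *)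

Section RealTrig.
Context {R : realType}.
Implicit Types x y : R.

Lemma sin_mean_value y : 0 <= y -> exists2 c, 0 <= c <= y & sin y = cos c * y.
Proof.
move=> y0; have [|c c0y] := @MVT_segment R sin cos 0 y y0 (fun x _ => is_derive_sin x).
  exact/continuous_subspaceT/continuous_sin.
by rewrite sin0 !subr0; exists c => //; move: c0y; rewrite in_itv.
Qed.

Lemma normr_sin_le y : `|sin y| <= `|y|.
Proof.
wlog y0 : y / 0 <= y.
  move=> H; have [/H//|/ltW y0] := leP 0 y.
  by have := H (- y); rewrite oppr_ge0 sinN !normrN; exact.
have [c _ ->] := sin_mean_value y0.
by rewrite normrM ler_piMl// cos_max.
Qed.

Lemma one_sub_cos_le y : 0 <= 1 - cos y <= y ^+ 2.
Proof.
rewrite subr_ge0 cos_le1/=.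
have -> : y = (y / 2) *+ 2 by rewrite -mulr_natr divfK.
rewrite cos_mulr2n cos2sin2.
have := normr_sin_le (y / 2).
rewrite -(@ler_pXn2r _ 2)// ?nnegrE// !real_normK ?num_real//.
rewrite !mulr2n; set a := y / 2; nra.
Qed.

Lemma sin_sub_id y : `|y| <= 1 -> `|sin y - y| <= y ^+ 2.
Proof.
wlog y0 : y / 0 <= y.
  move=> H y1; have [/H|/ltW y0] := leP 0 y; first exact.
  by have := H (- y); rewrite oppr_ge0 sinN normrN sqrrN -opprD normrN; apply.
rewrite (ger0_norm y0) => y1; have [c /andP[c0 cy] ->] := sin_mean_value y0.
rewrite -[X in _ - X]mul1r -mulrBl normrM (ger0_norm y0) expr2 ler_wpM2r//.
rewrite distrC; have /andP[? le] := one_sub_cos_le c.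
rewrite ger0_norm// (le_trans le)// expr2 (le_trans _ cy)// ler_piMr//.
exact: le_trans cy y1.
Qed.

(** Everything follows from exp y >= 1 + y: at y = x it is the lower bound, and at y = - x it gives
    exp x (1 - x) <= 1, the upper bound. *)
Lemma expR_quad x : `|x| <= 1 / 2 -> `|expR x - 1 - x| <= 2 * x ^+ 2.
Proof.
rewrite ler_norml => /andP[x1 x2].
have l := expR_ge1Dx x; have r := expR_ge1Dx (- x).
have e := expRxMexpNx_1 x; have p := expR_gt0 x.
have Ex : expR x * (1 - x) <= 1 by rewrite -[leRHS]e; apply: ler_wpM2l; first exact: ltW.
rewrite ger0_norm; last lra.
have : 0 <= (expR x - 1 - x) * (1 / 2 - x) by apply: mulr_ge0; lra.
nra.
Qed.

End RealTrig.

(** * The complex exponential and the principal logarithm *)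

Section ComplexExponential.
Context {R : realType}.
Local Open Scope complex_scope.
Implicit Types (z w s : R[i]).

Definition cexp z : R[i] := polar (expR (Re z)) (Im z).

Lemma cexpD z w : cexp (z + w) = cexp z * cexp w.
Proof.
case: z w => [a b] [c d]; rewrite /cexp /polar/= expRD sinD cosD.
by apply: complex_ext; rewrite ?reM ?imM /=; ring.
Qed.

Lemma cexp0 : cexp 0 = 1.
Proof. by rewrite /cexp /polar/= expR0 cos0 sin0 mulr0 mulr1. Qed.

Lemma cmod_polar (r t : R) : cmod (polar r t) = `|r|.
Proof.
apply/eqP; rewrite -(eqrXn2 (ltn0Sn 1)) ?cmod_ge0//; apply/eqP.
by rewrite cmod_sqr /= !exprMn -mulrDr cos2Dsin2 mulr1 real_normK// num_real.
Qed.

Lemma cmod_cexp z : cmod (cexp z) = expR (Re z).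
Proof. by rewrite cmod_polar ger0_norm// expR_ge0. Qed.

Lemma cexp_neq0 z : cexp z != 0.
Proof. by rewrite -cmod_gt0 cmod_cexp expR_gt0. Qed.

Lemma cexpN z : cexp (- z) = (cexp z)^-1.
Proof.
by apply: (mulfI (cexp_neq0 z)); rewrite -cexpD subrr cexp0 divff// cexp_neq0.
Qed.

Lemma cexpB z w : cexp (z - w) = cexp z / cexp w.
Proof. by rewrite cexpD cexpN. Qed.

Lemma cexp_real (x : R) : cexp x%:C = (expR x)%:C.
Proof. by rewrite /cexp /polar /= cos0 sin0 mulr1 mulr0. Qed.

Lemma cexp_quad s : cmod s <= 1 / 2 -> cmod (cexp s - 1 - s) <= 4 * cmod s ^+ 2.
Proof.
move=> s2; have xs := le_trans (cmod_ge_Re s) s2.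
have ys := le_trans (cmod_ge_Im s) s2.
rewrite cmod_sqr; case: s {s2} xs ys => [x y]; rewrite [Re _]/= [Im _]/= => xs ys.
have ex := expR_quad xs; have /andP[c0 c1] := one_sub_cos_le y.
have sy : `|sin y - y| <= y ^+ 2 by apply: sin_sub_id; lra.
have s1 := normr_sin_le y; have c2 := cos_max y.
have ex1 : `|expR x - 1| <= 2 * `|x|.
  have -> : expR x - 1 = (expR x - 1 - x) + x by ring.
  rewrite (le_trans (ler_normD _ _))//.
  have : x ^+ 2 <= `|x| / 2.
    by rewrite -real_normK ?num_real// expr2 ler_wpM2l//; lra.
  lra.
apply: le_trans (cmod_le_ReIm _) _.
rewrite !reD !imD !reN !imN /cexp /polar /= oppr0 addr0.
have -> : expR x * cos y - 1 - x =
  (expR x - 1 - x) * cos y - (1 + x) * (1 - cos y) by ring.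
have -> : expR x * sin y - y = (expR x - 1) * sin y + (sin y - y) by ring.
have A : `|(expR x - 1 - x) * cos y - (1 + x) * (1 - cos y)| <=
   2 * x ^+ 2 + 2 * y ^+ 2.
  rewrite (le_trans (ler_normB _ _))// !normrM lerD//.
    by rewrite (le_trans _ ex)// ler_piMr.
  by rewrite [`|1 - _|]ger0_norm// ler_pM// (le_trans (ler_normD _ _))// normr1; lra.
have B : `|(expR x - 1) * sin y + (sin y - y)| <= x ^+ 2 + 2 * y ^+ 2.
  rewrite (le_trans (ler_normD _ _))// normrM.
  have : `|expR x - 1| * `|sin y| <= 2 * `|x| * `|y| by rewrite ler_pM.
  have : 0 <= (`|x| - `|y|) ^+ 2 by apply: sqr_ge0.
  have := real_normK (num_real x); have := real_normK (num_real y).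
  nra.
have := sqr_ge0 x; have := sqr_ge0 y; lra.
Qed.

Lemma sderiv_cexp z : sderiv cexp z (cexp z).
Proof.
exists (cmod (cexp z) * 4), (1 / 2); split => //.
  by rewrite mulr_ge0// cmod_ge0.
move=> s /ltW s2; rewrite cexpD.
have -> : cexp z * cexp s - cexp z - cexp z * s = cexp z * (cexp s - 1 - s).
  by ring.
by rewrite cmodM -mulrA ler_wpM2l ?cmod_ge0// cexp_quad.
Qed.

(** The exponential is its own derivative, so integrating its jet of order n yields its jet of order
    n + 1. *)
Lemma smooth_cexp z : smooth cexp z.
Proof.
elim=> [|n [p ep]].
  exists 0; apply: (@bigO_eq _ _ _ (fun s => (cexp (z + s) - cexp z) + cexp z) 1) => //.
    by move=> s _; rewrite horner0; ring.
  apply: bigOD; last exact: bigO_cst.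
  exact: bigO_le (leq0n 1) (sderiv_lipschitz (sderiv_cexp z)).
have [P [_ _ ?]] := jet_integrate ltr01 (fun s _ => sderiv_cexp (z + s)) ep.
by exists P.
Qed.

Lemma cexp_inj z w : `|Im z - Im w| < pi *+ 2 -> cexp z = cexp w -> z = w.
Proof.
move=> zw E; have : cexp (z - w) = 1 by rewrite cexpB E divff// cexp_neq0.
move=> E1; have : expR (Re (z - w)) = 1 by rewrite -cmod_cexp E1 cmod1.
move=> E2; have re0 : Re (z - w) = 0 by apply: expR_inj; rewrite expR0.
move: E1; rewrite /cexp E2 /polar !mul1r => -[c1 _].
have im0 : Im (z - w) = 0.
  apply/eqP; apply: contraT; rewrite -normr_gt0 => i0.
  have s0 : 0 < sin (`|Im (z - w)| / 2).
    apply: sin_gt0_pi; rewrite divr_gt0//= ltr_pdivrMr//.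
    by rewrite mulr_natr imD imN.
  have : cos (`|Im (z - w)|) = 1 by rewrite cos_norm.
  rewrite (_ : `|Im (z - w)| = (`|Im (z - w)| / 2) *+ 2); last first.
    by rewrite -mulr_natr divfK.
  rewrite cos_mulr2n cos2sin2 mulr2n; nra.
by apply/eqP; rewrite -subr_eq0; apply/eqP; apply: complex_ext.
Qed.

(* Branch cut along the closed negative real axis. *)
Definition slit z := 0 < cmod z + Re z.

(** The half-angle formula arg z = 2 atan (Im z / (|z| + Re z)) describes the argument by one
    expression on the whole slit plane. *)
Definition Log z : R[i] := ln (cmod z) +i* (atan (Im z / (cmod z + Re z)) *+ 2).

Lemma slit_neq0 z : slit z -> 0 < cmod z.
Proof.
rewrite /slit => z0; rewrite cmod_gt0; apply: contraTN z0 => /eqP ->.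
by rewrite cmod0 add0r ltxx.
Qed.

Lemma Im_Log_bound z : `|Im (Log z)| < pi.
Proof.
rewrite /= -mulr_natr normrM [`|2|]ger0_norm// -ltr_pdivlMr// ltr_norml.
by rewrite atan_gtNpi2 atan_ltpi2.
Qed.

Lemma cexp_Log z : slit z -> cexp (Log z) = z.
Proof.
move=> sz; have z0 := slit_neq0 sz.
have sq := cmod_sqr z; rewrite /cexp /polar /= lnK ?posrE//.
move: sz; rewrite /slit; set t := Im z / _ => sz.
(* Since t is the tangent of half the argument, this is the half-angle formula for the squared
   cosine. *)
have ca : cos (atan t) ^+ 2 = (cmod z + Re z) / (2 * cmod z).
  rewrite cos_atan exprVn sqr_sqrtr ?addr_ge0 ?sqr_ge0//.
  rewrite /t expr_div_n (_ : Im z ^+ 2 = cmod z ^+ 2 - Re z ^+ 2); last first.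
    by rewrite sq; ring.
  have E : (cmod z + Re z) ^+ 2 + (cmod z ^+ 2 - Re z ^+ 2) =
    2 * cmod z * (cmod z + Re z) by ring.
  field; rewrite E !gt_eqF// ?mulr_gt0//.
have c0 : cos (atan t) != 0.
  by rewrite -sqrf_eq0 ca gt_eqF// divr_gt0// mulr_gt0.
have sa : sin (atan t) = t * cos (atan t).
  by rewrite -{2}(atanK t) /tan divfK.
rewrite cos_mulr2n sin_mulr2n sa mulrCA -expr2 ca.
apply: complex_ext => /=; rewrite /t !mulr2n; field; rewrite !gt_eqF//.
Qed.

End ComplexExponential.

(** * Regularity of the principal logarithm *)

Section Logarithm.
Context {R : realType}.
Local Open Scope complex_scope.
Implicit Types (z w s : R[i]).

Lemma ln_dist_le (a b : R) : 0 < a -> a / 2 <= b ->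
  `|ln b - ln a| <= 2 * `|b - a| / a.
Proof.
move=> a0 ab; have b0 : 0 < b by apply: lt_le_trans ab; rewrite divr_gt0.
have ln_le (x y : R) : 0 < x -> 0 < y -> ln x - ln y <= (x - y) / y.
  move=> x0 y0; rewrite -ln_div ?posrE//.
  have -> : x / y = 1 + (x - y) / y by field; rewrite gt_eqF.
  apply: le_ln1Dx; rewrite -subr_gt0 opprK.
  have -> : (x - y) / y + 1 = x / y by field; rewrite gt_eqF.
  by rewrite divr_gt0.
rewrite ler_norml; apply/andP; split.
  rewrite lerNl opprB (le_trans (ln_le _ _ a0 b0))//.
  rewrite distrC (@le_trans _ _ (`|a - b| / b))//.
    by rewrite ler_wpM2r ?ler_norm// invr_ge0 ltW.
  rewrite [2 * _]mulrC -mulrA ler_wpM2l//.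
  by rewrite -[2 / a]invf_div lef_pV2 ?posrE ?divr_gt0.
rewrite (le_trans (ln_le _ _ b0 a0))//.
apply: ler_wpM2r; first by rewrite invr_ge0 ltW.
by rewrite (le_trans (ler_norm _))// ler_peMl ?ler1n.
Qed.

Lemma atan_lipschitz (a b : R) : `|atan a - atan b| <= `|a - b|.
Proof.
wlog ab : a b / b <= a.
  by move=> H; have [/H//|/ltW/H] := leP b a; rewrite distrC [X in _ <= X]distrC.
have [|c _ ->] := @MVT_segment R atan _ b a ab (fun x _ => is_derive1_atan x).
  by apply: continuous_subspaceT => x; exact: continuous_atan.
rewrite normrM ler_piMl// ger0_norm ?invr_ge0 ?addr_ge0 ?sqr_ge0//.
by rewrite invf_le1 ?ltr_wpDr ?sqr_ge0// lerDl sqr_ge0.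
Qed.

Lemma slit_near z : slit z ->
  exists2 d : R, 0 < d & forall s, cmod s < d -> slit (z + s).
Proof.
move=> sz; exists ((cmod z + Re z) / 4); first by rewrite divr_gt0.
move=> s sd; rewrite /slit reD.
have := cmod_ge_sub z s; have := cmod_ge_Re s; rewrite ler_norml => /andP[? ?] ?.
rewrite /slit in sz; have := cmod_ge0 s; lra.
Qed.

(** A crude constant is enough: it only serves to invert the expansion of [cexp] in [sderiv_Log]. *)
Lemma Log_lipschitz z : slit z -> bigO_at0 1 (fun s => Log (z + s) - Log z).
Proof.
move=> sz; have z0 := slit_neq0 sz; rewrite /slit in sz.
set c := cmod z + Re z in sz; set a := cmod z in z0.
exists (2 / a + 2 * (2 * (c + 2 * a) / c ^+ 2)), (Num.min (a / 2) (c / 4)).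
split.
- have a0 := ltW z0; have c0 := ltW sz.
  have : 0 <= 2 / a by apply: divr_ge0.
  have : 0 <= 2 * (c + 2 * a) / c ^+ 2 by apply: divr_ge0; [lra|exact: sqr_ge0].
  lra.
- by rewrite lt_min !divr_gt0.
move=> s; rewrite lt_min => /andP[sa sc]; rewrite expr1 mulrDl.
have s0 := cmod_ge0 s.
have := cmod_ge_Re s; rewrite ler_norml => /andP[r1 r2].
have := cmod_ge_sub z s => zs1.
have d1 : `|cmod (z + s) - a| <= cmod s.
  by rewrite (le_trans (cmod_dist _ _))// addrAC subrr add0r.
have d1' := d1; rewrite ler_norml in d1'; case/andP: d1' => d1a d1b.
apply: le_trans (cmod_le_ReIm _) _; apply: lerD.
  rewrite reD reN /=.
  have /le_trans -> // : `|ln (cmod (z + s)) - ln a| <= 2 * `|cmod (z + s) - a| / a.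
    by apply: ln_dist_le => //; lra.
  by rewrite mulrAC ler_wpM2l// divr_ge0// ltW.
rewrite imD imN /= -mulrnBl normrMn.
rewrite (_ : 2 * (2 * (c + 2 * a) / c ^+ 2) * cmod s =
  2 * (c + 2 * a) / c ^+ 2 * cmod s *+ 2); last by ring.
rewrite ler_pMn2r//.
apply: le_trans (atan_lipschitz _ _) _.
have c'E : cmod (z + s) + Re (z + s) >= c / 2.
  by rewrite reD /c; rewrite /c in sc; lra.
set c' := cmod (z + s) + Re (z + s) in c'E *.
have c'0 : 0 < c' by apply: lt_le_trans c'E; rewrite divr_gt0.
have -> : Im (z + s) / c' - Im z / c =
    (Im s * c - Im z * (c' - c)) / (c * c').
  by rewrite imD; field; rewrite !gt_eqF.
rewrite normrM normfV [`|c * c'|]gtr0_norm ?mulr_gt0// ler_pdivrMr ?mulr_gt0//.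
have N : `|Im s * c - Im z * (c' - c)| <= (c + 2 * a) * cmod s.
  rewrite (le_trans (ler_normB _ _))// mulrDl !normrM; apply: lerD.
    rewrite (gtr0_norm sz) mulrC; apply: ler_wpM2l; first exact: ltW.
    exact: cmod_ge_Im.
  have : `|c' - c| <= 2 * cmod s.
    rewrite /c' /c reD.
    by rewrite ler_norml; apply/andP; split; rewrite /a in d1a d1b *; lra.
  move=> cc; rewrite (_ : 2 * a * cmod s = a * (2 * cmod s)); last by ring.
  by apply: ler_pM => //; exact: cmod_ge_Im.
apply: le_trans N _; rewrite (_ : 2 * (c + 2 * a) / c ^+ 2 * cmod s * (c * c') =
   (c + 2 * a) * cmod s * (c' * 2 / c)); last by field; rewrite gt_eqF.
apply: ler_peMr.
  by apply: mulr_ge0 => //; rewrite addr_ge0 ?mulr_ge0// ltW.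
by rewrite ler_pdivlMr// mul1r -ler_pdivrMr.
Qed.

(** For u = Log (z + s) - Log z, which is O(s), exp u = 1 + s / z; hence exp u - 1 - u = O(u^2) says
    that u = s / z + O(s^2). *)
Lemma sderiv_Log z : slit z -> sderiv Log z z^-1.
Proof.
move=> sz; have [d d0 sd] := slit_near sz.
have z0 : z != 0 by rewrite -cmod_gt0 slit_neq0.
have Lz := Log_lipschitz sz.
have Q := sderiv_cexp (0 : R[i]); rewrite /sderiv cexp0 in Q.
apply: (bigO_eq d0 _ (bigON (bigOM (bigO_cst 1) (bigO_comp Q Lz)))) => s ss /=.
by rewrite add0r cexpB !cexp_Log//; [field | exact: sd].
Qed.

Lemma smooth_Log z : slit z -> smooth Log z.
Proof.
move=> sz; have [d d0 sd] := slit_near sz.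
apply: (@smooth_integrate _ _ (fun x => x^-1) _ d) => //.
  by move=> s ss; exact: sderiv_Log (sd _ ss).
by apply: smooth_inv; rewrite -cmod_gt0 slit_neq0.
Qed.

Lemma slit_cexp z : `|Im z| < pi -> slit (cexp z).
Proof.
move=> zpi; rewrite /slit cmod_cexp /= -{1}[expR _]mulr1 -mulrDr mulr_gt0 ?expR_gt0//.
rewrite -[Im z](divfK (_ : 2 != 0))// mulr_natr cos_mulr2n.
have : 0 < cos (Im z / 2).
  apply: cos_gt0_pihalf; rewrite -ltr_norml normrM [`|2^-1|]gtr0_norm//.
  by rewrite ltr_pM2r.
move=> c0; rewrite addrC subrK -mulr_natl mulr_gt0// exprn_gt0//.
Qed.

Lemma cexpK z : `|Im z| < pi -> Log (cexp z) = z.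
Proof.
move=> zpi; apply: cexp_inj; last by rewrite cexp_Log// slit_cexp.
by rewrite (le_lt_trans (ler_normB _ _))// mulr2n ltrD// Im_Log_bound.
Qed.

Lemma slit_Re_gt0 z : 0 < Re z -> slit z.
Proof. by move=> z0; rewrite /slit ltr_wpDl ?cmod_ge0. Qed.

Lemma Im_Log_Re_gt0 z : 0 < Re z -> `|Im (Log z)| < pi / 2.
Proof.
move=> z0; have -> : Im (Log z) = atan (Im z / (cmod z + Re z)) * 2.
  by rewrite mulr_natr.
rewrite normrM [`|2|]gtr0_norm// -ltr_pdivlMr//.
have -> : pi / 2 / 2 = pi / 4 :> R by field.
have c0 : 0 < cmod z + Re z by rewrite ltr_wpDl ?cmod_ge0.
have t1 : `|Im z / (cmod z + Re z)| < 1.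
  rewrite normrM normfV [`|_ + _|]gtr0_norm// ltr_pdivrMr// mul1r.
  by rewrite (le_lt_trans (cmod_ge_Im z))// ltrDl.
rewrite ltr_norml in t1; case/andP: t1 => t1 t2.
by rewrite ltr_norml -atan1 -atanN !lt_atan.
Qed.

Lemma Log_real (x : R) : 0 < x -> Log x%:C = (ln x)%:C.
Proof.
move=> x0; rewrite -[in LHS](lnK (x:=x)) ?posrE// -cexp_real cexpK//=.
by rewrite normr0 pi_gt0.
Qed.

Lemma Log1 : Log (1 : R[i]) = 0.
Proof. by rewrite Log_real// ln1. Qed.

Lemma Re_cexp_gt0 z : `|Im z| < pi / 2 -> 0 < Re (cexp z).
Proof.
move=> z2; rewrite /= mulr_gt0 ?expR_gt0//; apply: cos_gt0_pihalf.
by rewrite -ltr_norml.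
Qed.

Lemma polar_form z : z != 0 ->
  exists2 t : R, - pi < t <= pi & z = polar (cmod z) t.
Proof.
move=> z0; have zp : 0 < cmod z by rewrite cmod_gt0.
have [sz|nsz] := boolP (slit z).
  exists (Im (Log z)); last by rewrite -{1}(cexp_Log sz) /cexp /= lnK.
  by have := Im_Log_bound z; rewrite ltr_norml => /andP[-> /ltW].
exists pi; first by rewrite lexx andbT gtrN ?pi_gt0.
have Re0 : Re z = - cmod z.
  apply/eqP; rewrite /slit -leNgt in nsz.
  have := cmod_ge_Re z; rewrite ler_norml => /andP[? _].
  by rewrite eq_le; apply/andP; split; lra.
have Im0 : Im z = 0.
  have := cmod_sqr z; rewrite Re0 sqrrN -[LHS]addr0 => /addrI/esym/eqP.
  by rewrite sqrf_eq0 => /eqP.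
by apply: complex_ext; rewrite /polar/= ?cospi ?sinpi ?mulrN1 ?mulr0.
Qed.

End Logarithm.

(** * Geometric decay against polynomial growth *)

Section Geometric.
Context {R : realType}.
Implicit Types (x e : R).

Lemma geom_sumE x n : (1 - x) * (\sum_(i < n) x ^+ i) = 1 - x ^+ n.
Proof.
elim: n => [|n ih]; first by rewrite big_ord0 mulr0 expr0 subrr.
by rewrite big_ord_recr /= mulrDr ih exprS; ring.
Qed.

Lemma geom_sum_le x n : 0 <= x < 1 -> \sum_(i < n) x ^+ i <= (1 - x)^-1.
Proof.
move=> /andP[x0 x1]; have x1' : 0 < 1 - x by rewrite subr_gt0.
rewrite -[leRHS]mul1r ler_pdivlMr// mulrC geom_sumE.
by rewrite lerBlDr lerDl exprn_ge0.
Qed.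

(** Each of the n powers x^i with i < n is at least x^n. *)
Lemma nat_mul_geom_le x n : 0 <= x < 1 -> n%:R * x ^+ n <= (1 - x)^-1.
Proof.
move=> x01; have /andP[x0 x1] := x01; apply: le_trans (geom_sum_le n x01).
have -> : n%:R * x ^+ n = \sum_(i < n) x ^+ n.
  by rewrite sumr_const card_ord mulr_natl.
by apply: ler_sum => i _; apply: ler_wiXn2l => //; [exact: ltW|exact: ltnW].
Qed.

(** Half of the decay, a factor (sqrt x)^n, absorbs one factor n and leaves the claim for k at sqrt
    x. *)
Lemma nat_pow_geom_small (k : nat) x e : 0 <= x < 1 -> 0 < e ->
  exists N, forall n, (N <= n)%N -> n%:R ^+ k * x ^+ n < e.
Proof.
elim: k x e => [|k ih] x e x01 e0; have /andP[x0 x1] := x01.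
  have /cvg_expr/cvgrPdist_lt/(_ e e0)[N _ H] : `|x| < 1 by rewrite ger0_norm.
  exists N => n Nn; rewrite mul1r; have := H n Nn.
  by rewrite sub0r normrN ger0_norm// exprn_ge0.
have s01 : 0 <= Num.sqrt x < 1 by rewrite sqrtr_ge0 -sqrtr1 ltr_sqrt.
have s1 : 0 < 1 - Num.sqrt x by rewrite subr_gt0; case/andP: s01.
have [N HN] := ih _ (e * (1 - Num.sqrt x)) s01 (mulr_gt0 e0 s1).
exists N => n Nn.
have -> : n%:R ^+ k.+1 * x ^+ n =
  (n%:R * Num.sqrt x ^+ n) * (n%:R ^+ k * Num.sqrt x ^+ n).
  rewrite exprS -[in LHS](sqr_sqrtr x0) -exprM mulnC exprM expr2; ring.
apply: le_lt_trans (_ : (1 - Num.sqrt x)^-1 * (n%:R ^+ k * Num.sqrt x ^+ n) < e).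
  apply: ler_wpM2r; last exact: nat_mul_geom_le.
  by rewrite mulr_ge0 ?exprn_ge0 ?sqrtr_ge0.
by rewrite mulrC ltr_pdivrMr// HN.
Qed.

End Geometric.

(** * Limits of complex sequences and sums of power series *)

Section PowerSeries.
Context {R : realType}.
Local Open Scope complex_scope.
Implicit Types (a c : nat -> R[i]) (f : R[i] -> R[i]) (z w : R[i]) (u v : nat -> R[i]).

(** Convergence through the modulus with values in R; [cvg_climP] identifies it with convergence in
    the topology of R[i]. *)
Definition clim u l := forall e : R, 0 < e ->
  exists N, forall n, (N <= n)%N -> cmod (u n - l) < e.

Lemma clim_unique u l m : clim u l -> clim u m -> l = m.
Proof.
move=> ul um; apply/eqP; rewrite -subr_eq0 -cmod_eq0; apply: contraT => lm.
have e0 : 0 < cmod (l - m) / 2 by rewrite divr_gt0// lt_def lm cmod_ge0.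
have [N HN] := ul _ e0; have [M HM] := um _ e0.
have := HN _ (leq_maxl N M); have := HM _ (leq_maxr N M).
have := cmod_triangle l m (u (maxn N M)); rewrite (cmodC l (u _)); lra.
Qed.

Lemma climD u v l m : clim u l -> clim v m -> clim (fun n => u n + v n) (l + m).
Proof.
move=> ul vm e e0; have e2 : 0 < e / 2 by rewrite divr_gt0.
have [N HN] := ul _ e2; have [M HM] := vm _ e2.
exists (maxn N M) => n; rewrite geq_max => /andP[/HN uN /HM vM].
rewrite opprD addrACA (le_lt_trans (cmodD _ _))//; lra.
Qed.

Lemma climM z u l : clim u l -> clim (fun n => z * u n) (z * l).
Proof.
move=> ul e e0; have z1 : 0 < cmod z + 1 by rewrite ltr_wpDl ?cmod_ge0.
have [N HN] := ul (e / (cmod z + 1)) (divr_gt0 e0 z1).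
exists N => n /HN; rewrite ltr_pdivlMr// -mulrBr cmodM => lt.
apply: le_lt_trans lt; rewrite mulrC ler_wpM2l ?cmod_ge0//.
by rewrite lerDl.
Qed.

Lemma clim_cst z : clim (fun=> z) z.
Proof. by move=> e e0; exists 0%N => n _; rewrite subrr cmod0. Qed.

Lemma climS u l : clim u l <-> clim (fun n => u n.+1) l.
Proof.
split=> H e e0; have [N HN] := H e e0.
  by exists N => n Nn; apply: HN; exact: leqW.
by exists N.+1; case=> // n; exact: HN.
Qed.

Lemma clim_ext u v l : u =1 v -> clim u l -> clim v l.
Proof. by move=> uv H e /H[N HN]; exists N => n /HN; rewrite uv. Qed.

Lemma clim_le u l (b : R) : (forall n, cmod (u n) <= b) -> clim u l -> cmod l <= b.
Proof.
move=> ub ul; rewrite leNgt; apply/negP => bl.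
have e0 : 0 < cmod l - b by rewrite subr_gt0.
have [N /(_ N (leqnn N)) HN] := ul _ e0.
have := ub N; have := cmod_dist l (u N); rewrite cmodC in HN.
rewrite ler_norml => /andP[_]; lra.
Qed.

Lemma clim0_le u (v : nat -> R) : (forall n, cmod (u n) <= v n) ->
  (forall e : R, 0 < e -> exists N, forall n, (N <= n)%N -> v n < e) -> clim u 0.
Proof.
move=> uv H e /H[N HN]; exists N => n /HN; rewrite subr0.
exact: le_lt_trans.
Qed.

Lemma series_real_converges (x : nat -> R) (M t : R) : 0 <= t < 1 ->
  (forall n, `|x n| <= M * t ^+ n) ->
  exists l, forall e : R, 0 < e ->
    exists N, forall n, (N <= n)%N -> `|\sum_(i < n) x i - l| < e.
Proof.
move=> /andP[t0 t1] xM; have t1' : `|t| < 1 by rewrite ger0_norm.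
have M0 : 0 <= M by have := xM 0%N; rewrite expr0 mulr1; exact: le_trans.
have cx : cvgn (series x).
  apply: normed_cvg; apply: (series_le_cvg _ _ xM) => //.
    by move=> n; rewrite mulr_ge0 ?exprn_ge0.
  exact: (is_cvg_geometric_series t1').
exists (limn (series x)) => e e0.
have /cvgrPdist_lt/(_ e e0)[N _ H] := cx.
exists N => n Nn; have := H n Nn.
by rewrite distrC seriesEord.
Qed.

Lemma series_converges u (M t : R) : 0 <= t < 1 ->
  (forall n, cmod (u n) <= M * t ^+ n) ->
  exists l, clim (fun n => \sum_(i < n) u i) l.
Proof.
move=> t01 uM.
have [x Hx] := series_real_converges t01 (fun n => le_trans (cmod_ge_Re _) (uM n)).
have [y Hy] := series_real_converges t01 (fun n => le_trans (cmod_ge_Im _) (uM n)).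
have reS n : Re (\sum_(i < n) u i) = \sum_(i < n) Re (u i).
  by elim: n => [|n ih]; rewrite ?big_ord0// !big_ord_recr reD ih.
have imS n : Im (\sum_(i < n) u i) = \sum_(i < n) Im (u i).
  by elim: n => [|n ih]; rewrite ?big_ord0// !big_ord_recr imD ih.
exists (x +i* y) => e e0; have e2 : 0 < e / 2 by rewrite divr_gt0.
have [N HN] := Hx _ e2; have [N' HN'] := Hy _ e2.
exists (maxn N N') => n; rewrite geq_max => /andP[/HN h /HN' h'].
rewrite (le_lt_trans (cmod_le_ReIm _))// reD imD reN imN reS imS /=; lra.
Qed.

Definition psum a z n := \sum_(i < n) a i * z ^+ i.

Definition ps a f := forall z, cmod z < 1 -> clim (psum a z) (f z).

Lemma ps_bound a f (r : R) : ps a f -> 0 <= r < 1 ->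
  exists2 M : R, 0 <= M & forall n, cmod (a n) * r ^+ n <= M.
Proof.
move=> af /andP[r0 r1]; have cr : cmod r%:C = r by rewrite cmod_real ger0_norm.
have [N HN] := af r%:C (eq_rect_r (fun x => x < 1) r1 cr) 1 ltr01.
pose M := \sum_(i < N) cmod (a i) * r ^+ i.
have T n : 0 <= cmod (a n) * r ^+ n by rewrite mulr_ge0 ?cmod_ge0 ?exprn_ge0.
have M0 : 0 <= M by apply: sumr_ge0.
exists (M + 2); first by rewrite addr_ge0.
move=> n; have [nN|Nn] := ltnP n N.
  rewrite ler_wpDr// /M (bigD1 (Ordinal nN))//= lerDl.
  by apply: sumr_ge0.
have h1 := HN _ Nn; have h2 := HN _ (leqW Nn).
have E : cmod (a n) * r ^+ n = cmod (psum a r%:C n.+1 - psum a r%:C n).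
  by rewrite /psum big_ord_recr /= addrAC subrr add0r cmodM cmodX cr.
rewrite E; have := cmod_triangle (psum a r%:C n.+1) (psum a r%:C n) (f r%:C).
rewrite [cmod (f _ - _)]cmodC; lra.
Qed.

Lemma ps_sub_le a f z (r M : R) : ps a f -> cmod z < r -> r < 1 ->
  (forall n, cmod (a n) * r ^+ n <= M) -> cmod (f z) <= M / (1 - cmod z / r).
Proof.
move=> af zr r1 aM; have r0 : 0 < r by apply: le_lt_trans zr; exact: cmod_ge0.
have z1 : cmod z < 1 by apply: lt_trans r1.
have M0 : 0 <= M by apply: le_trans (aM 0%N); rewrite mulr1 cmod_ge0.
have t01 : 0 <= cmod z / r < 1.
  by rewrite divr_ge0 ?cmod_ge0 ?(ltW r0)//= ltr_pdivrMr// mul1r.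
apply: clim_le (af z z1) => n; rewrite (le_trans (cmod_sum _ _ _))//.
apply: le_trans (_ : \sum_(i < n) M * (cmod z / r) ^+ i <= _).
  apply: ler_sum => i _.
  have -> : cmod (a i * z ^+ i) = cmod (a i) * r ^+ i * (cmod z / r) ^+ i.
    rewrite cmodM cmodX expr_div_n; field.
    by rewrite expf_neq0// gt_eqF.
  by apply: ler_wpM2r => //; rewrite exprn_ge0//; case/andP: t01.
by rewrite -mulr_sumr ler_wpM2l// geom_sum_le.
Qed.

End PowerSeries.

(** * Division, expansion and termwise differentiation of power series *)

Section PowerSeriesCalculus.
Context {R : realType}.
Local Open Scope complex_scope.
Implicit Types (a c : nat -> R[i]) (f g : R[i] -> R[i]) (z w : R[i]).

Lemma psumS a z n : psum a z n.+1 = psum a z n + a n * z ^+ n.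
Proof. by rewrite /psum big_ord_recr. Qed.

Lemma psum0 a z : psum a z 0 = 0.
Proof. by rewrite /psum big_ord0. Qed.

(* The coefficients of the divided difference (f z - f z0) / (z - z0) are the
   scaled tails C (i + 1) = sum_k a (i + 1 + k) z0 ^ k. *)
Lemma ps_tails a f z0 : ps a f -> cmod z0 < 1 ->
  exists C : nat -> R[i], [/\ C 0%N = f z0, forall i, C i = a i + z0 * C i.+1 &
    forall r : R, cmod z0 < r < 1 ->
      exists M, forall i, cmod (C i) * r ^+ i <= M].
Proof.
move=> af z01.
have bnd (r : R) i k (M : R) : cmod z0 < r < 1 ->
    (forall n, cmod (a n) * r ^+ n <= M) ->
    cmod (a (i + k)%N * z0 ^+ k) <= M / r ^+ i * (cmod z0 / r) ^+ k.
  move=> /andP[zr r1] aM; have r0 : 0 < r by apply: le_lt_trans zr; exact: cmod_ge0.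
  have -> : cmod (a (i + k)%N * z0 ^+ k) =
      cmod (a (i + k)%N) * r ^+ (i + k) / r ^+ i * (cmod z0 / r) ^+ k.
    rewrite cmodM cmodX expr_div_n exprD; field.
    by rewrite !expf_neq0// gt_eqF.
  apply: ler_wpM2r; first by rewrite exprn_ge0// divr_ge0 ?cmod_ge0// ltW.
  by apply: ler_wpM2r => //; rewrite invr_ge0 exprn_ge0// ltW.
have ratio (r : R) : cmod z0 < r < 1 -> 0 <= cmod z0 / r < 1.
  move=> /andP[zr r1]; have r0 : 0 < r by apply: le_lt_trans zr; exact: cmod_ge0.
  by rewrite divr_ge0 ?cmod_ge0 ?(ltW r0)//= ltr_pdivrMr// mul1r.
have cvgC i : exists l, clim (fun n => \sum_(k < n) a (i + k)%N * z0 ^+ k) l.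
  have zr : cmod z0 < (cmod z0 + 1) / 2 < 1 by apply/andP; split; lra.
  have r01 : 0 <= (cmod z0 + 1) / 2 < 1.
    by case/andP: zr => [/ltW zr ->]; rewrite (le_trans _ zr)// cmod_ge0.
  have [M M0 aM] := ps_bound af r01.
  apply: (@series_converges _ (fun k => a (i + k)%N * z0 ^+ k)
    (M / ((cmod z0 + 1) / 2) ^+ i) _ (ratio _ zr)) => k.
  exact: bnd zr aM.
have [C HC] := choice cvgC; exists C; split.
- by apply: clim_unique (HC 0%N) (af z0 z01).
- move=> i; apply: clim_unique (HC i) _; apply/climS.
  apply: clim_ext (climD (clim_cst (a i)) (climM z0 (HC i.+1))) => n /=.
  rewrite big_ord_recl /= addn0 mulr1; congr (_ + _).
  rewrite mulr_sumr; apply: eq_bigr => k _.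
  by rewrite /bump /= add1n addnS addSn exprS; ring.
move=> r zr; have /andP[zr1 r1] := zr.
have r0 : 0 < r by apply: le_lt_trans zr1; exact: cmod_ge0.
have r01 : 0 <= r < 1 by rewrite ltW.
have [M M0 aM] := ps_bound af r01.
exists (M / (1 - cmod z0 / r)) => i.
rewrite -ler_pdivlMr ?exprn_gt0//.
apply: clim_le (HC i) => n; rewrite (le_trans (cmod_sum _ _ _))//.
apply: le_trans (_ : \sum_(k < n) M / r ^+ i * (cmod z0 / r) ^+ k <= _).
  by apply: ler_sum => k _; exact: bnd.
rewrite -mulr_sumr [leRHS]mulrAC; apply: ler_wpM2l; last exact: geom_sum_le (ratio _ zr).
by rewrite divr_ge0// exprn_ge0// ltW.
Qed.

(** Used with k = 0 for the remainder of the divided difference, and with k = 1 for the boundary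
    term in its value at z0. *)
Lemma ps_geom_small (C : nat -> R[i]) (r M : R) z k : cmod z < r ->
  (forall i, cmod (C i) * r ^+ i <= M) ->
  clim (fun n => n%:R ^+ k * (C n * z ^+ n)) 0.
Proof.
move=> zr CM; have r0 : 0 < r by apply: le_lt_trans zr; exact: cmod_ge0.
have M0 : 0 <= M by apply: le_trans (CM 0%N); rewrite mulr1 cmod_ge0.
have t01 : 0 <= cmod z / r < 1.
  by rewrite divr_ge0 ?cmod_ge0 ?(ltW r0)//= ltr_pdivrMr// mul1r.
apply: (@clim0_le _ _ (fun n => M * (n%:R ^+ k * (cmod z / r) ^+ n))) => [n|e e0].
  rewrite !cmodM !cmodX cmod_nat [leRHS]mulrCA; apply: ler_wpM2l; first by rewrite exprn_ge0.
  have -> : cmod (C n) * cmod z ^+ n = cmod (C n) * r ^+ n * (cmod z / r) ^+ n.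
    by rewrite expr_div_n; field; rewrite expf_neq0// gt_eqF.
  by apply: ler_wpM2r => //; rewrite exprn_ge0//; case/andP: t01.
have M1 : 0 < M + 1 by rewrite ltr_wpDl.
have [N HN] := nat_pow_geom_small k t01 (divr_gt0 e0 M1).
exists N => n /HN; rewrite ltr_pdivlMr// mulrC; apply: le_lt_trans.
apply: ler_wpM2r; last by rewrite lerDl.
by rewrite mulr_ge0 ?exprn_ge0//; case/andP: t01.
Qed.

Lemma mid_radius z w : cmod z < 1 -> cmod w < 1 ->
  exists r : R, [/\ cmod z < r, cmod w < r & r < 1].
Proof.
move=> z1 w1; exists ((Num.max (cmod z) (cmod w) + 1) / 2).
have : Num.max (cmod z) (cmod w) < 1 by rewrite gt_max z1 w1.
have : cmod z <= Num.max (cmod z) (cmod w) by rewrite le_max lexx.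
have : cmod w <= Num.max (cmod z) (cmod w) by rewrite le_max lexx orbT.
by move=> *; split; lra.
Qed.

(** As g is again the sum of a power series, the division can be repeated, which yields expansions
    of all orders at z0. The last clause identifies g z0 with the termwise derivative. *)
Lemma ps_divide a f z0 : ps a f -> cmod z0 < 1 ->
  exists c g, [/\ ps c g, forall z, cmod z < 1 -> f z = f z0 + (z - z0) * g z &
    clim (fun n => psum (fun k => k.+1%:R * a k.+1) z0 n) (g z0)].
Proof.
move=> af z01; have [C [C0 CS CM]] := ps_tails af z01.
pose c i := C i.+1.
have cM (r : R) : cmod z0 < r < 1 -> exists M : R, forall i, cmod (c i) * r ^+ i <= M.
  move=> zr; have [M HM] := CM r zr; exists (M / r) => i.
  have r0 : 0 < r by case/andP: zr => [zr _]; apply: le_lt_trans zr; exact: cmod_ge0.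
  by rewrite ler_pdivlMr// -mulrA /c -exprSr; exact: HM.
have cvg z : exists l, cmod z < 1 -> clim (psum c z) l.
  have [z1|] := boolP (cmod z < 1); last by exists 0.
  have [r [zr z0r r1]] := mid_radius z1 z01.
  have r0 : 0 < r by apply: le_lt_trans zr; exact: cmod_ge0.
  have [M HM] : exists M : R, forall i, cmod (c i) * r ^+ i <= M.
    by apply: cM; rewrite z0r r1.
  have [//||l Hl] := @series_converges _ (fun i => c i * z ^+ i) M (cmod z / r).
  - by rewrite divr_ge0 ?cmod_ge0 ?(ltW r0)//= ltr_pdivrMr// mul1r.
  - move=> n; have -> : cmod (c n * z ^+ n) =
        cmod (c n) * r ^+ n * (cmod z / r) ^+ n.
      by rewrite cmodM cmodX expr_div_n; field; rewrite expf_neq0// gt_eqF.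
    apply: ler_wpM2r => //; rewrite exprn_ge0// divr_ge0 ?cmod_ge0//.
    exact: ltW.
  - by exists l.
have [g Hg] := choice cvg; exists c, g; split => //.
  move=> z z1; have [r [zr z0r r1]] := mid_radius z1 z01.
  have [M HM] := CM r ltac:(by rewrite z0r r1).
  (* The recurrence of the tails makes this exact for every n, and the error C n z^n tends to 0. *)
  have E n : f z0 + (z - z0) * psum c z n = psum a z n + C n * z ^+ n.
    elim: n => [|n ih]; first by rewrite !psum0 mulr0 add0r addr0 mulr1 C0.
    by rewrite !psumS mulrDr addrA ih /c (CS n) exprS; ring.
  apply: (@clim_unique _ (fun n => psum a z n + C n * z ^+ n)).
    rewrite -[f z]addr0; apply: climD; first exact: af.
    apply: clim_ext (ps_geom_small 0 zr HM) => n /=.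
    by rewrite expr0 mul1r.
  apply: (clim_ext (fun n => E n)); apply: climD; first exact: clim_cst.
  by apply: climM; exact: Hg.
have [r [_ z0r r1]] := mid_radius z01 z01.
have [M HM] := CM r ltac:(by rewrite z0r r1).
(* Summation by parts: the partial sums of the tails and those of the derived series differ by a
   boundary term with factor n. *)
have E n : psum c z0 n - n%:R ^+ 1 * (c n * z0 ^+ n) =
    psum (fun k => k.+1%:R * a k.+1) z0 n.
  elim: n => [|n ih]; first by rewrite !psum0 mul0r subrr.
  rewrite !psumS -ih.
  have -> : a n.+1 = C n.+1 - z0 * C n.+2 by rewrite (CS n.+1) addrK.
  by rewrite /c (exprS z0 n) -[n.+1%:R]natr1; ring.
have [Mc HMc] := cM r ltac:(by rewrite z0r r1).
apply: clim_ext E _; rewrite -[g z0]subr0; apply: climD; first exact: Hg.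
rewrite -mulN1r; apply: clim_ext (climM (-1) (ps_geom_small 1 z0r HMc)) => n /=.
by rewrite mulN1r.
Qed.

Lemma cmodD_lt1 z s : cmod s < 1 - cmod z -> cmod (z + s) < 1.
Proof. by move=> sd; rewrite (le_lt_trans (cmodD _ _))// addrC -ltrBrDr. Qed.

Lemma ps_smooth a f z0 : ps a f -> cmod z0 < 1 -> smooth f z0.
Proof.
move=> + z01 n; elim: n a f => [|n ih] a f af.
  have [r [zr _ r1]] := mid_radius z01 z01.
  have r0 : 0 < r by apply: le_lt_trans zr; exact: cmod_ge0.
  have r01 : 0 <= r < 1 by rewrite (ltW r0).
  have [M M0 HM] := ps_bound af r01.
  exists 0, (M / (1 - (cmod z0 + r) / 2 / r)), ((r - cmod z0) / 2).
  have H1 : (cmod z0 + r) / 2 / r < 1 by rewrite ltr_pdivrMr// mul1r; lra.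
  split; [by rewrite divr_ge0// subr_ge0 ltW|by lra|] => s sr.
  have zs : cmod (z0 + s) < (cmod z0 + r) / 2.
    by rewrite (le_lt_trans (cmodD _ _))//; lra.
  rewrite horner0 subr0 expr0 mulr1 (le_trans (ps_sub_le af _ r1 HM))//.
    by apply: lt_trans zs _; lra.
  apply: ler_wpM2l => //; rewrite lef_pV2 ?posrE ?subr_gt0//; last first.
    rewrite ltr_pdivrMr// mul1r; apply: lt_trans zs _; lra.
  by rewrite lerD2l lerN2 ler_pM2r ?invr_gt0// ltW.
have [c [g [cg fE _]]] := ps_divide af z01; have [p gp] := ih _ _ cg.
exists ((f z0)%:P + 'X * p).
have d0 : 0 < 1 - cmod z0 by rewrite subr_gt0.
apply: (bigO_eq d0 _ (bigOM (@bigO_id R) gp)) => s sd.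
rewrite fE ?(cmodD_lt1 sd)// [z0 + s - z0]addrAC subrr add0r !hornerE; ring.
Qed.

Lemma ps_sderiv a f : ps a f ->
  exists2 df, ps (fun k => k.+1%:R * a k.+1) df &
    forall z, cmod z < 1 -> sderiv f z (df z).
Proof.
move=> af; have H z : exists l, cmod z < 1 ->
    clim (psum (fun k => k.+1%:R * a k.+1) z) l /\ sderiv f z l.
  have [z1|] := boolP (cmod z < 1); last by exists 0.
  have [c [g [cg fE lim]]] := ps_divide af z1; exists (g z) => _; split => //.
  have d0 : 0 < 1 - cmod z by rewrite subr_gt0.
  have := bigOM (@bigO_id R) (smooth_lipschitz (ps_smooth cg z1)).
  apply: bigO_eq d0 _ => s sd.
  by rewrite fE ?(cmodD_lt1 sd)// [z + s - z]addrAC subrr add0r; ring.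
by have [df Hdf] := choice H; exists df => z z1; have [] := Hdf z z1.
Qed.

Lemma ps_shift a f : ps a f -> exists2 g, ps (fun k => a k.+1) g &
  forall z, cmod z < 1 -> f z = a 0%N + z * g z.
Proof.
move=> af; pose g z := if z == 0 then a 1%N else (f z - a 0%N) / z.
have z01 : cmod (0 : R[i]) < 1 by rewrite cmod0.
have psum_at0 (c : nat -> R[i]) n : psum c 0 n.+1 = c 0%N.
  rewrite /psum big_ord_recl expr0 mulr1 big1 ?addr0// => i _.
  by rewrite expr0n /= mulr0.
have f0 : f 0 = a 0%N.
  apply: clim_unique (af 0 z01) _; apply/climS.
  by apply: clim_ext (clim_cst (a 0%N)) => n'; rewrite psum_at0.
exists g => z z1; rewrite /g; have [->|zn0] := eqVneq z 0.
- by apply/climS; apply: clim_ext (clim_cst (a 1%N)) => n; rewrite psum_at0.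
- have /climS H := af z z1.
  have := climM z^-1 (climD H (clim_cst (- a 0%N))).
  rewrite mulrC; apply: clim_ext => n.
  rewrite /psum big_ord_recl expr0 mulr1 addrAC subrr add0r mulr_sumr.
  by apply: eq_bigr => i _; rewrite lift0 exprS; field.
- by rewrite f0 mul0r addr0.
- by field.
Qed.

Lemma ps_jet0 a f n : ps a f -> jet n f 0 (\poly_(i < n) a i).
Proof.
elim: n a f => [|n ih] a f af.
  have [p fp] := ps_smooth af (eq_rect_r (fun x => x < 1) ltr01 (@cmod0 R)) 0.
  apply: (bigO_eq ltr01 _ (jet_bounded fp)) => s _.
  by rewrite poly_def big_ord0 horner0 subr0.
have [g cg fE] := ps_shift af.
apply: (bigO_eq ltr01 _ (bigOM (@bigO_id R) (ih _ _ cg))) => s s1.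
rewrite !add0r fE// !horner_poly big_ord_recl expr0 mulr1.
have -> : \sum_(i < n) a (lift ord0 i) * s ^+ lift ord0 i =
    s * \sum_(i < n) a i.+1 * s ^+ i.
  by rewrite mulr_sumr; apply: eq_bigr => i _; rewrite lift0 exprS; ring.
ring.
Qed.

End PowerSeriesCalculus.

(** * The maximum principle on annuli *)

Section MaximumPrinciple.
Context {R : realType}.
Local Open Scope complex_scope.
Implicit Types (f g : R[i] -> R[i]) (z w s : R[i]).

Lemma continuous_pair (v : R * R -> R) (p : R * R) :
  (forall e : R, 0 < e -> exists2 d : R, 0 < d & forall x, `|x.1 - p.1| < d ->
    `|x.2 - p.2| < d -> `|v x - v p| < e) -> {for p, continuous v}.
Proof.
move=> H; apply/cvgrPdist_lt => e e0; have [d d0 vd] := H e e0.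
have := nbhsx_ballx p d d0; apply: filterS => x [/= x1 x2].
by rewrite distrC; apply: vd; rewrite distrC.
Qed.

Lemma annulus_max (v : R[i] -> R) (e r : R) :
  (forall z, e <= cmod z <= r -> forall eps : R, 0 < eps ->
    exists2 d : R, 0 < d & forall s, cmod s < d -> `|v (z + s) - v z| < eps) ->
  (exists w : R[i], e <= cmod w <= r) ->
  exists2 z, e <= cmod z <= r & forall w, e <= cmod w <= r -> v w <= v z.
Proof.
move=> cv [w0 w0K]; pose A := [set p : R * R | e <= cmod (p.1 +i* p.2) <= r].
have cA : compact A.
  apply: (@subclosed_compact _ _ (`[- r, r] `*` `[- r, r])).
  - have -> : A = (fun p : R * R => cmod (p.1 +i* p.2)) @^-1` `[e, r].
      by apply/seteqP; split => p; rewrite /A /= in_itv.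
    apply: preimage_closed; last exact: itv_closed.
    move=> p _; apply: continuous_pair => eps e0; exists (eps / 2).
      by rewrite divr_gt0.
    move=> x x1 x2; apply: le_lt_trans (cmod_dist _ _) _.
    apply: le_lt_trans (cmod_le_ReIm _) _.
    by rewrite reD imD reN imN /=; lra.
  - by apply: compact_setX; exact: segment_compact.
  - move=> [x y] /= /andP[_ xyr]; rewrite !in_itv /= -!ler_norml.
    split; [apply: le_trans (cmod_ge_Re (x +i* y)) xyr|
      apply: le_trans (cmod_ge_Im (x +i* y)) xyr].
have cvA : {within A, continuous (fun p : R * R => v (p.1 +i* p.2))}.
  apply: continuous_in_subspaceT => p; rewrite inE => pA.
  apply: continuous_pair => eps e0; have [d d0 Hd] := cv _ pA eps e0.
  exists (d / 2); first by rewrite divr_gt0.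
  move=> x x1 x2.
  have -> : x.1 +i* x.2 = (p.1 +i* p.2) + ((x.1 - p.1) +i* (x.2 - p.2)).
    by apply: complex_ext; rewrite ?reD ?imD /=; ring.
  by apply: Hd; apply: le_lt_trans (cmod_le_ReIm _) _ => /=; lra.
have [|[x y]] := compact_EVT_max _ cA cvA.
  by exists (Re w0, Im w0); rewrite /A /=; move: w0K; case: w0.
rewrite inE => xyA Hmax; exists (x +i* y) => // w wK.
have := Hmax (Re w, Im w); rewrite inE /A /=.
by case: w wK => a b wK; exact.
Qed.

Lemma jet_take n f z p : jet n f z p -> jet n f z (take_poly n p).
Proof.
move=> fp.
have H := bigOD fp (bigOM (bigO_poly (drop_poly n p)) (bigO_exp n)).
apply: (bigO_eq ltr01 _ H) => s _ /=.
by rewrite -{2}(poly_take_drop n p) hornerD hornerM hornerXn; ring.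
Qed.

Lemma smooth_quadratic f z : smooth f z -> exists l1 l2,
  bigO_at0 3 (fun s => f (z + s) - (f z + l1 * s + l2 * s ^+ 2)).
Proof.
move=> /(_ 3)[p /jet_take fp]; exists p`_1, p`_2.
have p0 := jet_at (ltn0Sn 2) fp; apply: bigO_eq ltr01 _ fp => s _.
rewrite -p0 /take_poly !horner_poly !big_ord_recr !big_ord0 /=.
by rewrite !expr0n /= !mulr0 !expr0 !mulr1 !expr1; ring.
Qed.

Lemma parallelogram z w :
  cmod (z + w) ^+ 2 + cmod (z - w) ^+ 2 = 2 * cmod z ^+ 2 + 2 * cmod w ^+ 2.
Proof.
by rewrite !cmod_sqr; case: z w => [a b] [c d]; rewrite /=; ring.
Qed.

(* Averaging over the four points i^k d kills the cross terms. *)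
Lemma four_points (a b c : R[i]) (d : R) :
  let P s := cmod (a + b * s + c * s ^+ 2) ^+ 2 in
  P d%:C + P (- d%:C) + (P ('i * d%:C) + P (- ('i * d%:C))) =
  4 * cmod a ^+ 2 + 4 * d ^+ 2 * cmod b ^+ 2 + 4 * d ^+ 4 * cmod c ^+ 2.
Proof.
have pair s : cmod (a + b * s + c * s ^+ 2) ^+ 2 +
    cmod (a + b * - s + c * (- s) ^+ 2) ^+ 2 =
    2 * cmod (a + c * s ^+ 2) ^+ 2 + 2 * (cmod b * cmod s) ^+ 2.
  by rewrite -cmodM -parallelogram; congr (cmod _ ^+ 2 + cmod _ ^+ 2); ring.
have i2 : 'i * 'i = -1 :> R[i] by apply: complex_ext; rewrite /= ?oppr0; ring.
have i1 : cmod ('i : R[i]) = 1 by rewrite /= expr0n expr1n add0r sqrtr1.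
move=> P; rewrite /P !pair cmodM i1 cmod_real mul1r.
have -> : c * ('i * d%:C) ^+ 2 = - (c * d%:C ^+ 2).
  by rewrite exprMn [X in c * (X * _)]expr2 i2; ring.
have := parallelogram a (c * d%:C ^+ 2); rewrite cmodM cmodX cmod_real.
have -> : (cmod b * `|d|) ^+ 2 = d ^+ 2 * cmod b ^+ 2.
  by rewrite exprMn real_normK ?num_real// mulrC.
have -> : (cmod c * `|d| ^+ 2) ^+ 2 = d ^+ 4 * cmod c ^+ 2.
  by rewrite real_normK ?num_real// exprMn -exprM mulrC.
lra.
Qed.

(** The term eta |z|^2 makes the function strictly subharmonic: over the points z + i^k t its mean
    exceeds the central value by at least eta t^2, up to a cubic remainder. *)
Lemma no_interior_max f z (eta C d : R) l1 l2 :
  0 < eta -> 0 < d -> 0 <= C ->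
  (forall s, cmod s < d ->
     cmod (f (z + s) - (f z + l1 * s + l2 * s ^+ 2)) <= C * cmod s ^+ 3) ->
  exists2 s, cmod s < d &
    cmod (f z) ^+ 2 + eta * cmod z ^+ 2 <
    cmod (f (z + s)) ^+ 2 + eta * cmod (z + s) ^+ 2.
Proof.
move=> eta0 d0 C0 fE; pose B := cmod (f z) + cmod l1 + cmod l2.
have B0 : 0 <= B by rewrite !addr_ge0 ?cmod_ge0.
have BC : 0 < B * C + 1 by rewrite ltr_wpDl// mulr_ge0.
(* The last entry makes the total remainder 8 B C t^3 smaller than the total gain 4 eta t^2. *)
pose t := Num.min (d / 2) (Num.min 1 (eta / (B * C + 1) / 4)).
have t0 : 0 < t by rewrite !lt_min ltr01 !divr_gt0.
have td : t < d by rewrite gt_min; apply/orP; left; lra.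
have t1 : t <= 1 by rewrite !ge_min lexx /= orbT.
have tBC : 4 * (B * C + 1) * t <= eta.
  have : t <= eta / (B * C + 1) / 4 by rewrite !ge_min lexx !orbT.
  by rewrite -ler_pdivlMl ?mulr_gt0// => /le_trans -> //; rewrite invfM le_eqVlt; apply/orP; left; apply/eqP; ring.
apply: contrapT => H.
have {}H s : cmod s = t -> cmod (f (z + s)) ^+ 2 + eta * cmod (z + s) ^+ 2 <=
    cmod (f z) ^+ 2 + eta * cmod z ^+ 2.
  move=> st; rewrite leNgt; apply/negP => lt; apply: H.
  by exists s => //; rewrite st.
have lower s : cmod s = t -> cmod (f z + l1 * s + l2 * s ^+ 2) ^+ 2 -
    2 * B * C * t ^+ 3 <= cmod (f (z + s)) ^+ 2.
  move=> st; have sd : cmod s < d by rewrite st.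
  have := fE s sd; rewrite st; set P := f z + _ + _ => PE.
  have PB : cmod P <= B.
    rewrite /P (le_trans (cmodD _ _))//.
    apply: le_trans (lerD (cmodD _ _) (lexx _)) _.
    rewrite (cmodM l1) (cmodM l2) cmodX st /B; apply: lerD; first apply: lerD => //.
      by rewrite ler_piMr ?cmod_ge0.
    by rewrite ler_piMr ?cmod_ge0// exprn_ile1// ltW.
  have := cmod_dist P (f (z + s)); rewrite cmodC => /le_trans/(_ PE).
  rewrite ler_norml => /andP[_ h1].
  have h2 := cmod_ge0 (f (z + s)); have h3 := cmod_ge0 P.
  have T0 : 0 <= C * t ^+ 3 by rewrite mulr_ge0 ?exprn_ge0// ltW.
  have [PT|TP] := leP (cmod P) (C * t ^+ 3).
    have : cmod P ^+ 2 <= B * (C * t ^+ 3) by rewrite expr2 ler_pM.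
    have := sqr_ge0 (cmod (f (z + s))).
    have : 0 <= B * (C * t ^+ 3) by rewrite mulr_ge0.
    by rewrite -!mulrA; lra.
  have : (cmod P - C * t ^+ 3) ^+ 2 <= cmod (f (z + s)) ^+ 2.
    by rewrite lerXn2r ?nnegrE ?subr_ge0 ?(ltW TP)//; lra.
  have : cmod P * (C * t ^+ 3) <= B * (C * t ^+ 3) by rewrite ler_wpM2r.
  have := sqr_ge0 (C * t ^+ 3).
  have -> : 2 * B * C * t ^+ 3 = 2 * (B * (C * t ^+ 3)) by ring.
  rewrite sqrrB; nra.
have ct : cmod t%:C = t by rewrite cmod_real gtr0_norm.
have ci : cmod ('i * t%:C) = t.
  by rewrite cmodM ct /= expr0n expr1n add0r sqrtr1 mul1r.
have four := four_points (f z) l1 l2 t.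
have Ez := four_points z 1 0 t; cbv zeta beta in Ez; rewrite !mul0r !mul1r !addr0 cmod0 cmod1 in Ez.
have h1 := H _ ct; have h2 := H (- t%:C) ltac:(by rewrite cmodN).
have h3 := H _ ci; have h4 := H (- ('i * t%:C)) ltac:(by rewrite cmodN).
have l1' := lower _ ct; have l2' := lower (- t%:C) ltac:(by rewrite cmodN).
have l3 := lower _ ci; have l4 := lower (- ('i * t%:C)) ltac:(by rewrite cmodN).
have : 8 * (B * C * t ^+ 3) < 4 * (eta * t ^+ 2).
  have : 0 < t ^+ 2 by rewrite exprn_gt0.
  rewrite (exprS t 2); set T := t ^+ 2; nra.
have : 0 <= 4 * t ^+ 2 * cmod l1 ^+ 2 by rewrite mulr_ge0 ?sqr_ge0// mulr_ge0 ?sqr_ge0.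
have : 0 <= 4 * t ^+ 4 * cmod l2 ^+ 2.
  by rewrite mulr_ge0 ?sqr_ge0// mulr_ge0// exprn_ge0// ltW.
have {}Ez := congr1 (fun x => eta * x) Ez; cbv beta in Ez.
cbv zeta beta in four.
lra.
Qed.

(** By compactness |f|^2 + eta |z|^2 has a maximum, which lies on the boundary by [no_interior_max];
    then eta tends to 0. A negative e turns the annulus into the disk of radius r. *)
Lemma max_principle0 f (e r M : R) :
  (forall z, e <= cmod z <= r -> smooth f z) ->
  (forall z, e <= cmod z <= r -> cmod z = e \/ cmod z = r -> cmod (f z) <= M) ->
  forall z, e <= cmod z <= r -> cmod (f z) <= M.
Proof.
move=> sf bM w wK.
have r0 : 0 <= r by case/andP: wK => _; apply: le_trans; exact: cmod_ge0.
(* The sign of M is recorded along the way, from a boundary point where |f| <= M; it allows taking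
   square roots at the end. *)
have key (eta : R) : 0 < eta -> 0 <= M /\ cmod (f w) ^+ 2 <= M ^+ 2 + eta * r ^+ 2.
  move=> eta0; pose v z := cmod (f z) ^+ 2 + eta * cmod z ^+ 2.
  have [z zK vmax] : exists2 z, e <= cmod z <= r &
      forall w, e <= cmod w <= r -> v w <= v z.
    apply: annulus_max; last by exists w.
    move=> z zK eps eps0; have [C [d [C0 d0 fC]]] := smooth_lipschitz (sf z zK).
    pose A := cmod (f z); pose B := cmod z.
    have A0 : 0 <= A := cmod_ge0 _; have B0 : 0 <= B := cmod_ge0 _.
    pose L := C * (2 * A + C) + eta * (2 * B + 1) + 1.
    have L0 : 0 < L.
      by rewrite ltr_wpDl// addr_ge0// mulr_ge0 ?addr_ge0 ?mulr_ge0// ltW.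
    exists (Num.min d (Num.min 1 (eps / L))).
      by rewrite !lt_min d0 ltr01 divr_gt0.
    move=> s; rewrite !lt_min => /and3P[sd s1]; rewrite ltr_pdivlMr// => sL.
    have := fC s sd; rewrite expr1 => fs.
    have s0 := cmod_ge0 s.
    have h1 := le_trans (cmod_dist _ _) fs.
    have h2 : `|cmod (z + s) - B| <= cmod s.
      by rewrite (le_trans (cmod_dist _ _))// addrAC subrr add0r.
    have sq (x y k : R) : 0 <= k -> 0 <= x -> `|y - x| <= k * cmod s ->
        `|y ^+ 2 - x ^+ 2| <= k * (2 * x + k) * cmod s.
      move=> k0 x0 h; rewrite subr_sqr normrM.
      have : `|y + x| <= 2 * x + k.
        have -> : y + x = (y - x) + 2 * x by ring.
        rewrite (le_trans (ler_normD _ _))// [`|2 * x|]ger0_norm ?mulr_ge0//.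
        by rewrite addrC lerD2l (le_trans h)// ler_piMr// ltW.
      move=> h'; rewrite mulrAC; exact: ler_pM.
    have q1 := sq _ _ C C0 A0 h1.
    have q2 : `|cmod (z + s) ^+ 2 - B ^+ 2| <= 1 * (2 * B + 1) * cmod s.
      by apply: sq; rewrite ?mul1r.
    rewrite /v -/A -/B.
    have -> : cmod (f (z + s)) ^+ 2 + eta * cmod (z + s) ^+ 2 -
        (A ^+ 2 + eta * B ^+ 2) = (cmod (f (z + s)) ^+ 2 - A ^+ 2) +
        eta * (cmod (z + s) ^+ 2 - B ^+ 2) by ring.
    apply: le_lt_trans (ler_normD _ _) _; rewrite normrM (gtr0_norm eta0).
    have : eta * `|cmod (z + s) ^+ 2 - B ^+ 2| <= eta * (1 * (2 * B + 1) * cmod s).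
      by apply: ler_wpM2l => //; exact: ltW.
    move: sL; rewrite /L; lra.
  have v1 := vmax w wK; rewrite /v in v1.
  have etaw : 0 <= eta * cmod w ^+ 2 by rewrite mulr_ge0 ?sqr_ge0// ltW.
  have [bz|/not_orP[ze zr]] := pselect (cmod z = e \/ cmod z = r).
    have fz := bM z zK bz; have M0 := le_trans (cmod_ge0 _) fz.
    split => //; apply: le_trans (_ : cmod (f z) ^+ 2 + eta * cmod z ^+ 2 <= _); first lra.
    apply: lerD; first by rewrite lerXn2r ?nnegrE ?cmod_ge0.
    apply: ler_wpM2l; first exact: ltW.
    by rewrite lerXn2r ?nnegrE ?cmod_ge0//; case/andP: zK.
  exfalso; have [l1 [l2 [C [d [C0 d0 fE]]]]] := smooth_quadratic (sf z zK).
  have /andP[ez zr'] := zK.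
  have e1 : 0 < cmod z - e by rewrite subr_gt0 lt_neqAle ez eq_sym andbT; apply/eqP.
  have r1 : 0 < r - cmod z by rewrite subr_gt0 lt_neqAle zr' andbT; apply/eqP.
  pose d' := Num.min d (Num.min (cmod z - e) (r - cmod z)).
  have d'0 : 0 < d' by rewrite !lt_min d0 e1.
  have [s|s sd'] := no_interior_max eta0 d'0 C0 (l1 := l1) (l2 := l2) (f := f) (z := z).
    by rewrite lt_min => /andP[sd _]; exact: fE.
  apply/negP; rewrite -leNgt; apply: vmax.
  move: sd'; rewrite !lt_min => /and3P[_ s1 s2].
  have := cmod_ge_sub z s; have := cmodD z s => h1 h2.
  by apply/andP; split; lra.
have [M0 _] := key 1 ltr01.
rewrite -(ler_pXn2r (ltn0Sn 1)) ?nnegrE ?cmod_ge0// -subr_le0.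
apply: (@le0_of_small _ _ (r ^+ 2) 1 ltr01) => eta /andP[eta0 _].
by have [_] := key _ eta0; rewrite lerBlDl mulrC.
Qed.

Lemma max_principle f z0 (e r M : R) :
  (forall z, e <= cmod (z - z0) <= r -> smooth f z) ->
  (forall z, e <= cmod (z - z0) <= r ->
    cmod (z - z0) = e \/ cmod (z - z0) = r -> cmod (f z) <= M) ->
  forall z, e <= cmod (z - z0) <= r -> cmod (f z) <= M.
Proof.
move=> sf bM z zK.
have := @max_principle0 (fun x => f (z0 + x)) e r M _ _ (z - z0) zK.
rewrite addrC subrK; apply => w; have -> : w = z0 + w - z0 by ring.
- move=> /sf sw n; have [p fp] := sw n; exists p.
  by apply: bigO_eq ltr01 _ fp => s _; congr (f _ - _); ring.
- by move=> wK wb; have := bM _ wK wb; congr (cmod (f _) <= _); ring.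
Qed.

End MaximumPrinciple.

(** * Schwarz's lemma and Caratheodory's coefficient inequality *)

Section Schwarz.
Context {R : realType}.
Local Open Scope complex_scope.
Implicit Types (f g F : R[i] -> R[i]) (z w s : R[i]).

Lemma bernoulli (x : R) n : 0 <= x -> 1 + n%:R * x <= (1 + x) ^+ n.
Proof.
move=> x0; elim: n => [|n ih]; first by rewrite mul0r addr0 expr0.
rewrite exprS; apply: le_trans (_ : (1 + x) * (1 + n%:R * x) <= _); last first.
  by apply: ler_wpM2l => //; rewrite addr_ge0.
rewrite -natr1; have : 0 <= n%:R * x ^+ 2 by rewrite mulr_ge0 ?sqr_ge0.
nra.
Qed.

Lemma bernoulli_sub (x : R) n : 0 <= x <= 1 -> 1 - n%:R * x <= (1 - x) ^+ n.
Proof.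
move=> /andP[x0 x1]; elim: n => [|n ih]; first by rewrite mul0r subr0 expr0.
rewrite exprS; apply: le_trans (_ : (1 - x) * (1 - n%:R * x) <= _); last first.
  by apply: ler_wpM2l => //; rewrite subr_ge0.
rewrite -natr1; have : 0 <= n%:R * x ^+ 2 by rewrite mulr_ge0 ?sqr_ge0.
nra.
Qed.

Lemma le1_of_expn_bounded (Y B : R) : 0 <= B -> (forall n, (0 < n)%N -> Y ^+ n <= B) -> Y <= 1.
Proof.
move=> B0 H; rewrite leNgt; apply/negP => Y1.
have d0 : 0 < Y - 1 by rewrite subr_gt0.
pose N := Num.bound (B / (Y - 1)).
have NB : B < N%:R * (Y - 1).
  rewrite -ltr_pdivrMr//; apply: le_lt_trans (archi_boundP _).
    exact: lexx.
  by rewrite divr_ge0// ltW.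
have := bernoulli N.+1 (ltW d0); have -> : 1 + (Y - 1) = Y by ring.
have := H N.+1 (ltn0Sn N); move: (Y ^+ N.+1) => P PB.
have -> : N.+1%:R = N%:R + 1 :> R by rewrite natr1.
lra.
Qed.

(* f ^ N / z ^ (m N - 1) vanishes at 0, so its maximum over a small annulus is
   attained on the outer circle; let the outer radius tend to 1, then N to
   infinity. *)
Lemma schwarz_punctured f m (C d : R) : 0 < d ->
  (forall z, 0 < cmod z < 1 -> smooth f z) ->
  (forall z, 0 < cmod z < 1 -> cmod (f z) <= 1) ->
  (forall z, 0 < cmod z < d -> cmod (f z) <= C * cmod z ^+ m) ->
  forall z, 0 < cmod z < 1 -> cmod (f z) <= cmod z ^+ m.
Proof.
move=> d0 sf f1 fC z z01; have /andP[z0 z1] := z01.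
pose rho := cmod z; pose K := Num.max 1 C.
have K1 : 1 <= K by rewrite le_max lexx.
have K0 : 0 < K by apply: lt_le_trans K1.
have powN N : cmod (f z) ^+ N * rho <= rho ^+ (m * N).
  pose X := cmod (f z) ^+ N * rho / rho ^+ (m * N).
  suff : X <= 1 by rewrite /X ler_pdivrMr ?exprn_gt0// mul1r.
  have X0 : 0 <= X by rewrite /X divr_ge0 ?mulr_ge0 ?exprn_ge0 ?cmod_ge0.
  have Xr (r : R) : rho < r < 1 -> X * r ^+ (m * N) <= 1.
    move=> /andP[zr r1]; have r0 : 0 < r by apply: lt_trans zr.
    pose u x := f x ^+ N * x / x ^+ (m * N).
    have cu x : cmod (u x) = cmod (f x) ^+ N * cmod x / cmod x ^+ (m * N).
      by rewrite /u cmod_div !cmodM !cmodX.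
    rewrite -ler_pdivlMr ?exprn_gt0// div1r /X -cu.
    (* Below K^-N the extra factor x in u outweighs the constant K^N coming from the bound near 0,
       so that |u| <= 1 on the inner circle. *)
    pose e := Num.min (rho / 2) (Num.min (d / 2) (K ^- N)).
    have e0 : 0 < e by rewrite !lt_min !divr_gt0 ?invr_gt0 ?exprn_gt0.
    have erho : e <= rho.
      have : e <= rho / 2 by rewrite /e !ge_min lexx.
      by move=> /le_trans; apply; rewrite ler_pdivrMr// ler_peMr ?ler1n// ltW.
    apply: (@max_principle0 _ u e r (r ^- (m * N))); last by rewrite erho ltW.
    - move=> x /andP[ex xr].
      have x0 : 0 < cmod x by apply: lt_le_trans ex.
      have xn0 : x ^+ (m * N) != 0 by rewrite expf_neq0// -cmod_gt0.
      have x01 : 0 < cmod x < 1 by rewrite x0 (le_lt_trans xr).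
      apply: smooth_div => //; last by apply: smooth_exp; exact: smooth_id.
      by apply: smoothM; [apply: smooth_exp; exact: sf|exact: smooth_id].
    - move=> x _ [xe|xr]; rewrite cu; last first.
        rewrite xr -[leRHS]mul1r; apply: ler_wpM2r.
          by rewrite invr_ge0 exprn_ge0// ltW.
        have x01 : 0 < cmod x < 1 by rewrite xr r0.
        by rewrite mulr_ile1 ?exprn_ge0 ?cmod_ge0 ?exprn_ile1 ?cmod_ge0 ?f1// ltW.
      apply: le_trans (_ : 1 <= _); last first.
        by rewrite invf_ge1 ?exprn_gt0// exprn_ile1// ltW.
      have xd : 0 < cmod x < d.
        have ed : e <= d / 2 by rewrite /e !ge_min lexx !orbT.
        by rewrite xe e0 /=; apply: le_lt_trans ed _; rewrite ltr_pdivrMr// mulr_natr mulr2n ltrDl.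
      have fx : cmod (f x) ^+ N <= K ^+ N * e ^+ (m * N).
        rewrite exprM -exprMn -xe; apply: lerXn2r; rewrite ?nnegrE ?cmod_ge0//.
          by rewrite mulr_ge0 ?exprn_ge0 ?cmod_ge0// ltW.
        apply: le_trans (fC x xd) _; apply: ler_wpM2r; first by rewrite exprn_ge0 ?cmod_ge0.
        by rewrite le_max lexx orbT.
      rewrite xe ler_pdivrMr ?exprn_gt0// mul1r.
      apply: le_trans (_ : K ^+ N * e ^+ (m * N) * e <= _).
        by apply: ler_wpM2r => //; exact: ltW.
      rewrite mulrAC ler_piMl ?exprn_ge0 ?(ltW e0)//.
      have : e <= K ^- N by rewrite /e !ge_min lexx !orbT.
      by rewrite -[K ^- N]mul1r ler_pdivlMr ?exprn_gt0// mulrC.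
  rewrite -subr_le0.
  have r1 : 0 < 1 - rho by rewrite subr_gt0.
  (* With r = 1 - t, Bernoulli's inequality turns X r^(m N) <= 1 into X <= 1 + X m N t. *)
  apply: (@le0_of_small _ _ (X * (m * N)%:R) _ r1) => t /andP[t0 t1].
  have := Xr (1 - t); rewrite gtrBl t0 andbT ltrBrDr -ltrBrDl => /(_ t1).
  apply: contraTT; rewrite -!ltNge => lt; apply: lt_le_trans (_ : X * (1 - (m * N)%:R * t) <= _).
    by rewrite mulrBr mulr1 mulrA ltrBrDl addrC -ltrBrDl.
  apply: ler_wpM2l => //; apply: bernoulli_sub; rewrite (ltW t0) /=.
  apply: ltW; apply: lt_le_trans t1 _; rewrite gerBl; exact: cmod_ge0.
rewrite -[leRHS]mul1r -ler_pdivrMr ?exprn_gt0//.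
apply: (@le1_of_expn_bounded _ rho^-1); first by rewrite invr_ge0 ltW.
move=> N N0; rewrite expr_div_n -exprM ler_pdivrMr ?exprn_gt0//.
by rewrite mulrC ler_pdivlMr.
Qed.

Lemma cexpMn z n : cexp (z *+ n) = cexp z ^+ n.
Proof. by elim: n => [|n ih]; rewrite ?cexp0// mulrS cexpD ih exprS. Qed.

Lemma primitive_root n : (0 < n)%N -> exists zeta : R[i],
  [/\ zeta ^+ n = 1, cmod zeta = 1 &
      forall i, (0 < i < n)%N -> \sum_(j < n) (zeta ^+ j) ^+ i = 0].
Proof.
move=> n0; have n0R : 0 < n%:R :> R by rewrite ltr0n.
pose a : R := pi *+ 2 / n%:R; pose zeta := cexp (0 +i* a).
have a0 : 0 < a by rewrite divr_gt0// mulrn_wgt0// pi_gt0.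
have zE k : zeta ^+ k = cexp (0 +i* (a *+ k)).
  rewrite -cexpMn; congr cexp; elim: k => [|k ih]; first by rewrite !mulr0n.
  by rewrite !mulrS ih; apply: complex_ext; rewrite ?reD ?imD /= ?addr0.
have zn : zeta ^+ n = 1.
  rewrite zE -mulr_natr /a divfK ?gt_eqF//; rewrite /cexp /polar /= expR0 !mul1r.
  by rewrite cos2pi sin2pi.
exists zeta; split => //; first by rewrite cmod_cexp /= expR0.
move=> i /andP[i0 ltin].
have zi : zeta ^+ i != 1.
  apply/eqP; rewrite zE -[RHS](@cexp0 R) => /cexp_inj.
  have ia : a *+ i < pi *+ 2.
    by rewrite -mulr_natr /a mulrAC ltr_pdivrMr// ltr_pM2l ?ltr_nat// mulrn_wgt0// pi_gt0.
  rewrite subr0 ger0_norm ?mulrn_wge0 ?(ltW a0)// => /(_ ia) [] /eqP.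
  by rewrite mulrn_eq0 (gt_eqF a0) orbF -leqn0 leqNgt i0.
have -> : \sum_(j < n) (zeta ^+ j) ^+ i = \sum_(j < n) (zeta ^+ i) ^+ j.
  by apply: eq_bigr => j _; rewrite -!exprM mulnC.
apply: (mulfI (_ : zeta ^+ i - 1 != 0)); first by rewrite subr_eq0.
by rewrite mulr0 -subrX1 -exprM mulnC exprM zn expr1n subrr.
Qed.

Lemma re_sum n (F : 'I_n -> R[i]) : Re (\sum_(i < n) F i) = \sum_(i < n) Re (F i).
Proof. by elim: n F => [|n ih] F; rewrite ?big_ord0// !big_ord_recr reD ih. Qed.

Lemma smooth_scale f z w : smooth f (w * z) -> smooth (fun x => f (w * x)) z.
Proof.
move=> fz; apply: (smooth_comp (f := fun x => w * x)) => //.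
by apply: smoothM; [exact: smooth_cst|exact: smooth_id].
Qed.

(** The average Fa over rotations has the expansion a + b z^n. Its Cayley transform W = (Fa - a) /
    (Fa + conj a) is bounded by 1 and O(z^n), so |W| <= |z|^n by Schwarz; near 0, W behaves like b
    z^n / (2 Re a). *)
Lemma caratheodory_pos F n p : (0 < n)%N ->
  (forall z, 0 < cmod z < 1 -> smooth F z) ->
  (forall z, 0 < cmod z < 1 -> 0 <= Re (F z)) ->
  jet n.+1 F 0 p -> 0 < Re p`_0 -> cmod p`_n <= 2 * Re p`_0.
Proof.
move=> n0 sF F0 /jet_take Fp p0; have [zeta [zn z1 zsum]] := primitive_root n0.
have nC : n%:R != 0 :> R[i] by rewrite pnatr_eq0 -lt0n.
pose Fa z := n%:R^-1 * \sum_(j < n) F (zeta ^+ j * z).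
have zj (j : nat) z : cmod (zeta ^+ j * z) = cmod z.
  by rewrite cmodM cmodX z1 expr1n mul1r.
have sFa z : 0 < cmod z < 1 -> smooth Fa z.
  move=> zz; apply: smoothM; first exact: smooth_cst.
  by apply: smooth_sum => j; apply: smooth_scale; apply: sF; rewrite zj.
have ReFa z : 0 < cmod z < 1 -> 0 <= Re (Fa z).
  move=> zz; rewrite /Fa.
  have -> : n%:R^-1 = (n%:R^-1)%:C :> R[i] by rewrite fmorphV rmorph_nat.
  rewrite (reM (_%:C)) /= mul0r subr0 mulr_ge0 ?invr_ge0// re_sum.
  by apply: sumr_ge0 => j _; apply: F0; rewrite zj.
pose a := p`_0; pose b := p`_n.
have FaO : bigO_at0 n.+1 (fun s => Fa s - (a + b * s ^+ n)).
  have [C [d [C0 d0 H]]] := Fp; exists C, d; split => // s sd.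
  have -> : Fa s - (a + b * s ^+ n) = n%:R^-1 *
     \sum_(j < n) (F (0 + zeta ^+ j * s) - (take_poly n.+1 p).[zeta ^+ j * s]).
    rewrite sumrB mulrBr /Fa; congr (_ - _).
      by congr (_ * _); apply: eq_bigr => j _; rewrite add0r.
    have -> : \sum_(j < n) (take_poly n.+1 p).[zeta ^+ j * s] =
        \sum_(i < n.+1) p`_i * s ^+ i * \sum_(j < n) (zeta ^+ j) ^+ i.
      rewrite /take_poly; under eq_bigr do rewrite horner_poly.
      rewrite exchange_big /=; apply: eq_bigr => i _; rewrite mulr_sumr.
      by apply: eq_bigr => j _; rewrite exprMn; ring.
    (* Of the exponents 0, ..., n only 0 and n survive the sum over the roots of unity. *)
    rewrite big_ord_recr /= (bigD1 (Ordinal n0))//= [X in _ + X + _]big1; last first.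
      move=> i i0; rewrite zsum ?mulr0// ltn_ord andbT lt0n.
      by apply: contraNN i0 => /eqP i0; apply/eqP/val_inj.
    rewrite expr0 mulr1 addr0 /a /b.
    have -> : \sum_(j < n) (zeta ^+ j) ^+ 0 = n%:R.
        by under eq_bigr do rewrite expr0; rewrite sumr_const card_ord.
    have -> : \sum_(j < n) (zeta ^+ j) ^+ n = n%:R.
        under eq_bigr do rewrite -exprM mulnC exprM zn expr1n.
        by rewrite sumr_const card_ord.
    by field.
  rewrite cmodM cmodV cmod_nat ler_pdivrMl ?ltr0n//.
  apply: le_trans (cmod_sum _ _ _) _.
  apply: le_trans (_ : \sum_(j < n) C * cmod s ^+ n.+1 <= _).
    by apply: ler_sum => j _; rewrite (le_trans (H _ _)) ?zj.
  by rewrite sumr_const card_ord mulr_natl.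
pose W z := (Fa z - a) / (Fa z + a^*).
have Rea : Re (a^*) = Re a by case: (a).
have den z : 0 < cmod z < 1 -> Re a <= cmod (Fa z + a^*).
  move=> zz; apply: le_trans (Re_le_cmod _); rewrite reD Rea lerDr; exact: ReFa.
have den0 z : 0 < cmod z < 1 -> Fa z + a^* != 0.
  by move=> zz; rewrite -cmod_gt0 (lt_le_trans p0)// den.
have Fan : bigO_at0 n (fun s => Fa s - a).
  have Ob := bigOM (bigO_cst b) (bigO_exp n).
  apply: (bigO_eq ltr01 _ (bigOD (bigO_le (leqnSn n) FaO) Ob)) => s _ /=; ring.
have WS z : 0 < cmod z < 1 -> cmod (W z) <= cmod z ^+ n.
  have [C [d [C0 d0 H]]] := Fan.
  (* The constant is C / Re a because the denominator of W has modulus at least Re a. *)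
  apply: (@schwarz_punctured W n (C / Re a) (Num.min d 1)).
  - by rewrite lt_min d0 ltr01.
  - move=> x xx; apply: smooth_div; first exact: den0.
      by apply: smoothB; [exact: sFa|exact: smooth_cst].
    by apply: smoothD; [exact: sFa|exact: smooth_cst].
  - move=> x xx; rewrite /W cmod_div ler_pdivrMr ?cmod_gt0 ?den0// mul1r.
    rewrite -(ler_pXn2r (ltn0Sn 1)) ?nnegrE ?cmod_ge0//.
    rewrite !cmod_sqr !(reD, imD, reN, imN) Rea.
    have -> : Im (a^*) = - Im a by case: (a).
    have := ReFa x xx; have := p0; rewrite -/a; nra.
  - move=> x /andP[x0]; rewrite lt_min => /andP[xd x1].
    have xx : 0 < cmod x < 1 by rewrite x0.
    rewrite /W cmod_div ler_pdivrMr ?cmod_gt0 ?den0//.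
    apply: le_trans (H x xd) _.
    rewrite (_ : C / Re a * cmod x ^+ n * cmod (Fa x + a^*) =
      C * cmod x ^+ n * (cmod (Fa x + a^*) / Re a)); last by ring.
    apply: ler_peMr; first by rewrite mulr_ge0 ?exprn_ge0 ?cmod_ge0.
    by rewrite ler_pdivlMr// mul1r den.
have [C [d [C0 d0 H]]] := FaO; have [C' [d' [C'0 d'0 H']]] := bigO_le n0 Fan.
rewrite -/a -/b -subr_le0.
have m0 : 0 < Num.min 1 (Num.min d d') by rewrite !lt_min ltr01 d0.
apply: (@le0_of_small _ _ (C + C') _ m0) => t /andP[t0].
rewrite !lt_min => /and3P[t1 td td'].
pose s : R[i] := t%:C; have st : cmod s = t by rewrite cmod_real gtr0_norm.
have ss : 0 < cmod s < 1 by rewrite st t0.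
have h1 := WS s ss; rewrite /W cmod_div ler_pdivrMr ?cmod_gt0 ?den0// in h1.
have h2 := H s ltac:(by rewrite st); have h3 := H' s ltac:(by rewrite st).
have tn : 0 < t ^+ n by rewrite exprn_gt0.
have h4 : cmod b * t ^+ n <= cmod (Fa s - a) + C * t ^+ n.+1.
  rewrite -st -cmodX -cmodM.
  have -> : b * s ^+ n = (Fa s - a) - (Fa s - (a + b * s ^+ n)) by ring.
  by rewrite (le_trans (cmodB _ _))// lerD2l.
have h5 : cmod (Fa s + a^*) <= 2 * Re a + C' * t.
  have -> : Fa s + a^* = (Fa s - a) + (2 * Re a)%:C.
    by apply: complex_ext; rewrite !(reD, imD, reN, imN) /=; case: (a) => x y /=; ring.
  rewrite (le_trans (cmodD _ _))// addrC; apply: lerD.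
    by rewrite cmod_real ger0_norm// mulr_ge0// ltW.
  by have := h3; rewrite st expr1.
rewrite st in h1.
have h6 : t ^+ n * cmod (Fa s + a^*) <= t ^+ n * (2 * Re a + C' * t) by rewrite ler_pM2l.
have : t ^+ n * (cmod b - 2 * Re a) <= t ^+ n * ((C + C') * t).
  rewrite exprS in h4; lra.
by rewrite ler_pM2l.
Qed.

(** Adding a small t > 0 to F makes the real part of the constant term positive, which is what
    bounds the denominator of the Cayley transform away from 0. *)
Lemma caratheodory F n p : (0 < n)%N ->
  (forall z, 0 < cmod z < 1 -> smooth F z) ->
  (forall z, 0 < cmod z < 1 -> 0 <= Re (F z)) ->
  jet n.+1 F 0 p -> 0 <= Re p`_0 -> cmod p`_n <= 2 * Re p`_0.
Proof.
move=> n0 sF F0 Fp p0; rewrite -subr_le0.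
apply: (@le0_of_small _ _ 2 1 ltr01) => t /andP[t0 _].
have := @caratheodory_pos (fun x => F x + t%:C) n (p + t%:C%:P) n0 _ _
  (jetD Fp (jet_cst n.+1 0 t%:C)).
rewrite !coefD !coefC /= gtn_eqF// addr0 reD /=.
move=> H; have {}H : cmod p`_n <= 2 * (Re p`_0 + t).
  apply: H; last by rewrite ltr_wpDl.
  - by move=> z zz; apply: smoothD; [exact: sF|exact: smooth_cst].
  - by move=> z zz; rewrite reD /= addr_ge0 ?F0// ltW.
lra.
Qed.

End Schwarz.

(** * Bohr's inequality for bounded functions and for the dilatation *)

Section BohrSums.
Context {R : realType}.
Local Open Scope complex_scope.
Implicit Types (f g h : R[i] -> R[i]) (a b c : nat -> R[i]) (z w s : R[i]).

(** The left side collects, out of the N^2 nonnegative products on the right, those whose indices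
    add up to less than N. *)
Lemma cauchy_product_le (u v : nat -> R) N :
  (forall n, 0 <= u n) -> (forall n, 0 <= v n) ->
  \sum_(n < N) \sum_(j < n.+1) u j * v (n - j)%N <=
  (\sum_(j < N) u j) * (\sum_(i < N) v i).
Proof.
move=> + v0; elim: N u => [|N ih] u u0; first by rewrite !big_ord0 mul0r.
have -> : \sum_(n < N.+1) \sum_(j < n.+1) u j * v (n - j)%N =
    u 0%N * \sum_(n < N.+1) v n +
    \sum_(n < N) \sum_(j < n.+1) u j.+1 * v (n - j)%N.
  rewrite [LHS]big_ord_recl big_ord_recl big_ord0 addr0 subn0.
  rewrite [in RHS]big_ord_recl mulrDr -addrA; congr (_ + _).
  rewrite mulr_sumr -big_split /=; apply: eq_bigr => i _.
  by rewrite big_ord_recl subn0; congr (_ + _); apply: eq_bigr.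
rewrite [X in _ <= X * _]big_ord_recl mulrDl lerD2l.
apply: le_trans (ih (fun n => u n.+1) (fun n => u0 n.+1)) _.
apply: ler_wpM2l; first exact: sumr_ge0.
by rewrite big_ord_recr /= lerDl.
Qed.

(** Taylor coefficients at 0 for functions that are not known to be sums of power series, such as
    quotients and composites. *)
Definition fulljet f a := forall n, jet n f 0 (\poly_(i < n) a i).

(** Jets of different orders agree on their common coefficients, so the coefficient of index i can
    be taken from any jet of order above i. *)
Lemma fulljet_exists f : smooth f 0 -> exists a, fulljet f a.
Proof.
move=> /choice[p fp]; exists (fun i => (p i.+1)`_i) => n.
have := jet_take (fp n); congr (jet _ _ _ _); apply/polyP => i.
rewrite coef_take_poly coef_poly; case: ltnP => // lein.
exact: (jet_unique (jet_le lein (fp n)) (fp i.+1)).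
Qed.

Lemma fulljet_unique f a b : fulljet f a -> fulljet f b -> a =1 b.
Proof.
move=> fa fb i; have := jet_unique (fa i.+1) (fb i.+1) (ltnSn i).
by rewrite !coef_poly ltnSn.
Qed.

Lemma fulljetM f g a b : fulljet f a -> fulljet g b ->
  fulljet (fun x => f x * g x) (fun n => \sum_(j < n.+1) a j * b (n - j)%N).
Proof.
move=> fa gb n; have := jet_take (jetM (fa n) (gb n)).
congr (jet _ _ _ _); apply/polyP => i; rewrite coef_take_poly coef_poly.
case: ltnP => // lein; rewrite coefM; apply: eq_bigr => j _.
rewrite !coef_poly (leq_ltn_trans _ lein) ?(leq_ltn_trans _ lein)//.
  exact: leq_subr.
by rewrite -ltnS.
Qed.

Lemma ps_fulljet a f : ps a f -> fulljet f a.
Proof. by move=> af n; exact: ps_jet0. Qed.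

Lemma fulljet_eq_near f g a (d : R) : 0 < d ->
  (forall s, cmod s < d -> f s = g s) -> fulljet g a -> fulljet f a.
Proof.
move=> d0 fg ga n; apply: (jet_eq_near d0) (ga n) => s sd.
by rewrite add0r fg.
Qed.

(** If eta rotates a_0 to |a_0|, then k - eta f has nonnegative real part and constant term k -
    |a_0|. The disk is punctured so that w z / z qualifies in [schwarz_sum]. *)
Lemma bounded_coefs f a (k : R) :
  (forall z, 0 < cmod z < 1 -> smooth f z) ->
  (forall z, 0 < cmod z < 1 -> cmod (f z) <= k) -> fulljet f a ->
  cmod (a 0%N) <= k /\ forall n, (0 < n)%N -> cmod (a n) <= 2 * (k - cmod (a 0%N)).
Proof.
move=> sf fk fa.
have a0k : cmod (a 0%N) <= k.
  rewrite -subr_le0; have [C [d [C0 d0 H]]] := fa 1%N.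
  have m0 : 0 < Num.min 1 d by rewrite lt_min ltr01.
  apply: (@le0_of_small _ _ C _ m0) => t /andP[t0]; rewrite lt_min => /andP[t1 td].
  have ct : cmod (t%:C : R[i]) = t by rewrite cmod_real gtr0_norm.
  have := H t%:C; rewrite ct => /(_ td).
  rewrite horner_poly big_ord1 expr0 mulr1 expr1 add0r => h1.
  have := fk t%:C; rewrite ct t0 => /(_ t1) h2.
  have := cmod_triangle (a 0%N) 0 (f t%:C); rewrite !subr0 cmodC; lra.
split => // n n0; have [eta [eta1 etaE]] := exists_phase (a 0%N).
pose F z := k%:C - eta * f z.
have FJ : jet n.+1 F 0 (k%:C%:P - eta%:P * \poly_(i < n.+1) a i).
  apply: jetD; first exact: jet_cst.
  by apply: jetN; apply: jetM; [exact: jet_cst | exact: fa].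
have c0 : (k%:C%:P - eta%:P * \poly_(i < n.+1) a i)`_0 = (k - cmod (a 0%N))%:C.
  by rewrite coefB coefC coefCM coef_poly /= etaE rmorphB.
have cn : (k%:C%:P - eta%:P * \poly_(i < n.+1) a i)`_n = - (eta * a n).
  by rewrite coefB coefC coefCM coef_poly ltnSn gtn_eqF// sub0r.
have := caratheodory n0 _ _ FJ; rewrite cn c0 cmodN cmodM eta1 mul1r; apply.
- move=> z zz; apply: smoothB; first exact: smooth_cst.
  by apply: smoothM; [exact: smooth_cst|exact: sf].
- move=> z zz; rewrite /F reD reN /= subr_ge0 (le_trans (Re_le_cmod _))//.
  by rewrite cmodM eta1 mul1r fk.
- by rewrite /= subr_ge0.
Qed.

(** The sum is at most |a_0| + 2 (k - |a_0|) r / (1 - r), and 2 r / (1 - r) <= 1 means r <= 1/3. *)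
Lemma bohr_bounded f a (k r : R) N :
  (forall z, 0 < cmod z < 1 -> smooth f z) ->
  (forall z, 0 < cmod z < 1 -> cmod (f z) <= k) -> fulljet f a ->
  0 <= r <= 1 / 3 -> \sum_(i < N) cmod (a i) * r ^+ i <= k.
Proof.
move=> sf fk fa /andP[r0 r3]; have [a0k an] := bounded_coefs sf fk fa.
case: N => [|N]; first by rewrite big_ord0 (le_trans (cmod_ge0 _) a0k).
rewrite big_ord_recl expr0 mulr1.
apply: le_trans (_ : cmod (a 0%N) + \sum_(i < N) 2 * (k - cmod (a 0%N)) * r * r ^+ i <= _).
  rewrite lerD2l; apply: ler_sum => i _; rewrite lift0 exprS mulrA.
  apply: ler_wpM2r; first exact: exprn_ge0.
  by apply: ler_wpM2r => //; exact: an.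
have r1 : 0 <= r < 1 by rewrite r0 /=; lra.
have := geom_sum_le N r1; rewrite -mulr_sumr.
have : (1 - r)^-1 <= 3 / 2.
  by rewrite -[3 / 2]invf_div lef_pV2 ?posrE//; lra.
move: (\sum_(i < N) _) => S h1 h2.
have k0 : 0 <= k - cmod (a 0%N) by rewrite subr_ge0.
have S0 : S <= 3 / 2 by apply: le_trans h1.
have : r * S <= 1 / 3 * (3 / 2).
  by apply: le_trans (_ : r * (3 / 2) <= _); [exact: ler_wpM2l|apply: ler_wpM2r].
have -> : 2 * (k - cmod (a 0%N)) * r * S = 2 * (k - cmod (a 0%N)) * (r * S) by ring.
move=> rS; have : (k - cmod (a 0%N)) * (r * S) <= (k - cmod (a 0%N)) * (1 / 3 * (3 / 2)).
  by apply: ler_wpM2l.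
lra.
Qed.

(** From g' = omega h', the coefficient b_(n+1) is a convolution of those of omega with a_(n-j+1),
    up to factors (n - j + 1) / (n + 1) <= 1; Bohr's inequality bounds the weighted sum of omega by
    k. *)
Lemma dilatation_sum dh dg a b (k r : R) N :
  ps (fun n => n.+1%:R * a n.+1) dh -> ps (fun n => n.+1%:R * b n.+1) dg ->
  (forall z, cmod z < 1 -> dh z != 0) ->
  (forall z, cmod z < 1 -> cmod (dg z / dh z) <= k) -> 0 <= r <= 1 / 3 ->
  \sum_(n < N) cmod (b n.+1) * r ^+ n.+1 <=
  k * \sum_(n < N) cmod (a n.+1) * r ^+ n.+1.
Proof.
move=> ah bg dh0 gk r3; have /andP[r0 _] := r3.
have sw z : cmod z < 1 -> smooth (fun z => dg z / dh z) z.
  move=> z1; apply: smooth_div; first exact: dh0.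
  - exact: ps_smooth bg z1.
  - exact: ps_smooth ah z1.
have z01 : cmod (0 : R[i]) < 1 by rewrite cmod0.
have [om om_jet] := fulljet_exists (sw 0 z01).
have om_sum : \sum_(i < N) cmod (om i) * r ^+ i <= k.
  apply: bohr_bounded om_jet r3; first by move=> z /andP[_ /sw].
  by move=> z /andP[_ /gk].
have E n : n.+1%:R * b n.+1 =
    \sum_(j < n.+1) om j * ((n - j).+1%:R * a (n - j).+1).
  have J := fulljetM om_jet (ps_fulljet ah).
  have := fulljet_unique (ps_fulljet bg) (fulljet_eq_near ltr01 _ J).
  by apply => s s1; rewrite divfK// dh0.
have bn n : cmod (b n.+1) <= \sum_(j < n.+1) cmod (om j) * cmod (a (n - j).+1).
  rewrite -(ler_pM2l (ltr0Sn R n)) -[in leLHS]cmod_nat -cmodM E.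
  rewrite (le_trans (cmod_sum _ _ _))// mulr_sumr; apply: ler_sum => j _.
  rewrite !cmodM cmod_nat mulrCA ler_wpM2r ?mulr_ge0 ?cmod_ge0//.
  by rewrite ler_nat ltnS leq_subr.
apply: le_trans (_ : \sum_(n < N) \sum_(j < n.+1) (cmod (om j) * r ^+ j) *
    (cmod (a (n - j).+1) * r ^+ (n - j).+1) <= _).
  apply: ler_sum => n _; apply: le_trans (_ : (\sum_(j < n.+1)
      cmod (om j) * cmod (a (n - j).+1)) * r ^+ n.+1 <= _).
    by apply: ler_wpM2r; [exact: exprn_ge0|exact: bn].
  rewrite mulr_suml le_eqVlt; apply/orP; left; apply/eqP; apply: eq_bigr => j _.
  have -> : r ^+ n.+1 = r ^+ j * r ^+ (n - j).+1.
    by rewrite -exprD addnS subnKC// -ltnS.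
  by ring.
apply: le_trans (@cauchy_product_le (fun j => cmod (om j) * r ^+ j)
  (fun i => cmod (a i.+1) * r ^+ i.+1) N _ _) _.
- by move=> n; rewrite mulr_ge0 ?cmod_ge0 ?exprn_ge0.
- by move=> n; rewrite mulr_ge0 ?cmod_ge0 ?exprn_ge0.
apply: ler_wpM2r => //; apply: sumr_ge0 => i _.
by rewrite mulr_ge0 ?cmod_ge0 ?exprn_ge0.
Qed.

End BohrSums.

(** * Coefficients of the sector maps and their domination in the weighted sum *)

Section SectorCoefficients.
Context {R : realType}.
Local Open Scope complex_scope.
Variable alpha : R.

(** The coefficients of (1 + z)^alpha. *)
Definition gbin k : R := \prod_(i < k) ((alpha - i%:R) / i.+1%:R).

(** The coefficients of (1 - z)^(-alpha). *)
Definition ngbin j : R := \prod_(i < j) ((alpha + i%:R) / i.+1%:R).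

(* The Taylor coefficients of ((1 + y z) / (1 - z)) `^ alpha at 0. *)
Definition sector_coef (y : R[i]) n : R[i] :=
  \sum_(k < n.+1) ((gbin k)%:C * y ^+ k) * (ngbin (n - k))%:C.

Definition koebe_coef n : R := \sum_(k < n.+1) gbin k * ngbin (n - k).

(** Up to the sign (-1)^j, the binomial coefficient of alpha - 2 over j, in a form where all factors
    lie in [0, 1] for 1 <= alpha <= 2. *)
Definition gtail j : R := \prod_(i < j) (1 - (alpha - 1) / i.+1%:R).

Lemma gbinS k : gbin k.+1 = gbin k * ((alpha - k%:R) / k.+1%:R).
Proof. by rewrite /gbin big_ord_recr. Qed.

Lemma ngbinS k : ngbin k.+1 = ngbin k * ((alpha + k%:R) / k.+1%:R).
Proof. by rewrite /ngbin big_ord_recr. Qed.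

Lemma gtailS k : gtail k.+1 = gtail k * (1 - (alpha - 1) / k.+1%:R).
Proof. by rewrite /gtail big_ord_recr. Qed.

Lemma gbin0 : gbin 0 = 1. Proof. by rewrite /gbin big_ord0. Qed.

Lemma gbin1 : gbin 1 = alpha.
Proof. by rewrite gbinS gbin0 subr0 divr1 mul1r. Qed.

Lemma ngbin0 : ngbin 0 = 1. Proof. by rewrite /ngbin big_ord0. Qed.

Lemma gtail0 : gtail 0 = 1. Proof. by rewrite /gtail big_ord0. Qed.

(** From index 2 on the binomial coefficients alternate in sign, so that odd j contribute
    negatively. *)
Lemma gbin_tail j : gbin j.+2 =
  (-1) ^+ j * (alpha * (alpha - 1) * gtail j / (j.+2%:R * j.+1%:R)).
Proof.
elim: j => [|j ih].
  by rewrite gbinS gbin1 gtail0 expr0; field.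
rewrite gbinS ih gtailS exprS.
have h k : k.+1%:R = k%:R + 1 :> R by rewrite natr1.
rewrite !h; have := ler0n R j; move: (j%:R) => x x0.
field; rewrite !gt_eqF//; lra.
Qed.

Hypothesis alpha12 : 1 <= alpha <= 2.

Lemma gtail_itv j : 0 <= gtail j <= 1.
Proof.
case/andP: alpha12 => a1 a2; elim: j => [|j /andP[h0 h1]]; first by rewrite gtail0 ler01 lexx.
rewrite gtailS; have k1 : 1 <= j.+1%:R :> R by rewrite ler1n.
have q0 : 0 <= (alpha - 1) / j.+1%:R by rewrite divr_ge0// subr_ge0.
have q1 : (alpha - 1) / j.+1%:R <= 1 by rewrite ler_pdivrMr//; lra.
have p0 : 0 <= 1 - (alpha - 1) / j.+1%:R by rewrite subr_ge0.
by rewrite mulr_ge0// mulr_ile1// gerBl.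
Qed.

Lemma ngbin_gt0 j : 0 < ngbin j.
Proof.
case/andP: alpha12 => a1 a2; elim: j => [|j h]; first by rewrite ngbin0.
by rewrite ngbinS mulr_gt0// divr_gt0// ltr_pwDl// (lt_le_trans ltr01).
Qed.

Lemma ngbin_le j : ngbin j <= ngbin j.+1.
Proof.
case/andP: alpha12 => a1 a2; rewrite ngbinS ler_peMr ?(ltW (ngbin_gt0 _))//.
by rewrite ler_pdivlMr// mul1r -natr1 addrC lerD2r.
Qed.

Lemma ngbin_mono i j : (i <= j)%N -> ngbin i <= ngbin j.
Proof.
move=> /subnK <-; elim: (j - i)%N => [//|k ih].
by rewrite addSn (le_trans ih)// ngbin_le.
Qed.

(** The right side is the coefficient of (1 - z)^(-2), the case alpha = 2. *)
Lemma ngbin_le_linear j : ngbin j <= j.+1%:R.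
Proof.
case/andP: alpha12 => a1 a2; elim: j => [|j ih]; first by rewrite ngbin0.
rewrite ngbinS; apply: le_trans (_ : j.+1%:R * ((alpha + j%:R) / j.+1%:R) <= _).
  apply: ler_wpM2r => //; rewrite divr_ge0// addr_ge0//.
  exact: le_trans a1.
by rewrite mulrC divfK// -natr1 -[j.+1%:R]natr1; lra.
Qed.

(** The modulus of [gbin] at index j + 2. *)
Definition gabs j : R := alpha * (alpha - 1) * gtail j / (j.+2%:R * j.+1%:R).

Lemma gabs_ge0 j : 0 <= gabs j.
Proof.
case/andP: alpha12 => a1 a2; have /andP[h0 _] := gtail_itv j.
rewrite /gabs divr_ge0// mulr_ge0// mulr_ge0//; lra.
Qed.

Lemma gabs_quad j : j.+2%:R * j.+1%:R * gabs j <= alpha.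
Proof.
case/andP: alpha12 => a1 a2; have /andP[h0 h1] := gtail_itv j.
rewrite /gabs mulrC divfK ?mulf_neq0 ?pnatr_eq0// -mulrA ler_piMr//; first lra.
by rewrite mulr_ile1 ?subr_ge0//; lra.
Qed.

(** Each term is alpha times a decrement of [gtail]. All terms from j = 1 on telescope to at most
    alpha [gtail 1] = alpha (2 - alpha) <= 1. *)
Lemma gabs_sum m : \sum_(j < m.+1 | odd j) j.+2%:R * gabs j <= 1.
Proof.
case/andP: alpha12 => a1 a2.
have E j : j.+2%:R * gabs j = alpha * (gtail j - gtail j.+1).
  rewrite /gabs gtailS -[j.+2%:R]natr1 -[j.+1%:R]natr1.
  have := ler0n R j; move: (j%:R) => x x0.
  by field; rewrite !gt_eqF//; lra.
have dec j : 0 <= gtail j - gtail j.+1.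
  have : 0 <= j.+2%:R * gabs j by rewrite mulr_ge0// gabs_ge0.
  by rewrite E pmulr_rge0//; lra.
apply: le_trans (_ : \sum_(j < m) alpha * (gtail j.+1 - gtail j.+2) <= _).
  rewrite big_mkcond /= big_ord_recl /= add0r; apply: ler_sum => j _.
  by case: ifP => _; rewrite ?E// mulr_ge0//; lra.
rewrite -mulr_sumr.
have -> : \sum_(j < m) (gtail j.+1 - gtail j.+2) = gtail 1 - gtail m.+1.
  elim: m => [|m ih]; first by rewrite big_ord0 subrr.
  by rewrite big_ord_recr /= ih; ring.
have /andP[h0 _] := gtail_itv m.+1.
have -> : gtail 1 = 2 - alpha by rewrite gtailS gtail0; field.
nra.
Qed.

(** Chebyshev polynomials of the second kind with shifted index: at c = cos t the value is sin (l t)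
    / sin t. *)
Fixpoint cheb (c : R) l : R :=
  if l is l1.+1 then (if l1 is l2.+1 then 2 * c * cheb c l1 - cheb c l2 else 1)
  else 0.

Lemma chebSS c l : cheb c l.+2 = 2 * c * cheb c l.+1 - cheb c l.
Proof. by []. Qed.

Section UnitCircle.
Variable y : R[i].
Hypothesis y1 : cmod y = 1.
Local Notation U := (cheb (Re y)).
Local Notation u := (1 - Re y).

Lemma conj_unit : y * y^* = 1.
Proof.
have := cmod_sqr y; rewrite y1 expr1n; case: (y) => a b /= h.
by apply: complex_ext => /=; [rewrite mulrN opprK -!expr2 -h|ring].
Qed.

Lemma conj_recurrence (a b : R) :
  (2 * Re y * a - b)%:C = (y + y^*) * a%:C - b%:C.
Proof. by case: (y) => c d; apply: complex_ext => /=; ring. Qed.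

Lemma pow_cheb l : y ^+ l.+1 = (U l.+1)%:C * y - (U l)%:C.
Proof.
elim: l => [|l ih]; first by rewrite expr1 mul1r subr0.
rewrite exprS ih chebSS conj_recurrence.
have -> : ((y + y^*) * (U l.+1)%:C - (U l)%:C) * y - (U l.+1)%:C =
  y * ((U l.+1)%:C * y - (U l)%:C) + (U l.+1)%:C * (y * y^* - 1) by ring.
by rewrite conj_unit subrr mulr0 addr0.
Qed.

Lemma cheb_step l : (U l.+1)%:C - y * (U l)%:C = (y^*) ^+ l.
Proof.
elim: l => [|l ih]; first by rewrite mulr0 subr0.
rewrite exprS -ih chebSS conj_recurrence.
have -> : (y + y^*) * (U l.+1)%:C - (U l)%:C - y * (U l.+1)%:C =
  y^* * ((U l.+1)%:C - y * (U l)%:C) + (U l)%:C * (y * y^* - 1) by ring.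
by rewrite conj_unit subrr mulr0 addr0.
Qed.

Lemma cheb_le l : `|U l| <= l%:R.
Proof.
elim: l => [|l ih]; first by rewrite normr0.
have /eqP := cheb_step l; rewrite subr_eq => /eqP E.
rewrite -[`|_|]cmod_real E (le_trans (cmodD _ _))// cmodM y1 mul1r cmod_real.
by rewrite cmodX cmod_conj y1 expr1n -natr1 addrC lerD2r.
Qed.

Lemma u_ge0 : 0 <= u.
Proof. by rewrite subr_ge0 -y1 Re_le_cmod. Qed.

(** At y = 1 the left side vanishes, because U l = l there. The factor u = 1 - Re y on the right is
    of second order in y - 1. *)
Lemma cheb_defect l : 1 + U l - U l.+1 <= l.+1%:R * l%:R * u.
Proof.
elim: l => [|l ih]; first by rewrite /= mulr0 mul0r addr0 subrr.
rewrite chebSS.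
have -> : 1 + U l.+1 - (2 * Re y * U l.+1 - U l) =
  (1 + U l - U l.+1) + 2 * u * U l.+1 by ring.
have : u * U l.+1 <= u * l.+1%:R.
  by apply: ler_wpM2l; [exact: u_ge0|exact: le_trans (ler_norm _) (cheb_le _)].
have -> : l.+2%:R * l.+1%:R * u = l.+1%:R * l%:R * u + 2 * (u * l.+1%:R).
  by rewrite -[l.+2%:R]natr1 -[l.+1%:R]natr1; ring.
rewrite -mulrA; lra.
Qed.

Lemma sector_coefSS m : sector_coef y m.+2 =
  (ngbin m.+2)%:C + alpha%:C * y * (ngbin m.+1)%:C +
  \sum_(j < m.+1) ((-1) ^+ j * gabs j * ngbin (m - j))%:C * y ^+ j.+2.
Proof.
rewrite /sector_coef big_ord_recl big_ord_recl addrA; congr (_ + _ + _).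
- by rewrite gbin0 subn0 !mul1r.
- by rewrite gbin1 expr1 subSS subn0.
apply: eq_bigr => j _; rewrite !lift0 gbin_tail !subSS -/(gabs j) !rmorphM /=.
ring.
Qed.

Lemma koebe_coefSS m : koebe_coef m.+2 = ngbin m.+2 + alpha * ngbin m.+1 +
  \sum_(j < m.+1) (-1) ^+ j * gabs j * ngbin (m - j).
Proof.
rewrite /koebe_coef big_ord_recl big_ord_recl addrA; congr (_ + _ + _).
- by rewrite gbin0 subn0 !mul1r.
- by rewrite gbin1 subSS subn0.
by apply: eq_bigr => j _; rewrite !lift0 gbin_tail !subSS.
Qed.

(* Odd powers come with a negative sign; replacing y ^ l by U_l y - U_(l-1)
   makes the loss in the triangle inequality of second order in y - 1. *)
Lemma sector_coef_le m : cmod (sector_coef y m.+2) <= koebe_coef m.+2 +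
  u * alpha * \sum_(j < m.+1 | odd j) ngbin (m - j).
Proof.
case/andP: alpha12 => a1 a2.
pose b j := gabs j * ngbin (m - j).
have b0 j : 0 <= b j by rewrite mulr_ge0 ?gabs_ge0// ltW// ngbin_gt0.
(* The weights j + 2 are the bounds of [cheb_le], so this keeps both odd sums X0 and X1 below
   [ngbin m]. *)
have sumb : \sum_(j < m.+1 | odd j) j.+2%:R * b j <= ngbin m.
  apply: le_trans (_ : (\sum_(j < m.+1 | odd j) j.+2%:R * gabs j) * ngbin m <= _).
    rewrite mulr_suml; apply: ler_sum => j _; rewrite /b mulrA.
    apply: ler_wpM2l; first by rewrite mulr_ge0// gabs_ge0.
    by apply: ngbin_mono; exact: leq_subr.
  by rewrite ler_piMl ?gabs_sum// ltW// ngbin_gt0.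
pose X0 := \sum_(j < m.+1 | odd j) b j * U j.+1.
pose X1 := \sum_(j < m.+1 | odd j) b j * U j.+2.
have bndX0 : `|X0| <= ngbin m.
  apply: le_trans sumb; apply: le_trans (ler_norm_sum _ _ _) _; apply: ler_sum => j _.
  rewrite normrM ger0_norm// mulrC; apply: ler_wpM2r => //.
  by rewrite (le_trans (cheb_le _))// ler_nat.
have bndX1 : `|X1| <= ngbin m.
  apply: le_trans sumb; apply: le_trans (ler_norm_sum _ _ _) _; apply: ler_sum => j _.
  rewrite normrM ger0_norm// mulrC; apply: ler_wpM2r => //.
  exact: cheb_le.
have E : sector_coef y m.+2 = (ngbin m.+2 + X0)%:C +
    (alpha * ngbin m.+1 - X1)%:C * y +
    \sum_(j < m.+1 | ~~ odd j) (b j)%:C * y ^+ j.+2.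
  rewrite sector_coefSS [X in _ + X = _](bigID (fun j : 'I_m.+1 => odd j)) /=.
  have -> : \sum_(i < m.+1 | odd i) ((-1) ^+ i * gabs i * ngbin (m - i))%:C * y ^+ i.+2 =
     X0%:C - X1%:C * y.
    rewrite /X0 /X1 !rmorph_sum mulr_suml -sumrB; apply: eq_bigr => j oj.
    rewrite pow_cheb -signr_odd oj expr1 !rmorphM /= rmorphN rmorph1; ring.
  have -> : \sum_(i < m.+1 | ~~ odd i) ((-1) ^+ i * gabs i * ngbin (m - i))%:C * y ^+ i.+2 =
     \sum_(j < m.+1 | ~~ odd j) (b j)%:C * y ^+ j.+2.
    by apply: eq_bigr => j /negbTE oj; rewrite -signr_odd oj expr0 mul1r.
  rewrite rmorphD rmorphB rmorphM /=; ring.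
have g12 := ngbin_le m.+1; have g01 := ngbin_le m; have g0 := ngbin_gt0 m.
(* The constant term and the coefficient of y absorb X0 and X1 without changing sign, so that their
   moduli open without loss. *)
have p0 : 0 <= ngbin m.+2 + X0 by move: bndX0; rewrite ler_norml => /andP[h _]; lra.
have p1 : 0 <= alpha * ngbin m.+1 - X1.
  move: bndX1; rewrite ler_norml => /andP[_ h].
  have : ngbin m.+1 <= alpha * ngbin m.+1 by rewrite ler_peMl// ltW// ngbin_gt0.
  lra.
rewrite E; apply: le_trans (cmodD _ _) _; apply: le_trans (lerD (cmodD _ _) (cmod_sum _ _ _)) _.
rewrite cmodM y1 mulr1 !cmod_real !ger0_norm//.
have -> : \sum_(i < m.+1 | ~~ odd i) cmod ((b i)%:C * y ^+ i.+2) =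
    \sum_(i < m.+1 | ~~ odd i) b i.
  by apply: eq_bigr => j _; rewrite cmodM cmodX y1 expr1n mulr1 cmod_real ger0_norm.
rewrite koebe_coefSS [X in _ <= _ + X + _](bigID (fun j : 'I_m.+1 => odd j)) /=.
have -> : \sum_(i < m.+1 | odd i) (-1) ^+ i * gabs i * ngbin (m - i) =
   - \sum_(i < m.+1 | odd i) b i.
  by rewrite -sumrN; apply: eq_bigr => j oj; rewrite -signr_odd oj expr1 /b; ring.
have -> : \sum_(i < m.+1 | ~~ odd i) (-1) ^+ i * gabs i * ngbin (m - i) =
   \sum_(i < m.+1 | ~~ odd i) b i.
  by apply: eq_bigr => j /negbTE oj; rewrite -signr_odd oj expr0 mul1r.
(* This left side is exactly what the triangle inequality loses against [koebe_coef]; at y = 1 it is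
   0. *)
have : X0 - X1 + \sum_(i < m.+1 | odd i) b i <=
    u * alpha * \sum_(j < m.+1 | odd j) ngbin (m - j).
  rewrite /X0 /X1 -sumrB -big_split mulr_sumr /=; apply: ler_sum => j _.
  have -> : b j * U j.+1 - b j * U j.+2 + b j = b j * (1 + U j.+1 - U j.+2) by ring.
  apply: le_trans (_ : b j * (j.+2%:R * j.+1%:R * u) <= _).
    by apply: ler_wpM2l => //; exact: cheb_defect.
  rewrite /b (_ : gabs j * ngbin (m - j) * (j.+2%:R * j.+1%:R * u) =
    j.+2%:R * j.+1%:R * gabs j * (u * ngbin (m - j))); last by ring.
  rewrite (_ : u * alpha * ngbin (m - j) = alpha * (u * ngbin (m - j))); last by ring.
  apply: ler_wpM2r; last exact: gabs_quad.
  by rewrite mulr_ge0 ?u_ge0// ltW// ngbin_gt0.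
lra.
Qed.

(** The deficit that pays for the other coefficients: |1 + y|^2 = 4 - 2 u <= (2 - u / 2)^2. *)
Lemma sector_coef1 : cmod (sector_coef y 1) <= koebe_coef 1 - alpha * u / 2.
Proof.
case/andP: alpha12 => a1 a2.
have -> : koebe_coef 1 = 2 * alpha.
  rewrite /koebe_coef !big_ord_recr !big_ord0 /= gbin0 gbin1 ngbinS ngbin0.
  by field.
have -> : sector_coef y 1 = alpha%:C * (1 + y).
  rewrite /sector_coef !big_ord_recr !big_ord0 /= gbin0 gbin1 ngbinS ngbin0.
  rewrite addr0 divr1 mul1r (_ : (1 : R)%:C = 1)//; ring.
rewrite cmodM cmod_real ger0_norm; last lra.
have : cmod (1 + y) <= 2 - u / 2.
  rewrite -(ler_pXn2r (ltn0Sn 1)) ?nnegrE ?cmod_ge0//; last first.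
    have := cmod_ge_Re y; rewrite y1 ler_norml => /andP[]; lra.
  have := cmod_sqr y; rewrite y1 expr1n cmod_sqr reD imD /= add0r.
  have := sqr_ge0 u; nra.
move=> h; have : alpha * cmod (1 + y) <= alpha * (2 - u / 2) by rewrite ler_wpM2l//; lra.
lra.
Qed.

(** The first coefficient gains alpha u r / 2, and the others together lose at most alpha u times
    [excess], which is at most r / 2. *)
Lemma sector_coef_sum_le (r : R) N : 0 <= r <= 1 / 3 ->
  \sum_(n < N) cmod (sector_coef y n.+1) * r ^+ n.+1 <=
  \sum_(n < N) koebe_coef n.+1 * r ^+ n.+1.
Proof.
case/andP: alpha12 => a1 a2 /andP[r0 r3]; have r1 : 0 <= r < 1 by rewrite r0 /=; lra.
case: N => [|N]; first by rewrite !big_ord0.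
rewrite !big_ord_recl !expr1.
have geo n : \sum_(i < n) r ^+ i <= 3 / 2.
  apply: le_trans (geom_sum_le n r1) _.
  by rewrite -[3 / 2]invf_div lef_pV2 ?posrE//; lra.
have geo0 n : 0 <= \sum_(i < n) r ^+ i by apply: sumr_ge0 => i _; exact: exprn_ge0.
(* 9/4 is (1 - 1/3)^-2: as [ngbin i] <= i + 1, the sum is dominated by the square of the geometric
   series. *)
have lin n : \sum_(i < n) ngbin i * r ^+ i <= 9 / 4.
  apply: le_trans (_ : \sum_(i < n) \sum_(j < i.+1) r ^+ j * r ^+ (i - j) <= _).
    apply: ler_sum => i _; apply: le_trans (_ : i.+1%:R * r ^+ i <= _).
      by apply: ler_wpM2r; [exact: exprn_ge0|exact: ngbin_le_linear].
    rewrite mulr_natl -[in leLHS](card_ord i.+1) -sumr_const.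
    by apply: ler_sum => j _; rewrite -exprD subnKC// -ltnS.
  apply: le_trans (@cauchy_product_le _ (fun i => r ^+ i) (fun i => r ^+ i) n _ _) _.
  - by move=> ?; exact: exprn_ge0.
  - by move=> ?; exact: exprn_ge0.
  apply: le_trans (_ : (3 / 2) * (3 / 2) <= _); last lra.
  exact: ler_pM.
have oddgeo n : \sum_(j < n) (odd j)%:R * r ^+ j <= r * (3 / 2).
  case: n => [|n]; first by rewrite big_ord0 mulr_ge0.
  rewrite big_ord_recl mul0r add0r.
  apply: le_trans (_ : \sum_(j < n) r * r ^+ j <= _).
    apply: ler_sum => j _; rewrite lift0 -exprS; apply: ler_piMl; first exact: exprn_ge0.
    by rewrite -[1]/(1%:R) ler_nat leq_b1.
  by rewrite -mulr_sumr; apply: ler_wpM2l.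
(* The product of the bounds is r^2 (3/2) r (9/4) = 27/8 r^3, at most 3/8 r for r <= 1/3. *)
have excess : \sum_(m < N) (\sum_(j < m.+1 | odd j) ngbin (m - j)) * r ^+ m.+2 <=
    r / 2.
  apply: le_trans (_ : r ^+ 2 * \sum_(m < N) \sum_(j < m.+1)
      ((odd j)%:R * r ^+ j) * (ngbin (m - j) * r ^+ (m - j)) <= _).
    rewrite mulr_sumr; apply: ler_sum => m _; rewrite mulr_suml big_mkcond /=.
    rewrite mulr_sumr; apply: ler_sum => j _.
    have -> : r ^+ m.+2 = r ^+ 2 * (r ^+ j * r ^+ (m - j)).
      by rewrite -exprD subnKC 1?[RHS]mulrC -?exprD ?addn2// -ltnS.
    case: ifP => _; last by rewrite !mul0r mulr0.
    by rewrite mul1r le_eqVlt; apply/orP; left; apply/eqP; ring.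
  apply: le_trans (_ : r ^+ 2 * (r * (3 / 2) * (9 / 4)) <= _).
    apply: ler_wpM2l; first exact: sqr_ge0.
    apply: le_trans (@cauchy_product_le _ (fun j => (odd j)%:R * r ^+ j)
      (fun i => ngbin i * r ^+ i) N _ _) _.
    - by move=> ?; rewrite mulr_ge0 ?exprn_ge0.
    - by move=> ?; rewrite mulr_ge0 ?exprn_ge0// ltW// ngbin_gt0.
    apply: ler_pM => //; apply: sumr_ge0 => j _.
      by rewrite mulr_ge0 ?exprn_ge0.
    by rewrite mulr_ge0 ?exprn_ge0// ltW// ngbin_gt0.
  have : r ^+ 2 <= 1 / 9.
    have -> : 1 / 9 = (1 / 3) ^+ 2 :> R by field.
    by rewrite lerXn2r ?nnegrE.
  move=> h; have : r * r ^+ 2 <= r * (1 / 9) by apply: ler_wpM2l.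
  lra.
have h1 : cmod (sector_coef y 1) * r <= (koebe_coef 1 - alpha * u / 2) * r.
  by apply: ler_wpM2r => //; exact: sector_coef1.
have h2 : \sum_(i < N) cmod (sector_coef y (lift ord0 i).+1) * r ^+ (lift ord0 i).+1 <=
   \sum_(i < N) koebe_coef (lift ord0 i).+1 * r ^+ (lift ord0 i).+1 +
   u * alpha * \sum_(m < N) (\sum_(j < m.+1 | odd j) ngbin (m - j)) * r ^+ m.+2.
  rewrite mulr_sumr -big_split; apply: ler_sum => m _; rewrite lift0 /=.
  rewrite [X in _ + X]mulrA -mulrDl; apply: ler_wpM2r; first exact: exprn_ge0.
  exact: sector_coef_le.
have ua : 0 <= u * alpha by rewrite mulr_ge0 ?u_ge0//; lra.
have := ler_wpM2l ua excess.
move: h1 h2; lra.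
Qed.

End UnitCircle.
End SectorCoefficients.

(** * Taylor coefficients of complex powers *)

Section BinomialSeries.
Context {R : realType}.
Local Open Scope complex_scope.
Implicit Types (f g h F : R[i] -> R[i]) (a b : nat -> R[i]) (c z w s y : R[i]).

Lemma fulljet_deriv F f a b (d : R) : 0 < d ->
  (forall s, cmod s < d -> sderiv F s (f s)) -> fulljet f b -> fulljet F a ->
  forall i, b i = i.+1%:R * a i.+1.
Proof.
move=> d0 dF fb Fa i.
have [|P [Pp _ FP]] := jet_integrate (F := F) d0 _ (fb i.+1).
  by move=> s sd; rewrite add0r; exact: dF.
have -> : a i.+1 = P`_i.+1.
  have := jet_unique (Fa i.+2) FP (ltnSn _); by rewrite coef_poly ltnSn.
have := congr1 (fun p : {poly _} => p`_i) Pp.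
by rewrite coef_deriv coef_poly ltnSn => <-; rewrite mulr_natl.
Qed.

Lemma Re_1D_gt0 z : cmod z < 1 -> 0 < Re (1 + z).
Proof.
move=> z1; rewrite reD /=; have := cmod_ge_Re z; rewrite ler_norml => /andP[h _].
lra.
Qed.

Lemma smooth_affine (u v : R[i]) z : smooth (fun x => u + v * x) z.
Proof.
apply: smoothD; first exact: smooth_cst.
by apply: smoothM; [exact: smooth_cst | exact: smooth_id].
Qed.

Lemma sderiv_affine (u v : R[i]) z : sderiv (fun x => u + v * x) z v.
Proof.
have := sderivD (sderiv_cst u z) (sderivM (sderiv_cst v z) (sderiv_id z)).
by congr (sderiv _ _ _); ring.
Qed.

Lemma fulljet_affine (u v : R[i]) :
  fulljet (fun x => u + v * x) (fun n => if n is n'.+1 then if n' is 0 then v else 0 else u).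
Proof.
move=> n; have := jet_take (jetD (jet_cst n 0 u) (jetM (jet_cst n 0 v) (jet_id n 0))).
congr (jet _ _ _ _); apply/polyP => i; rewrite coef_take_poly coef_poly.
case: ltnP => // _; rewrite coefD coefC coefCM coefD !coefC coefX.
by case: i => [|[|i]] /=; ring.
Qed.

Lemma fulljet_eq f a b : a =1 b -> fulljet f a -> fulljet f b.
Proof. by move=> ab; have -> : b = a by apply/funext => i; rewrite ab. Qed.

Lemma fulljet_at f a : fulljet f a -> a 0%N = f 0.
Proof.
by move=> fa; have := jet_at (ltn0Sn 0) (fa 1%N); rewrite horner_poly big_ord1 mulr1.
Qed.

Definition cpower (beta : R) (c x : R[i]) := cexp (beta%:C * Log (1 + c * x)).

Lemma sderiv_cpower (beta : R) (c x : R[i]) : cmod (c * x) < 1 ->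
  sderiv (cpower beta c) x (cpower beta c x * (beta%:C * c / (1 + c * x))).
Proof.
move=> cx; have sl := slit_Re_gt0 (Re_1D_gt0 cx).
have n0 : 1 + c * x != 0 by rewrite -cmod_gt0 slit_neq0.
have dl := sderiv_comp (f := fun x => 1 + c * x) (sderiv_affine 1 c x) (sderiv_Log sl).
have := sderiv_comp (sderivM (sderiv_cst beta%:C x) dl) (sderiv_cexp _).
by congr (sderiv _ _ _); rewrite /cpower; field.
Qed.

Lemma smooth_cpower (beta : R) (c x : R[i]) : cmod (c * x) < 1 ->
  smooth (cpower beta c) x.
Proof.
move=> cx; apply: (smooth_comp (g := cexp)); last exact: smooth_cexp.
apply: smoothM; first exact: smooth_cst.
apply: (smooth_comp (g := Log)); first exact: smooth_affine.
by apply: smooth_Log; apply: slit_Re_gt0; exact: Re_1D_gt0.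
Qed.

Lemma cpower0 (beta : R) c : cpower beta c 0 = 1.
Proof. by rewrite /cpower mulr0 addr0 Log1 mulr0 cexp0. Qed.

(** Comparing coefficients in (1 + c x) F' = beta c F gives the recursion that defines [gbin]. *)
Lemma cpower_jet (beta : R) c : cmod c = 1 ->
  fulljet (cpower beta c) (fun k => (gbin beta k)%:C * c ^+ k).
Proof.
move=> c1; have c01 : cmod (c * 0) < 1 by rewrite mulr0 cmod0.
have [a Fa] := fulljet_exists (smooth_cpower beta c01).
have cs s : cmod s < 1 -> cmod (c * s) < 1 by rewrite cmodM c1 mul1r.
pose k x := cpower beta c x * (beta%:C * c / (1 + c * x)).
have n0 s : cmod s < 1 -> 1 + c * s != 0.
  by move=> /cs/Re_1D_gt0/slit_Re_gt0/slit_neq0; rewrite cmod_gt0.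
have sk : smooth k 0.
  apply: smoothM; first exact: smooth_cpower.
  apply: smooth_div; [by rewrite n0// cmod0|exact: smooth_cst|exact: smooth_affine].
have [b kb] := fulljet_exists sk.
have dF s : cmod s < 1 -> sderiv (cpower beta c) s (k s).
  by move=> s1; apply: sderiv_cpower; exact: cs.
have ba := fulljet_deriv ltr01 dF kb Fa.
have rec : forall i, i.+1%:R * a i.+1 = (beta%:C - i%:R) * c * a i.
  have J1 := fulljetM (fulljet_affine 1 c) kb.
  have J2 := fulljetM (fulljet_affine (beta%:C * c) 0) Fa.
  have J3 := fulljet_eq_near (f := fun x => (1 + c * x) * k x) ltr01 _ J2.
  have E : forall s, cmod s < 1 -> (1 + c * s) * k s = (beta%:C * c + 0 * s) * cpower beta c s.
    by move=> s s1; rewrite /k; field; exact: n0.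
  have {E} E i := fulljet_unique J1 (J3 E) i.
  case=> [|i].
    have := E 0%N; rewrite !big_ord_recr !big_ord0 /= !add0r !subn0 ba.
    by rewrite !mul1r subr0 => ->.
  have := E i.+1; rewrite big_ord_recl big_ord_recl big1 ?addr0; last first.
    by move=> j _; rewrite mul0r.
  rewrite [RHS]big_ord_recl big1 ?addr0; last first.
    by move=> j _; rewrite lift0 /=; case: (nat_of_ord j) => [|?]; rewrite mul0r.
  rewrite lift0 /= !subn0 subSS subn0 !ba mul1r => E'.
  by apply: (addIr (c * (i.+1%:R * a i.+1))); rewrite E'; ring.
apply: (fulljet_eq _ Fa); elim=> [|i ih].
  by rewrite (fulljet_at Fa) cpower0 gbin0 expr0 mulr1.
have i0 : i.+1%:R != 0 :> R[i] by rewrite pnatr_eq0.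
apply: (mulfI i0); rewrite rec ih gbinS exprS.
have -> : (gbin beta i * ((beta - i%:R) / i.+1%:R))%:C =
    (gbin beta i)%:C * ((beta%:C - i%:R) / i.+1%:R).
  by rewrite !rmorphM rmorphB fmorphV !rmorph_nat.
by field.
Qed.

Lemma Log_cpower_conj (alpha : R) y z : cmod (y * z) < 1 -> cmod z < 1 ->
  cexp (alpha%:C * (Log (1 + y * z) - Log (1 - z))) =
  cpower alpha y z * cpower (- alpha) (-1) z.
Proof.
move=> yz z1; rewrite /cpower -cexpD mulN1r rmorphN; congr cexp; ring.
Qed.

Lemma gbinN (alpha : R) k : gbin (- alpha) k = (-1) ^+ k * ngbin alpha k.
Proof.
elim: k => [|k ih]; first by rewrite gbin0 ngbin0 mulr1.
rewrite gbinS ngbinS ih exprS.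
have k0 : k.+1%:R != 0 :> R by rewrite pnatr_eq0.
by field.
Qed.

Definition sector_map (alpha : R) y z := cpower alpha y z * cpower (- alpha) (-1) z.

Lemma sector_map_jet (alpha : R) y : cmod y = 1 ->
  fulljet (sector_map alpha y) (sector_coef alpha y).
Proof.
move=> y1; have m1 : cmod (-1 : R[i]) = 1 by rewrite cmodN cmod1.
have := fulljetM (cpower_jet alpha y1) (cpower_jet (- alpha) m1).
apply: fulljet_eq => n; rewrite /sector_coef; apply: eq_bigr => j _; congr (_ * _).
rewrite gbinN rmorphM rmorphXn rmorphN rmorph1 mulrAC -exprMn mulrNN mulr1 expr1n.
by rewrite mul1r.
Qed.

End BinomialSeries.

(** * Coefficient sums of functions with values in a sector *)

Section Subordination.
Context {R : realType}.
Local Open Scope complex_scope.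
Implicit Types (f g h w : R[i] -> R[i]) (a b : nat -> R[i]) (y z s : R[i]) (p q : {poly R[i]}).

(** A weighted l^1 norm cut at degree N; the cut keeps it submultiplicative, since the low
    coefficients of a product depend only on the low ones of its factors. *)
Definition pnorm N (r : R) p := \sum_(n < N) cmod p`_n * r ^+ n.

Lemma pnorm_ge0 N r p : 0 <= r -> 0 <= pnorm N r p.
Proof. by move=> r0; apply: sumr_ge0 => i _; rewrite mulr_ge0 ?cmod_ge0 ?exprn_ge0. Qed.

Lemma pnormM N r p q : 0 <= r -> pnorm N r (p * q) <= pnorm N r p * pnorm N r q.
Proof.
move=> r0; apply: le_trans (@cauchy_product_le _ (fun n => cmod p`_n * r ^+ n)
  (fun n => cmod q`_n * r ^+ n) N _ _).
- apply: ler_sum => n _; rewrite coefM; apply: le_trans (_ :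
      (\sum_(j < n.+1) cmod p`_j * cmod q`_(n - j)) * r ^+ n <= _).
    apply: ler_wpM2r; first exact: exprn_ge0.
    apply: le_trans (cmod_sum _ _ _) _; apply: ler_sum => j _; by rewrite cmodM.
  rewrite mulr_suml; apply: ler_sum => j _; rewrite le_eqVlt; apply/orP; left.
  have -> : r ^+ n = r ^+ j * r ^+ (n - j) by rewrite -exprD subnKC// -ltnS.
  by apply/eqP; ring.
- by move=> n; rewrite mulr_ge0 ?cmod_ge0 ?exprn_ge0.
- by move=> n; rewrite mulr_ge0 ?cmod_ge0 ?exprn_ge0.
Qed.

Lemma pnormX N r p k : 0 <= r -> pnorm N r (p ^+ k.+1) <= pnorm N r p ^+ k.+1.
Proof.
move=> r0; elim: k => [|k ih]; first by rewrite !expr1.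
rewrite exprS [leRHS]exprS; apply: le_trans (pnormM _ _ _ r0) _.
by apply: ler_wpM2l => //; exact: pnorm_ge0.
Qed.

(** By submultiplicativity the k-th power of w has norm at most r^k, so each coefficient of Psi
    meets the weight r^k; the jets reduce the composite to one of polynomials. *)
Lemma composition_coefs_le H w a (W c : nat -> R[i]) (Psi : R[i] -> R[i]) (d r : R) N :
  0 < d -> w 0 = 0 -> (forall s, cmod s < d -> H s = Psi (w s)) ->
  fulljet H a -> fulljet w W -> fulljet Psi c -> 0 <= r ->
  \sum_(n < N.+1) cmod (W n) * r ^+ n <= r ->
  \sum_(n < N) cmod (a n.+1) * r ^+ n.+1 <= \sum_(n < N) cmod (c n.+1) * r ^+ n.+1.
Proof.
move=> d0 w0 HP Ha wW Pc r0 Wr.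
pose p := \poly_(i < N.+1) W i; pose q := \poly_(i < N.+1) c i.
have J : jet N.+1 H 0 (q \Po p).
  have := jet_comp (ltn0Sn N) (wW N.+1) (_ : jet N.+1 Psi (w 0) q).
  rewrite w0 subr0 => /(_ (Pc N.+1)); apply: (jet_eq_near d0) => s sd.
  by rewrite add0r HP.
have aE n : (n < N.+1)%N -> a n = (q \Po p)`_n.
  by move=> nN; rewrite -(jet_unique (Ha N.+1) J nN) coef_poly nN.
have qpE : q \Po p = \sum_(k < N.+1) c k *: p ^+ k.
  by rewrite /q poly_def linear_sum /=; apply: eq_bigr => k _;
    rewrite linearZ /= comp_Xn_poly.
have pr : pnorm N.+1 r p <= r.
  apply: le_trans Wr; apply: ler_sum => i _; by rewrite coef_poly ltn_ord.
apply: le_trans (_ : \sum_(n < N) \sum_(k < N) cmod (c k.+1) * (cmod (p ^+ k.+1)`_n.+1 * r ^+ n.+1) <= _).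
  apply: ler_sum => n _; rewrite aE ?ltnS// qpE coef_sum.
  rewrite big_ord_recl expr0 coefZ coef1 mulr0 add0r.
  under [leRHS]eq_bigr do rewrite mulrA; rewrite -mulr_suml.
  apply: ler_wpM2r; first exact: exprn_ge0.
  apply: le_trans (cmod_sum _ _ _) _; apply: ler_sum => k _.
  by rewrite coefZ cmodM lift0.
rewrite exchange_big /=; apply: ler_sum => k _; rewrite -mulr_sumr.
apply: ler_wpM2l; first exact: cmod_ge0.
apply: le_trans (_ : pnorm N.+1 r (p ^+ k.+1) <= _).
  rewrite /pnorm big_ord_recl /= ler_wpDl ?mulr_ge0 ?cmod_ge0 ?exprn_ge0//.
apply: le_trans (pnormX _ _ _ r0) _; apply: lerXn2r => //; rewrite nnegrE//.
exact: pnorm_ge0.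
Qed.

(** The value [W 1] fills the removable singularity at 0; the quotient has order n where w has order
    n + 1. *)
Lemma fulljet_quotient w W : w 0 = 0 -> fulljet w W ->
  fulljet (fun z => if z == 0 then W 1%N else w z / z) (fun n => W n.+1).
Proof.
move=> w0 wW n; have [C [d [C0 d0 H]]] := wW n.+1.
have W0 : W 0%N = 0 by rewrite (fulljet_at wW).
(* The summand |W 1| serves the case s = 0 and n = 0, where the bound concerns the filled value. *)
exists (C + cmod (W 1%N)), d; split => //; first by rewrite addr_ge0 ?cmod_ge0.
move=> s sd; rewrite add0r; have [->|s0] := eqVneq s 0.
  case: n H => [|n] _.
    by rewrite poly_def big_ord0 horner0 subr0 mulr1 lerDr.
  rewrite horner_poly big_ord_recl expr0 mulr1 big1 ?addr0 ?subrr ?cmod0.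
    by rewrite mulr_ge0 ?addr_ge0 ?cmod_ge0 ?exprn_ge0.
  by move=> i _; rewrite lift0 expr0n mulr0.
have sp : 0 < cmod s by rewrite cmod_gt0.
have := H s sd; rewrite add0r horner_poly big_ord_recl W0 mul0r add0r => h.
rewrite horner_poly.
have -> : w s / s - \sum_(i < n) W i.+1 * s ^+ i =
    (w s - \sum_(i < n) W (lift ord0 i) * s ^+ lift ord0 i) / s.
  rewrite mulrBl mulr_suml; congr (_ - _); apply: eq_bigr => i _.
  by rewrite lift0 exprS; field.
rewrite cmod_div ler_pdivrMr// (le_trans h)// exprSr mulrA.
by rewrite !ler_pM2r ?exprn_gt0// lerDl cmod_ge0.
Qed.

(** Bohr's inequality applies to w z / z, which Schwarz's lemma bounds by 1; multiplying by r
    restores w. *)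
Lemma schwarz_sum w W (r : R) N : (forall z, cmod z < 1 -> smooth w z) ->
  (forall z, cmod z < 1 -> cmod (w z) <= 1) -> w 0 = 0 -> fulljet w W ->
  0 <= r <= 1 / 3 ->
  (forall z, cmod z < 1 -> cmod (w z) <= cmod z) /\
  \sum_(n < N.+1) cmod (W n) * r ^+ n <= r.
Proof.
move=> sw w1 w0 wW r3; have /andP[r0 _] := r3.
have z01 : cmod (0 : R[i]) < 1 by rewrite cmod0.
have schw z : 0 < cmod z < 1 -> cmod (w z) <= cmod z.
  move=> zz; rewrite -[leRHS]expr1.
  have [C [d [C0 d0 H]]] := smooth_lipschitz (sw 0 z01).
  apply: (@schwarz_punctured _ w 1 C d) => //.
  - by move=> x /andP[_ /sw].
  - by move=> x /andP[_ /w1].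
  - by move=> x /andP[_ /H]; rewrite add0r w0 subr0.
split.
  move=> z z1; have [->|zn0] := eqVneq z 0; first by rewrite w0 cmod0.
  by apply: schw; rewrite cmod_gt0 zn0.
have W0 : W 0%N = 0 by rewrite (fulljet_at wW).
rewrite big_ord_recl W0 cmod0 mul0r add0r.
have : \sum_(i < N) cmod (W i.+1) * r ^+ i <= 1.
  apply: (@bohr_bounded _ _ (fun n => W n.+1) 1 r N _ _ (fulljet_quotient w0 wW) r3) =>
    z /andP[z0 z1].
    have zn0 : z != 0 by rewrite -cmod_gt0.
    apply: (@smooth_eq_near _ _ (fun x => w x / x) z (cmod z)) => //.
      move=> s sz; have : z + s != 0.
        by rewrite -cmod_gt0 (lt_le_trans _ (cmod_ge_sub _ _))// subr_gt0.
      by move=> /negbTE ->.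
    by apply: smooth_div => //; [exact: sw|exact: smooth_id].
  have zn0 : z != 0 by rewrite -cmod_gt0.
  rewrite (negbTE zn0) cmod_div ler_pdivrMr// mul1r; apply: schw.
  by rewrite z0.
move=> h; apply: le_trans (_ : r * \sum_(i < N) cmod (W i.+1) * r ^+ i <= _).
  rewrite mulr_sumr; apply: ler_sum => i _; rewrite lift0 exprS.
  by rewrite le_eqVlt; apply/orP; left; apply/eqP; ring.
by rewrite ler_piMr.
Qed.

(** The points conj s and - s are mirror images in the imaginary axis, and z lies on the side of
    conj s. *)
Lemma reflection_le z s : 0 <= Re z -> 0 <= Re s ->
  cmod (z - (Re s -i* Im s)) <= cmod (z + s).
Proof.
move=> z0 s0; rewrite -(ler_pXn2r (ltn0Sn 1)) ?nnegrE ?cmod_ge0//.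
rewrite !cmod_sqr; case: z s z0 s0 => [a b] [c d] /= a0 c0.
have := mulr_ge0 a0 c0; nra.
Qed.

(** G = exp (L / alpha) lies in the right half-plane rotated by e = exp (i mu). The mirror image of
    G 0 = 1 in the boundary of that half-plane is - e^2 = - y, so w = (G - 1) / (G + y) maps into
    the disk. *)
Lemma sector_subordination (alpha mu r : R) (H L : R[i] -> R[i]) a N :
  1 <= alpha <= 2 -> 0 <= r <= 1 / 3 -> `|mu| < pi / 2 ->
  (forall z, cmod z < 1 -> smooth L z) -> L 0 = 0 ->
  (forall z, cmod z < 1 -> H z = cexp (L z)) ->
  (forall z, cmod z < 1 -> `|Im (L z) / alpha - mu| <= pi / 2) ->
  fulljet H a ->
  \sum_(n < N) cmod (a n.+1) * r ^+ n.+1 <=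
  \sum_(n < N) koebe_coef alpha n.+1 * r ^+ n.+1.
Proof.
move=> alpha12 r3 mu2 sL L0 HL Lmu Ha.
have a0 : 0 < alpha by case/andP: alpha12 => h _; apply: lt_le_trans h.
have /andP[r0 _] := r3.
pose e := cexp (0 +i* mu); pose y := e * e.
have e1 : cmod e = 1 by rewrite cmod_cexp /= expR0.
have y1 : cmod y = 1 by rewrite cmodM e1 mulr1.
have Ree : 0 < Re e by apply: Re_cexp_gt0.
have en0 : e != 0 by rewrite cexp_neq0.
pose l z := (alpha^-1)%:C * L z.
pose G z := cexp (l z).
have Iml z : Im (l z) = Im (L z) / alpha by rewrite /l imM /= mul0r addr0 mulrC.
pose g z := G z / e.
have Reg z : cmod z < 1 -> 0 <= Re (g z).
  move=> z1; rewrite /g /G /e -cexpB /cexp /polar /=; apply: mulr_ge0.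
    exact: expR_ge0.
  by apply: cos_ge0_pihalf; rewrite -ler_norml imD imN /= Iml; exact: Lmu.
have Gg z : G z = g z * e by rewrite /g divfK.
have eV : e^-1 = (Re e) -i* (Im e).
  apply: (mulfI en0); rewrite divff//; have := cmod_sqr e; rewrite e1 expr1n.
  case: (e) => c d /= h; apply: complex_ext => /=; last by ring.
  by rewrite mulrN opprK -!expr2 -h.
have Gy z : G z + y = (g z + e) * e by rewrite Gg /y mulrDl.
have G1 z : G z - 1 = (g z - e^-1) * e by rewrite Gg mulrBl mulVf.
have Gyn0 z : cmod z < 1 -> G z + y != 0.
  move=> z1; rewrite Gy mulf_neq0// -cmod_gt0.
  by apply: lt_le_trans (Re_le_cmod _); rewrite reD ltr_wpDl ?Reg.
pose w z := (G z - 1) / (G z + y).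
have z01 : cmod (0 : R[i]) < 1 by rewrite cmod0.
have sG z : cmod z < 1 -> smooth G z.
  move=> z1; apply: (smooth_comp (g := cexp)); last exact: smooth_cexp.
  by apply: smoothM; [exact: smooth_cst|exact: sL].
have sw z : cmod z < 1 -> smooth w z.
  move=> z1; apply: smooth_div; first exact: Gyn0.
    by apply: smoothB; [exact: sG|exact: smooth_cst].
  by apply: smoothD; [exact: sG|exact: smooth_cst].
have w0 : w 0 = 0 by rewrite /w /G /l L0 mulr0 cexp0 subrr mul0r.
have w1 z : cmod z < 1 -> cmod (w z) <= 1.
  move=> z1; rewrite /w cmod_div ler_pdivrMr ?cmod_gt0 ?Gyn0// mul1r.
  rewrite G1 Gy !cmodM e1 !mulr1.
  by rewrite eV; apply: reflection_le; [exact: Reg|exact: ltW].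
have [W wW] := fulljet_exists (sw 0 z01).
have [schw Wr] := schwarz_sum N sw w1 w0 wW r3.
have yw z : cmod z < 1 -> cmod (y * w z) < 1.
  by move=> z1; rewrite cmodM y1 mul1r (le_lt_trans (schw _ z1)).
have ww z : cmod z < 1 -> cmod (- w z) < 1.
  by move=> z1; rewrite cmodN (le_lt_trans (schw _ z1)).
have HPsi z : cmod z < 1 -> H z = sector_map alpha y (w z).
  move=> z1; have wz : cmod (w z) < 1 by rewrite -cmodN ww.
  rewrite HL// /sector_map -(Log_cpower_conj _ (yw _ z1) wz).
  have E : l z = Log (1 + y * w z) - Log (1 - w z).
    have p1 := Re_1D_gt0 (yw _ z1); have p2 := Re_1D_gt0 (ww _ z1).
    apply: cexp_inj; last first.
      rewrite cexpB !cexp_Log; [|exact: slit_Re_gt0|exact: slit_Re_gt0].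
      have n2 : 1 - w z != 0 by rewrite -cmod_gt0 slit_neq0// slit_Re_gt0.
      have := Gyn0 z z1; rewrite -/(G z) /w => n1.
      (* If y were -1, then w would be equal to 1, against |w| < 1. *)
      have y10 : 1 + y != 0.
        apply: contra_neq n2 => y10; rewrite /w.
        have -> : 1 - (G z - 1) / (G z + y) = (1 + y) / (G z + y) by field.
        by rewrite y10 mul0r.
      by field; rewrite n1 /=; rewrite (_ : G z + y - (G z - 1) = 1 + y)//; ring.
    have b1 := Im_Log_Re_gt0 p1; have b2 := Im_Log_Re_gt0 p2.
    have := Lmu z z1; rewrite -Iml imD imN.
    move: b1 b2 mu2; rewrite !ltr_norml ler_norml (_ : pi *+ 2 = pi + pi); last exact: mulr2n.
    move=> /andP[? ?] /andP[? ?] /andP[? ?] /andP[? ?]; apply/andP; split; lra.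
  rewrite -E /l mulrA -rmorphM divff ?gt_eqF// mul1r//.
apply: le_trans (sector_coef_sum_le alpha12 y1 N r3).
exact: (composition_coefs_le ltr01 w0 HPsi Ha wW (sector_map_jet alpha y1) r0 Wr).
Qed.

End Subordination.

(** * Neighbourhoods, limits, convexity and boundaries in the complex plane *)

Section ComplexTopology.
Context {R : realType}.
Local Open Scope complex_scope.
Implicit Types (z w q c : R[i]) (W : set R[i]).

Lemma normC_cmod z : `|z| = (cmod z)%:C.
Proof. by []. Qed.

Lemma nbhs_cmodP z W : nbhs z W <->
  exists2 e : R, 0 < e & forall w, cmod (w - z) < e -> W w.
Proof.
split.
  move=> /nbhs_ballP[e /= e0 We].
  (* Radii of balls are elements of R[i], and positivity forces them to be real. *)
  have ereal : e = (Re e)%:C by move: e0; rewrite ltcE /= => /andP[/eqP i0 _]; apply: complex_ext.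
  rewrite ereal ltcR in e0; exists (Re e) => // w wz; apply: We.
  by rewrite -ball_normE /= ereal distrC normC_cmod ltcR.
move=> [e e0 We]; apply/nbhs_ballP; exists e%:C; first by rewrite /= ltcR.
move=> w; rewrite -ball_normE /= distrC normC_cmod ltcR; exact: We.
Qed.

Lemma cvg_climP (u : nat -> R[i]) l : u @ \oo --> l <-> clim u l.
Proof.
split=> [ul e e0|ul].
  have /ul[N _ H] : nbhs l [set w | cmod (w - l) < e].
    by apply/nbhs_cmodP; exists e.
  by exists N => n Nn; exact: H.
move=> W /nbhs_cmodP[e e0 We]; have [N H] := ul e e0.
by exists N => // n Nn; apply: We; exact: H.
Qed.

Lemma power_seriesP a f : power_series a f <-> @ps R a f.
Proof.
have E z : series (fun n => a n * z ^+ n) = psum a z.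
  by apply/funext => n; rewrite /psum seriesEord.
by split=> H z z1; have := H z z1; rewrite E => /cvg_climP.
Qed.

Lemma sderiv_derive1 (f : R[i] -> R[i]) z l : sderiv f z l ->
  derivable f z 1 /\ derive1 f z = l.
Proof.
move=> [C [d [C0 d0 H]]].
have cv : h^-1 *: (f (h *: 1 + z) - f z) @[h --> (0 : R[i])^'] --> l.
  move=> W /nbhs_cmodP[e e0 We].
  have C1 : 0 < C + 1 by rewrite ltr_wpDl.
  apply/nbhs_cmodP; exists (Num.min d (e / (C + 1))).
    by rewrite lt_min d0 divr_gt0.
  move=> h; rewrite subr0 lt_min ltr_pdivlMr// => /andP[hd he] h0.
  apply: We; rewrite [h *: 1]mulr1 [_ *: _]/(_ * _) [h + z]addrC.
  have -> : h^-1 * (f (z + h) - f z) - l = (f (z + h) - f z - l * h) / h.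
    by field.
  rewrite cmod_div ltr_pdivrMr ?cmod_gt0//; apply: le_lt_trans (H h hd) _.
  rewrite expr2 mulrA ltr_pM2r ?cmod_gt0//; apply: le_lt_trans he.
  by rewrite mulrC ler_wpM2l ?cmod_ge0// lerDl.
split; first by apply/cvg_ex; exists l.
by rewrite derive1E; apply: cvg_lim.
Qed.

Definition adherent W z := forall e : R, 0 < e -> exists2 c, W c & cmod (c - z) < e.

Definition convexC W := forall z w (t : R), 0 <= t <= 1 -> W z -> W w ->
  W (t%:C * z + (1 - t)%:C * w).

Lemma convex_setP W : convex_set (W : set (convex_lmodType (Rcomplex R))) <->
  convexC W.
Proof.
have sc (t : R) z : (t *: (z : Rcomplex R)) = t%:C * z.
  by case: z => a b; apply: complex_ext => /=; ring.
split=> [cW z w t t01 Wz Ww|cW z w l].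
  have := cW z w (Itv01 (proj1 (andP t01)) (proj2 (andP t01))).
  rewrite !inE => /(_ Wz Ww); congr W.
  by rewrite /conv /= !sc.
rewrite !inE => Wz Ww; have := cW z w l%:num _ Wz Ww.
rewrite /conv /= !sc; apply.
by apply/andP; split.
Qed.

Lemma boundary_adherent W q : boundary W q -> adherent (~` W) q.
Proof.
move=> [_ nint] e e0; apply: contrapT => H; apply: nint.
apply/nbhs_cmodP; exists e => // w wq; apply: contrapT => nW; apply: H.
by exists w.
Qed.

(** The boundary point sits at the supremum t0 of the parameters whose points on the segment from z
    to c lie in W. Were it interior, t0 could be increased, or c would belong to W. *)
Lemma boundary_nonempty W z c : W z -> ~ W c -> boundary W !=set0.
Proof.
move=> Wz nWc; pose x (t : R) := z + t%:C * (c - z).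
have xd s t : cmod (x s - x t) = `|s - t| * cmod (c - z).
  have -> : x s - x t = (s - t)%:C * (c - z) by rewrite /x rmorphB; ring.
  by rewrite cmodM cmod_real.
have zc : 0 < cmod (c - z).
  by rewrite cmod_gt0 subr_eq0; apply/eqP => zc; apply: nWc; rewrite zc.
pose S := [set t : R | 0 <= t <= 1 /\ W (x t)].
have S0 : S 0 by rewrite /S /= lexx ler01 /x mul0r addr0.
have supS : has_sup S.
  split; first by exists 0.
  by exists 1 => t [/andP[_ t1] _].
pose t0 := sup S; exists (x t0).
have t00 : 0 <= t0 by exact: (sup_upper_bound supS S0).
have t01 : t0 <= 1.
  by apply: ge_sup; [exists 0 | move=> t [/andP[_ h] _]].
split.
  move=> V /nbhs_cmodP[e e0 Ve].
  have [t tS tt0] := sup_adherent (divr_gt0 e0 zc) supS.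
  exists (x t); split => //; first by case: tS.
  apply: Ve; rewrite xd -ltr_pdivlMr// distrC ger0_norm ?subr_ge0; last exact: (sup_upper_bound supS tS).
  by rewrite ltrBlDr -ltrBlDl.
move=> /nbhs_cmodP[e e0 He].
have [t1|t1] := eqVneq t0 1.
  apply: nWc; have := He (x t0); rewrite subrr cmod0 => /(_ e0).
  by rewrite /x t1 mul1r addrC subrK.
have lt1 : t0 < 1 by rewrite lt_neqAle t1.
pose t := Num.min 1 (t0 + e / cmod (c - z) / 2).
have d0 : 0 < e / cmod (c - z) by rewrite divr_gt0.
have tt : t0 < t by rewrite lt_min lt1 ltrDl divr_gt0.
have : S t.
  split.
    by rewrite (le_trans t00 (ltW tt)) ge_min lexx.
  apply: He; rewrite xd -ltr_pdivlMr// gtr0_norm ?subr_gt0//.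
  have : t <= t0 + e / cmod (c - z) / 2 by rewrite ge_min lexx orbT.
  lra.
move=> /(sup_upper_bound supS); rewrite leNgt -/t0 tt//.
Qed.

End ComplexTopology.

(** * Arcs of large circles inside a domain with convex complement *)

Section ConcaveDomains.
Context {R : realType}.
Local Open Scope complex_scope.
Implicit Types (z w q c : R[i]) (W : set R[i]) (h : R[i] -> R[i]).

Lemma polar_cexp (r t : R) : polar r t = r%:C * cexp (0 +i* t).
Proof. by rewrite /cexp /polar /= expR0 !mul1r; apply: complex_ext => /=; ring. Qed.

Lemma cexp_circle_dist (s t : R) :
  cmod (cexp (0 +i* s) - cexp (0 +i* t)) <= 2 * `|s - t|.
Proof.
have -> : cexp (0 +i* s) - cexp (0 +i* t) =
    cexp (0 +i* t) * (cexp (0 +i* (s - t)) - 1).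
  by rewrite mulrBr mulr1 -cexpD; congr (cexp _ - _); apply: complex_ext => /=; ring.
rewrite cmodM cmod_cexp [Re _]/= expR0 mul1r; set u := s - t.
have iu : cmod (0 +i* u) = `|u| by rewrite /= expr0n add0r sqrtr_sqr.
have := @mean_value_segment R cexp cexp 0 (0 +i* u) 1; rewrite add0r cexp0 iu mul1r.
move=> H; have /H : forall r : R, 0 <= r <= 1 -> sderiv cexp (0 + r%:C * (0 +i* u)) (cexp (0 + r%:C * (0 +i* u))) /\
    cmod (cexp (0 + r%:C * (0 +i* u))) <= 1.
  move=> r _; split; first exact: sderiv_cexp.
  by rewrite cmod_cexp add0r reM /= !mul0r mulr0 subrr expR0.
by move=> le; apply: (le_trans le); rewrite mulr_natl mulr2n lerDl.
Qed.

Lemma adherent_convex W z w (t : R) : convexC W -> 0 <= t <= 1 ->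
  adherent W z -> adherent W w -> adherent W (t%:C * z + (1 - t)%:C * w).
Proof.
move=> cW t01 Wz Ww e e0; have [c Wc cz] := Wz e e0; have [d Wd dw] := Ww e e0.
exists (t%:C * c + (1 - t)%:C * d); first exact: cW.
have -> : t%:C * c + (1 - t)%:C * d - (t%:C * z + (1 - t)%:C * w) =
  t%:C * (c - z) + (1 - t)%:C * (d - w) by ring.
apply: le_lt_trans (cmodD _ _) _; case/andP: t01 => t0 t1.
rewrite !cmodM !cmod_real !ger0_norm ?subr_ge0//.
have [->|tn0] := eqVneq t 0; first by rewrite mul0r add0r subr0 mul1r.
have : t * cmod (c - z) < t * e by rewrite ltr_pM2l// lt_def tn0.
have : (1 - t) * cmod (d - w) <= (1 - t) * e by rewrite ler_wpM2l ?subr_ge0// ltW.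
lra.
Qed.

(* The point at distance r from q on the way to a far point polar rho t' tends
   to q + polar r t as t' tends to t and rho to infinity. *)
Lemma eventually_in_domain W q (a b : R) : convexC (~` W) -> adherent (~` W) q ->
  (forall t : R, a <= t <= b -> exists2 r : R, 0 <= r & ~ adherent (~` W) (q + polar r t)) ->
  exists rho0 : R, forall rho : R, rho0 < rho -> forall t, a <= t <= b -> W (polar rho t).
Proof.
move=> cW Wq H; have cab := @segment_compact R a b.
have near_cov : forall t : R, `[a, b]%classic t ->
    \forall t' \near t & rho \near (+oo : set_system R), W (polar rho t').
  move=> t; rewrite /= in_itv /= => /H[r r0 nW].
  have {}nW : exists2 e : R, 0 < e & forall c, ~ W c -> e <= cmod (c - (q + polar r t)).
    apply: contrapT => K; apply: nW => e e0; apply: contrapT => K'; apply: K.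
    exists e => // c nWc; rewrite leNgt; apply/negP => lt; apply: K'.
    by exists c.
  have [e e0 He] := nW.
  have rp : 0 < r + 1 by rewrite ltr_wpDl.
  pose B := r * cmod q + 1.
  have B0 : 0 < B by rewrite ltr_wpDl// mulr_ge0// cmod_ge0.
  (* The two thresholds keep the effect of the rotation from t to t' and that of the shift l q below
     e / 4 each. *)
  exists (ball t (e / 8 / (r + 1)), [set rho | Num.max (r + 1) (4 * B / e) < rho]).
    split; first by apply: nbhsx_ballx; rewrite !divr_gt0.
    by apply: nbhs_pinfty_gt; exact: num_real.
  move=> [t' rho] [/= tt]; rewrite /= gt_max => /andP[rrho Brho].
  have rho0 : 0 < rho by apply: lt_trans rrho.
  apply: contrapT => nWz.
  pose l := r / rho.
  have l01 : 0 <= l <= 1.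
    by rewrite divr_ge0 ?(ltW rho0)//= ler_pdivrMr// mul1r; lra.
  have Wx : adherent (~` W) (l%:C * polar rho t' + (1 - l)%:C * q).
    apply: adherent_convex => // e1 e10; exists (polar rho t') => //.
    by rewrite subrr cmod0.
  have e2 : 0 < e / 2 by rewrite divr_gt0.
  have [c nWc cx] := Wx _ e2; have := He c nWc; apply/negP; rewrite -ltNge.
  apply: le_lt_trans (cmod_triangle _ _ (l%:C * polar rho t' + (1 - l)%:C * q)) _.
  have -> : l%:C * polar rho t' + (1 - l)%:C * q - (q + polar r t) =
      r%:C * (cexp (0 +i* t') - cexp (0 +i* t)) - l%:C * q.
    rewrite !polar_cexp.
    have -> : l%:C * (rho%:C * cexp (0 +i* t')) = r%:C * cexp (0 +i* t').
      by rewrite mulrA -rmorphM /l divfK// gt_eqF.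
    have -> : (1 - l)%:C = 1 - l%:C :> R[i] by rewrite rmorphB.
    ring.
  have h1 : cmod (r%:C * (cexp (0 +i* t') - cexp (0 +i* t)) - l%:C * q) <=
      r * (2 * `|t' - t|) + l * cmod q.
    apply: le_trans (cmodB _ _) _; rewrite !cmodM !cmod_real.
    rewrite (ger0_norm r0) ger0_norm; last by case/andP: l01.
    by rewrite lerD2r; apply: ler_wpM2l => //; exact: cexp_circle_dist.
  have h2 : r * (2 * `|t' - t|) <= e / 4.
    rewrite distrC; have : `|t - t'| <= e / 8 / (r + 1) by apply: ltW.
    rewrite ler_pdivlMr// => h.
    have : `|t - t'| * r <= `|t - t'| * (r + 1) by rewrite ler_wpM2l// lerDl.
    lra.
  have h3 : l * cmod q < e / 4.
    rewrite /l mulrAC ltr_pdivrMr//.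
    move: Brho; rewrite ltr_pdivrMr// /B; have := mulr_ge0 r0 (cmod_ge0 q); lra.
  lra.
(* Compactness of [a, b] makes the threshold for rho uniform in the angle. *)
have := (compact_near_coveringP _).1 cab _ _ _ _ near_cov.
move=> [rho0 [_ Hrho]]; exists rho0 => rho /Hrho K t tab.
by apply: K; rewrite /= in_itv.
Qed.

Lemma polar_2pi (r t : R) : polar r (t + pi *+ 2) = polar r t.
Proof. by rewrite /polar cosD2pi sinD2pi. Qed.

(** [lebesgue_measure] is an outer measure on all sets, hence monotone also on sets of unknown
    measurability. *)
Lemma lebesgue_le (A B : set R) : A `<=` B ->
  (lebesgue_measure A <= lebesgue_measure B)%E.
Proof.
move=> AB; rewrite /lebesgue_measure /lebesgue_stieltjes_measure /measure_extension.
exact: le_outer_measure.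
Qed.

(** The interval of angles may run past pi; the part beyond is moved back by 2 pi, and b - a < 2 pi
    keeps it disjoint from the rest. *)
Lemma arc_measure_ge0 W (rho a b : R) : - pi < a <= pi -> a <= b -> b - a < pi *+ 2 ->
  (forall t, a <= t <= b -> W (polar rho t)) -> ((b - a)%:E <= arc_measure W rho)%E.
Proof.
move=> /andP[a1 a2] ab ba H; rewrite mulr2n in ba.
have [bpi|pib] := leP b pi.
  apply: le_trans (_ : lebesgue_measure `[a, b]%classic <= _)%E.
    rewrite lebesgue_measure_itv /= lte_fin.
    move: (ab); rewrite le_eqVlt => /orP[/eqP->|->]; first by rewrite ltxx subrr.
    by rewrite -EFinD.
  apply: lebesgue_le => t /=; rewrite in_itv /= => tab; split; last exact: H.
  by case/andP: tab => t1 t2; apply/andP; split; lra.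
have disj : `[a, pi]%classic `&` `]- pi, (b - pi *+ 2)]%classic = set0 :> set R.
  apply/seteqP; split => // t [] /=; rewrite !in_itv /= mulr2n => /andP[t1 _] /andP[_ t2].
  lra.
pose U : set R := `[a, pi]%classic `|` `]- pi, (b - pi *+ 2)]%classic.
apply: le_trans (_ : lebesgue_measure U <= _)%E; rewrite /U.
  rewrite measureU//= !lebesgue_measure_itv /= !lte_fin.
  have -> : - pi < b - pi *+ 2 by rewrite mulr2n; lra.
  move: (a2); rewrite le_eqVlt => /orP[/eqP->|->].
    by rewrite ltxx add0e -!EFinD lee_fin mulr2n; lra.
  by rewrite -!EFinD lee_fin mulr2n; lra.
apply: lebesgue_le => t /= []; rewrite in_itv /= => /andP[t1 t2].
  split; first by apply/andP; split; lra.
  by apply: H; apply/andP; split; lra.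
rewrite mulr2n in t2; split; first by apply/andP; split; lra.
by rewrite -polar_2pi; apply: H; apply/andP; split; rewrite mulr2n; lra.
Qed.

(** The range of a is that of the angles Im (L1 z) + th + pi in [sector_log]. *)
Lemma arc_measure_ge W (rho a b : R) : - pi < a < pi *+ 3 -> a <= b -> b - a < pi *+ 2 ->
  (forall t, a <= t <= b -> W (polar rho t)) -> ((b - a)%:E <= arc_measure W rho)%E.
Proof.
move=> /andP[a1 a2] ab ba H; have [api|pia] := leP a pi.
  by apply: arc_measure_ge0 => //; rewrite a1.
have -> : b - a = (b - pi *+ 2) - (a - pi *+ 2) by ring.
apply: arc_measure_ge0.
- by apply/andP; split; rewrite mulr2n; move: a2; rewrite mulrS mulr2n; lra.
- by rewrite lerD2r.
- by rewrite (_ : b - pi *+ 2 - (a - pi *+ 2) = b - a)//; ring.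
- move=> t /andP[t1 t2]; rewrite -polar_2pi; apply: H.
  by rewrite -lerBlDr t1 /= -lerBrDr.
Qed.

End ConcaveDomains.

(** * Open mapping and variation of the imaginary part *)

Section OpeningAngle.
Context {R : realType}.
Local Open Scope complex_scope.
Implicit Types (z w q c l : R[i]) (W : set R[i]) (f h : R[i] -> R[i]).

(** The open mapping argument: if some c outside W were very close to h z0, then 1 / (h - c) would
    be smooth on a small disk about z0 and larger at its centre than on its boundary. *)
Lemma image_not_adherent W h z0 l : (forall z, cmod z < 1 -> smooth h z) ->
  (forall z, cmod z < 1 -> W (h z)) -> cmod z0 < 1 -> sderiv h z0 l -> l != 0 ->
  ~ adherent (~` W) (h z0).
Proof.
move=> sh Wh z01 [C [d [C0 d0 H]]] l0 adh.
have lp : 0 < cmod l by rewrite cmod_gt0.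
have C1 : 0 < C + 1 by rewrite ltr_wpDl.
pose r := Num.min (d / 2) (Num.min ((1 - cmod z0) / 2) (cmod l / (C + 1) / 2)).
have r0 : 0 < r by rewrite !lt_min !divr_gt0// subr_gt0.
have rd : r < d by apply: le_lt_trans (_ : d / 2 < d); [rewrite ge_min lexx|lra].
have rz : r < 1 - cmod z0.
  apply: le_lt_trans (_ : (1 - cmod z0) / 2 < _); first by rewrite !ge_min lexx !orbT.
  lra.
have rl : C * r <= cmod l / 2.
  have : r <= cmod l / (C + 1) / 2 by rewrite !ge_min lexx !orbT.
  rewrite -mulrA mulrCA ler_pdivlMl// mulrC => h1.
  have : C * r <= (C + 1) * r by rewrite ler_pM2r// lerDl.
  by rewrite mulrC in h1; lra.
have in_disk z : cmod (z - z0) <= r -> cmod z < 1.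
  move=> zr; have := cmodD (z - z0) z0; rewrite subrK; lra.
have lr8 : 0 < cmod l * r / 8 by rewrite divr_gt0// mulr_gt0.
have [c nWc cz] := adh _ lr8.
have hc z : cmod (z - z0) <= r -> h z - c != 0.
  move=> /in_disk z1; rewrite subr_eq0; apply/eqP => hz; apply: nWc.
  by rewrite -hz; exact: Wh.
(* The inner radius -1 makes the annulus a full disk. On its boundary |h - c| >= |l| r / 2 - |l| r /
   8 = 3 |l| r / 8, whereas at z0 it is below |l| r / 8. *)
have := @max_principle R (fun z => (h z - c)^-1) z0 (-1) r (8 / (3 * (cmod l * r))) _ _ z0.
rewrite subrr cmod0 lerN10 (ltW r0).
have smf z : -1 <= cmod (z - z0) <= r -> smooth (fun z => (h z - c)^-1) z.
  case/andP=> _ zr; apply: (@smooth_comp R (fun z => h z - c) (fun x => x^-1)).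
    by apply: smoothB; [apply: sh; exact: in_disk|exact: smooth_cst].
  by apply: smooth_inv; exact: hc.
move=> /(_ smf).
have hb z : -1 <= cmod (z - z0) <= r -> cmod (z - z0) = -1 \/ cmod (z - z0) = r ->
    cmod (h z - c)^-1 <= 8 / (3 * (cmod l * r)).
  move=> _ [zN1|zr]; first by have := cmod_ge0 (z - z0); lra.
  have zr' : cmod (z - z0) <= r by rewrite zr.
  have hz : 0 < cmod (h z - c) by rewrite cmod_gt0 hc.
  rewrite cmodV -[leRHS]invf_div lef_pV2 ?posrE//; last first.
    by rewrite divr_gt0// mulr_gt0// mulr_gt0.
  have zd : cmod (z - z0) < d by rewrite zr.
  have := H _ zd; rewrite (addrC z0) subrK zr.
  have := cmod_ge_sub (l * (z - z0)) (h z - h z0 - l * (z - z0)).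
  rewrite (_ : l * (z - z0) + (h z - h z0 - l * (z - z0)) = h z - h z0); last by ring.
  have := cmod_triangle (h z) (h z0) c; rewrite cmodM zr.
  have : C * r ^+ 2 <= cmod l * r / 2.
    by rewrite expr2 mulrA [leRHS]mulrAC ler_pM2r.
  set x := cmod l * r in lr8 cz *; lra.
move=> /(_ hb isT); rewrite cmodV leNgt => /negP; apply.
have hz0 : 0 < cmod (h z0 - c) by rewrite cmod_gt0 hc// subrr cmod0 ltW.
rewrite -[ltLHS]invf_div ltf_pV2 ?posrE//; last by rewrite divr_gt0// !mulr_gt0.
rewrite cmodC; apply: lt_trans cz _; set x := cmod l * r in lr8 *; lra.
Qed.

(* Moving along +-i / l changes the imaginary part in both directions. *)
Lemma sderiv_Im_moves f l (e : R) : sderiv f 0 l -> l != 0 -> e ^+ 2 = 1 ->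
  exists2 z, cmod z < 1 & 0 < e * Im (f z - f 0).
Proof.
move=> [C [d [C0 d0 H]]] l0 e1.
have lp : 0 < cmod l by rewrite cmod_gt0.
have C1 : 0 < C + 1 by rewrite ltr_wpDl.
have en : `|e| = 1.
  by apply/eqP; rewrite -(@eqrXn2 _ 2)// real_normK ?num_real// e1 expr1n.
pose r := Num.min (d / 2) (Num.min (1 / 2) (cmod l / (C + 1) / 2)).
have r0 : 0 < r by rewrite !lt_min !divr_gt0.
have rd : r < d by apply: le_lt_trans (_ : d / 2 < d); [rewrite ge_min lexx|lra].
have r1 : r < 1.
  by apply: le_lt_trans (_ : 1 / 2 < 1); [rewrite !ge_min lexx !orbT|lra].
have rl : C * r <= cmod l / 2.
  have : r <= cmod l / (C + 1) / 2 by rewrite !ge_min lexx !orbT.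
  rewrite mulrAC ler_pdivlMr// => h1.
  have : r * C <= r * (C + 1) by rewrite ler_pM2l// lerDl.
  by rewrite [C * r]mulrC; lra.
pose s := r%:C * (cmod l)%:C * (0 +i* e) / l.
have sr : cmod s = r.
  rewrite /s cmod_div !cmodM !cmod_real !ger0_norm ?cmod_ge0 ?ltW// /=.
  by rewrite expr0n add0r e1 sqrtr1 mulr1 mulfK// gt_eqF.
exists s; rewrite ?sr//.
have sd : cmod s < d by rewrite sr.
have := H s sd; rewrite add0r sr.
have ls : l * s = 0 +i* (r * cmod l * e).
  rewrite /s mulrC divfK//; apply: complex_ext => /=; ring.
set q := f s - f 0 - l * s => qle.
have -> : f s - f 0 = l * s + q by rewrite /q; ring.
rewrite imD ls /= mulrDr (mulrC _ e) mulrA -expr2 e1 mul1r.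
have : `|e * Im q| <= C * r ^+ 2.
  by rewrite normrM en mul1r (le_trans _ qle)// cmod_ge_Im.
have : C * r ^+ 2 <= r * cmod l / 2.
  by rewrite expr2 mulrA mulrC -mulrA ler_pM2l.
have : 0 < r * cmod l by rewrite mulr_gt0.
rewrite ler_norml; lra.
Qed.

Lemma smooth_continuous_segment f z w : (forall t : R, 0 <= t <= 1 ->
    smooth f (z + t%:C * (w - z))) ->
  {within `[0 : R, 1], continuous (fun t : R => Im (f (z + t%:C * (w - z))))}.
Proof.
move=> sf; apply: derivable_within_continuous => t; rewrite in_itv /= => /sf /smooth_sderiv.
move=> [l [C [d [C0 d0 H]]]].
have s1 : 0 < cmod (w - z) + 1 by rewrite ltr_wpDl ?cmod_ge0.
suff : is_derive t (1 : R) (fun t : R => Im (f (z + t%:C * (w - z)))) (Im (l * (w - z))).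
  by case.
apply: (@is_derive_quadratic _ _ _ _ (C * cmod (w - z) ^+ 2) (d / (cmod (w - z) + 1))).
  by rewrite divr_gt0.
move=> k kd; have hs : cmod (k%:C * (w - z)) < d.
  rewrite cmodM cmod_real; rewrite ltr_pdivlMr// in kd.
  by apply: le_lt_trans kd; rewrite ler_wpM2l// lerDl.
apply: le_trans (le_trans (H _ hs) _); last first.
  by rewrite le_eqVlt; apply/orP; left; apply/eqP; rewrite cmodM cmod_real; ring.
apply: le_trans (cmod_ge_Im _); rewrite le_eqVlt; apply/orP; left; apply/eqP.
congr `| _ |; have -> : (t + k)%:C = t%:C + k%:C by rewrite rmorphD.
rewrite mulrDl addrA !imD !imN; congr (_ - _ - _).
by rewrite !imM !reM ?imM /=; ring.
Qed.

End OpeningAngle.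

(** * A branch of the logarithm with values in a strip *)

Section SectorLog.
Context {R : realType}.
Local Open Scope complex_scope.
Implicit Types (z w q c l : R[i]) (W : set R[i]) (f h : R[i] -> R[i]).

(** If every ray from q left the closure of the complement, all large circles would lie in W by
    [eventually_in_domain], although the complement is unbounded. *)
Lemma recession_direction W q : convexC (~` W) -> adherent (~` W) q ->
  (forall M : R, exists2 p, ~ W p & M < cmod p) ->
  exists2 th : R, - pi <= th <= pi &
    forall r : R, 0 <= r -> adherent (~` W) (q + polar r th).
Proof.
move=> cW Wq unb; apply: contrapT => K.
have [|rho0 H] := @eventually_in_domain R W q (- pi) pi cW Wq.
  move=> t tpi; apply: contrapT => K'; apply: K; exists t => // r r0.
  by apply: contrapT => K''; apply: K'; exists r.
have [p nWp] := unb (Num.max rho0 0); rewrite gt_max => /andP[pr p0].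
have pn0 : p != 0 by rewrite -cmod_gt0.
have [t /andP[t1 t2] pE] := polar_form pn0.
by apply: nWp; rewrite pE; apply: H => //; rewrite (ltW t1).
Qed.

Lemma cmod_seg z w (t : R) : 0 <= t <= 1 -> cmod z < 1 -> cmod w < 1 ->
  cmod (z + t%:C * (w - z)) < 1.
Proof.
move=> /andP[t0 t1] z1 w1.
have -> : z + t%:C * (w - z) = (1 - t)%:C * z + t%:C * w.
  by have -> : (1 - t)%:C = 1 - t%:C :> R[i]; [rewrite rmorphB|ring].
apply: le_lt_trans (cmodD _ _) _; rewrite !cmodM !cmod_real !ger0_norm ?subr_ge0//.
have [->|tn0] := eqVneq t 0; first by rewrite mul0r addr0 subr0 mul1r.
have : t * cmod w < t * 1 by rewrite ltr_pM2l// lt_def tn0.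
have : (1 - t) * cmod z <= (1 - t) * 1 by apply: ler_wpM2l; [rewrite subr_ge0|exact: ltW].
lra.
Qed.

(** Rotating the ray of [recession_direction] onto the negative axis sends h - q to u, up to the
    factor -1 that is built into u. As h(D) avoids the closure of the complement, u avoids the
    branch cut of [Log]. *)
Lemma sector_log (alpha beta : R) W h q l :
  1 <= alpha <= 2 -> convexC (~` W) -> opening_angle_at_infinity W beta ->
  beta <= pi * alpha -> adherent (~` W) q ->
  (forall z, cmod z < 1 -> smooth h z) ->
  (forall z, cmod z < 1 -> ~ adherent (~` W) (h z)) ->
  sderiv h 0 l -> l != 0 ->
  exists L mu, [/\ `|mu| < pi / 2, forall z, cmod z < 1 -> smooth L z, L 0 = 0,
    forall z, cmod z < 1 -> (h z - q) / (h 0 - q) = cexp (L z) &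
    forall z, cmod z < 1 -> `|Im (L z) / alpha - mu| <= pi / 2].
Proof.
move=> /andP[a1 a2] cW [unb lim] bpi Wq sh nWh dh l0.
have alpha0 : 0 < alpha by lra.
have z01 : cmod (0 : R[i]) < 1 by rewrite cmod0.
have pi0 := pi_gt0 R.
have [th /andP[th1 th2] ray] := recession_direction cW Wq unb.
pose e := cexp (0 +i* - th).
have e0 : e != 0 by apply: cexp_neq0.
pose u z := - (h z - q) * e; pose L1 z := Log (u z).
have uE z : h z = q + cexp (0 +i* (th + pi)) * u z.
  have -> : cexp (0 +i* (th + pi)) = - cexp (0 +i* th).
    by rewrite /cexp /polar /= cosDpi sinDpi; apply: complex_ext => /=; ring.
  rewrite /u mulrA mulrNN mulrAC -cexpD.
  have -> : (0 +i* th) + (0 +i* - th) = 0 :> R[i].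
    by apply: complex_ext => /=; ring.
  by rewrite cexp0 mul1r addrC subrK.
have slu z : cmod z < 1 -> slit (u z).
  move=> z1; rewrite /slit ltNge; apply/negP => ule; apply: (nWh z z1).
  have := cmod_ge_Re (u z); rewrite ler_norml => /andP[ge _].
  have re : Re (u z) = - cmod (u z) by lra.
  have im : Im (u z) = 0.
    have := cmod_sqr (u z); rewrite re sqrrN => /eqP.
    by rewrite -subr_eq0 opprD addrA subrr add0r oppr_eq0 sqrf_eq0 => /eqP.
  have : u z = - (cmod (u z))%:C by apply: complex_ext; rewrite ?reN ?imN//= ?re ?im ?oppr0.
  move=> uz; rewrite uE uz.
  have -> : cexp (0 +i* (th + pi)) * - (cmod (u z))%:C = polar (cmod (u z)) th.
    rewrite polar_cexp /cexp /polar /= cosDpi sinDpi; apply: complex_ext => /=; ring.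
  exact/ray/cmod_ge0.
have su z : cmod z < 1 -> smooth u z.
  move=> z1; apply: smoothM; last exact: smooth_cst.
  by apply: smoothN; apply: smoothB; [exact: sh|exact: smooth_cst].
have sL1 z : cmod z < 1 -> smooth L1 z.
  by move=> z1; apply: smooth_comp; [exact: su|apply: smooth_Log; exact: slu].
have hpol z : cmod z < 1 -> h z = q + polar (cmod (u z)) (Im (L1 z) + th + pi).
  move=> z1; rewrite uE; congr (_ + _).
  rewrite -{1}(cexp_Log (slu z z1)) -/(L1 z) -cexpD polar_cexp.
  have -> : (0 +i* (th + pi)) + L1 z = (Re (L1 z))%:C + (0 +i* (Im (L1 z) + th + pi)).
    by apply: complex_ext => /=; ring.
  by rewrite cexpD cexp_real /L1 /= lnK// posrE slit_neq0// slu.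
have width z1 z2 : cmod z1 < 1 -> cmod z2 < 1 -> Im (L1 z2) - Im (L1 z1) <= pi * alpha.
  move=> z11 z21; rewrite leNgt; apply/negP => wide.
  have := Im_Log_bound (u z1); have := Im_Log_bound (u z2).
  rewrite -!/(L1 _) !ltr_norml; set a := Im (L1 z1) in wide *; set b := Im (L1 z2) in wide *.
  move=> /andP[b1 b2] /andP[a3 a4].
  have pa : 0 < pi * alpha by rewrite mulr_gt0.
  have ab : a <= b by lra.
  have [|rho0 H] := @eventually_in_domain R W q (a + th + pi) (b + th + pi) cW Wq.
    (* Along the segment from z1 to z2 every height between a and b is attained, so each direction t
       contains a point that is not adherent to the complement. *)
    move=> t /andP[ta tb]; pose g (s : R) := Im (L1 (z1 + s%:C * (z2 - z1))).
    have g0 : g 0 = a by rewrite /g mul0r addr0.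
    have g1 : g 1 = b by rewrite /g mul1r addrC subrK.
    have cg : {within `[0 : R, 1], continuous g}.
      by apply: smooth_continuous_segment => s s01; apply: sL1; exact: cmod_seg.
    have [|s] := IVT ler01 cg (v := t - th - pi).
      by rewrite g0 g1 ge_min le_max; apply/andP; split; apply/orP; [left|right]; lra.
    rewrite in_itv /= => s01 gs; set z := z1 + s%:C * (z2 - z1) in gs.
    have zd : cmod z < 1 by apply: cmod_seg.
    exists (cmod (u z)); first exact: cmod_ge0.
    have := nWh z zd; rewrite (hpol z zd).
    by rewrite (_ : Im (L1 z) + th + pi = t)//; move: gs; rewrite /g -/z; lra.
  have : ((b - a)%:E <= beta%:E)%E.
    apply: cvge_ge lim; exists rho0; split; first exact: num_real.
    move=> rho /= rr; have -> : b - a = (b + th + pi) - (a + th + pi) by ring.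
    apply: arc_measure_ge (H rho rr).
    - by rewrite mulrS mulr2n; apply/andP; split; lra.
    - lra.
    - by rewrite mulr2n; lra.
  by rewrite lee_fin; lra.
pose S := [set Im (L1 z) | z in disk (R := R)].
have S0 : S !=set0 by exists (Im (L1 0)); exists 0.
have Sb z : cmod z < 1 -> - pi < Im (L1 z) < pi.
  by move=> _; rewrite -ltr_norml; exact: Im_Log_bound.
have supS : has_sup S.
  by split => //; exists pi => _ [z z1 <-]; case/andP: (Sb z z1) => _ /ltW.
have infS : has_inf S.
  by split => //; exists (- pi) => _ [z z1 <-]; case/andP: (Sb z z1) => /ltW.
set a := inf S; set b := sup S.
have Sa z : cmod z < 1 -> a <= Im (L1 z).
  by move=> z1; apply: inf_lbound; [case: infS|exists z].
have Sb' z : cmod z < 1 -> Im (L1 z) <= b.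
  by move=> z1; apply: sup_upper_bound => //; exists z.
have ab : b - a <= pi * alpha.
  rewrite lerBlDr; apply: ge_sup => // _ [z z1 <-].
  rewrite -lerBlDl; apply: lb_le_inf => // _ [w w1 <-].
  by have := width w z w1 z1; lra.
have u00 : u 0 != 0 by rewrite -cmod_gt0 slit_neq0// slu.
have hq : h 0 - q != 0 by move: u00; rewrite /u mulf_eq0 negb_or oppr_eq0 => /andP[].
have [l1 [dL1 l10]] : exists l1, sderiv L1 0 l1 /\ l1 != 0.
  exists ((u 0)^-1 * (- (l - 0) * e + - (h 0 - q) * 0)); split.
    apply: (@sderiv_comp _ u Log); last by apply: sderiv_Log; exact: slu.
    apply: sderivM; last exact: sderiv_cst.
    by apply: sderivN; apply: sderivB => //; exact: sderiv_cst.
  by rewrite mulr0 addr0 subr0 !mulf_neq0 ?oppr_eq0 ?invr_eq0.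
(* The height at 0 lies strictly between a and b, as the derivative of L1 at 0 is nonzero; this
   makes |mu| < pi / 2 strict. *)
have [zp zp1] := sderiv_Im_moves dL1 l10 (expr1n _ 2).
rewrite mul1r imD imN => up; have up' := Sb' zp zp1.
have N1 : (-1 : R) ^+ 2 = 1 by rewrite sqrrN expr1n.
have [zm zm1] := sderiv_Im_moves dL1 l10 N1.
rewrite mulN1r imD imN => um; have um' := Sa zm zm1.
exists (fun z => L1 z - L1 0), (((a + b) / 2 - Im (L1 0)) / alpha); split.
- rewrite normrM normfV (gtr0_norm alpha0) ltr_pdivrMr// ltr_norml; apply/andP; split; lra.
- by move=> z z1; apply: smoothB; [exact: sL1|exact: smooth_cst].
- by rewrite subrr.
- move=> z z1; rewrite cexpB !cexp_Log ?slu//.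
  by rewrite /u; field; apply/andP; split; [exact: e0|exact: hq].
- move=> z z1; rewrite imD imN.
  have -> : (Im (L1 z) - Im (L1 0)) / alpha - ((a + b) / 2 - Im (L1 0)) / alpha =
    (Im (L1 z) - (a + b) / 2) / alpha by ring.
  rewrite normrM normfV (gtr0_norm alpha0) ler_pdivrMr//.
  have := Sa z z1; have := Sb' z z1; rewrite ler_norml => ? ?; apply/andP; split; lra.
Qed.

End SectorLog.

(** * The extremal map and the recursion of its coefficients *)

Section KoebeSeries.
Context {R : realType}.
Local Open Scope complex_scope.
Implicit Types (z w : R[i]).

Lemma one_addN_neq0 z : cmod z < 1 -> (1 + z != 0) * (1 - z != 0) * (1 - z ^+ 2 != 0).
Proof.
move=> z1; have h1 : 1 + z != 0.
  by apply/eqP => h; have := Re_1D_gt0 z1; rewrite h ltxx.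
have h2 : 1 - z != 0.
  by apply/eqP => h; have := @Re_1D_gt0 _ (- z); rewrite cmodN h ltxx => /(_ z1).
split; first by split.
by have -> : 1 - z ^+ 2 = (1 + z) * (1 - z); [ring|rewrite mulf_neq0].
Qed.

Lemma sderiv_sector_map1 (alpha : R) z : cmod z < 1 ->
  sderiv (sector_map alpha 1) z
    (sector_map alpha 1 z * ((2 * alpha)%:C / (1 - z ^+ 2))).
Proof.
move=> z1; have z1' : cmod (1 * z) < 1 by rewrite mul1r.
have z1'' : cmod (-1 * z) < 1 by rewrite mulN1r cmodN.
have [[h1 h2] h3] := one_addN_neq0 z1.
have := sderivM (sderiv_cpower alpha z1') (sderiv_cpower (- alpha) z1'').
congr (sderiv _ _ _); rewrite /sector_map mul1r mulN1r.
have -> : (- alpha)%:C = - alpha%:C :> R[i] by rewrite rmorphN.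
have -> : (2 * alpha)%:C = 2 * alpha%:C :> R[i] by rewrite rmorphM rmorph_nat.
by field; rewrite h1 h2 h3.
Qed.

Lemma smooth_sector_map1 (alpha : R) z : cmod z < 1 -> smooth (sector_map alpha 1) z.
Proof.
by move=> z1; apply: smoothM; apply: smooth_cpower; rewrite ?mul1r ?mulN1r ?cmodN.
Qed.

Lemma sector_map0 (alpha : R) y : sector_map alpha y 0 = 1.
Proof. by rewrite /sector_map !cpower0 mulr1. Qed.

Lemma sector_mapE (alpha : R) z : sector_map alpha 1 z =
  cexp (alpha%:C * (Log (1 + z) - Log (1 - z))).
Proof.
rewrite /sector_map /cpower -cexpD mul1r mulN1r; congr cexp.
by rewrite (_ : (- alpha)%:C = - alpha%:C :> R[i]); [ring|rewrite rmorphN].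
Qed.

Lemma sector_map_neq0 (alpha : R) z : sector_map alpha 1 z != 0.
Proof. by rewrite sector_mapE cexp_neq0. Qed.

Lemma sector_map_real (alpha x : R) : 0 <= x < 1 ->
  sector_map alpha 1 x%:C = (((1 + x) / (1 - x)) `^ alpha)%:C.
Proof.
move=> /andP[x0 x1].
have p1 : 0 < 1 + x by lra.
have p2 : 0 < 1 - x by lra.
rewrite sector_mapE; have -> : 1 + x%:C = (1 + x)%:C :> R[i] by rewrite rmorphD.
have -> : 1 - x%:C = (1 - x)%:C :> R[i] by rewrite rmorphB.
rewrite !Log_real// -rmorphB -rmorphM cexp_real /powR gt_eqF ?divr_gt0//.
by rewrite ln_div ?posrE.
Qed.

Lemma fulljet_poly (p : {poly R[i]}) : fulljet (fun x => p.[x]) (fun i => p`_i).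
Proof.
move=> n; have H : jet n (fun x => p.[x]) 0 p.
  apply: (@bigO_eq _ _ _ (fun s => 0 * s ^+ n) 1) => // [s _|].
    by rewrite /= add0r subrr mul0r.
  exact: (bigOM (bigO_cst 0) (@bigO_exp R n)).
exact: jet_take H.
Qed.

Lemma sector_coef1E (alpha : R) n : sector_coef alpha 1 n = (koebe_coef alpha n)%:C.
Proof.
rewrite /koebe_coef rmorph_sum; apply: eq_bigr => i _.
by rewrite expr1n mulr1 rmorphM.
Qed.

(** Comparison of coefficients in (1 - z^2) f' = 2 alpha f for f = ((1 + z) / (1 - z))^alpha. *)
Lemma koebe_coef_recurrence (alpha : R) n :
  n.+2%:R * koebe_coef alpha n.+2 =
  2 * alpha * koebe_coef alpha n.+1 + n%:R * koebe_coef alpha n.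
Proof.
have o1 : cmod (1 : R[i]) = 1 by exact: cmod1.
have Fj := sector_map_jet alpha o1.
have z0 : cmod (0 : R[i]) < 1 by rewrite cmod0.
pose dF z := sector_map alpha 1 z * ((2 * alpha)%:C / (1 - z ^+ 2)).
have [b db] : exists b, fulljet dF b.
  apply: fulljet_exists; apply: smoothM; first exact: smooth_sector_map1.
  apply: smoothM; first exact: smooth_cst.
  apply: (@smooth_comp _ (fun z => 1 - z ^+ 2) (fun x => x^-1)).
    by apply: smoothB; [exact: smooth_cst|exact: smoothM (smooth_id _) (smooth_id _)].
  by apply: smooth_inv; rewrite expr0n subr0 oner_neq0.
have bE := fulljet_deriv ltr01 (fun s => @sderiv_sector_map1 alpha s) db Fj.
pose p : {poly R[i]} := 1 - 'X^2.
have E1 := fulljetM (fulljet_poly p) db.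
have E2 := fulljetM (fulljet_poly (2 * alpha)%:C%:P) Fj.
have : fulljet (fun x => p.[x] * dF x)
    (fun n => \sum_(j < n.+1) ((2 * alpha)%:C%:P)`_j * sector_coef alpha 1 (n - j)).
  apply: (fulljet_eq_near ltr01 _ E2) => s s1.
  have -> : p.[s] = 1 - s ^+ 2 by rewrite /p hornerD hornerN hornerC hornerXn.
  by rewrite hornerC /dF; have [[_ _] h3] := one_addN_neq0 s1; field.
move=> /(fulljet_unique E1) /(_ n.+1).
have pE j : p`_j = (j == 0%N)%:R - (j == 2)%:R by rewrite /p coefB coef1 coefXn.
rewrite [RHS]big_ord_recl [X in _ = _ + X]big1 ?addr0 => [|i _]; last by rewrite coefC mul0r.
rewrite coefC subn0 sector_coef1E 2!big_ord_recl !pE subn0 bE sector_coef1E.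
rewrite !lift0 /= subr0 mul1r subrr mul0r add0r => H.
suff : (n.+2%:R * koebe_coef alpha n.+2)%:C =
  (2 * alpha * koebe_coef alpha n.+1 + n%:R * koebe_coef alpha n)%:C by exact: realC_inj.
have -> : (n.+2%:R * koebe_coef alpha n.+2)%:C = n.+2%:R * (koebe_coef alpha n.+2)%:C :> R[i].
  by rewrite rmorphM rmorph_nat.
have -> : (2 * alpha * koebe_coef alpha n.+1 + n%:R * koebe_coef alpha n)%:C =
    (2 * alpha)%:C * (koebe_coef alpha n.+1)%:C + n%:R * (koebe_coef alpha n)%:C :> R[i].
  by rewrite rmorphD !rmorphM !rmorph_nat.
rewrite -H -addrA -[LHS]addr0; congr (_ + _); apply/esym.
case: n {H} => [|n]; first by rewrite big_ord0 mul0r addr0.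
rewrite big_ord_recl big1 ?addr0 => [|i _]; last by rewrite pE !lift0 /= subrr mul0r.
by rewrite pE /= /bump /= sub0r mulN1r !subSS subn0 bE sector_coef1E addNr.
Qed.

Lemma koebe_coef0 (alpha : R) : koebe_coef alpha 0 = 1.
Proof. by rewrite /koebe_coef big_ord1 gbin0 ngbin0 mulr1. Qed.

Lemma koebe_coef1 (alpha : R) : koebe_coef alpha 1 = 2 * alpha.
Proof.
rewrite /koebe_coef !big_ord_recr big_ord0 /= gbin0 gbin1 ngbinS !ngbin0; lra.
Qed.

(** Both bounds propagate through the recurrence; the upper one is the value for alpha = 2, where f
    - 1 = 4 z / (1 - z)^2. *)
Lemma koebe_coef_bounds (alpha : R) n : 1 <= alpha <= 2 ->
  0 <= koebe_coef alpha n.+1 <= 4 * n.+1%:R.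
Proof.
move=> /andP[a1 a2]; elim/ltn_ind: n => -[_|[_|n ih]].
- by rewrite koebe_coef1; apply/andP; split; lra.
- have := koebe_coef_recurrence alpha 0.
  rewrite koebe_coef1 mul0r addr0 => h; apply/andP; split; nra.
have /andP[l1 u1] := ih n.+1 (ltnSn _).
have /andP[l0 u0] := ih n (leqnSn _).
have n0 : (0 : R) <= n%:R by [].
have := koebe_coef_recurrence alpha n.+1.
have e1 : n.+1%:R = n%:R + 1 :> R by rewrite -natr1.
have e2 : n.+2%:R = n%:R + 1 + 1 :> R by rewrite -[n.+2%:R]natr1 e1.
have e3 : n.+3%:R = n%:R + 1 + 1 + 1 :> R by rewrite -[n.+3%:R]natr1 e2.
rewrite e1 in u0; rewrite e2 in u1; rewrite e3 e1; set x := koebe_coef _ _ in u1 l1 *.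
set y := koebe_coef _ n.+1 in u0 l0 *; set v := koebe_coef _ _ => h.
have vle : (n%:R + 1 + 1 + 1) * v <= (n%:R + 1 + 1 + 1) * (4 * (n%:R + 1 + 1 + 1)).
  rewrite h; have : 2 * alpha * x <= 4 * x by rewrite ler_wpM2r//; lra.
  have : (n%:R + 1) * y <= (n%:R + 1) * (4 * (n%:R + 1)) by rewrite ler_wpM2l//; lra.
  lra.
have vge : (n%:R + 1 + 1 + 1) * 0 <= (n%:R + 1 + 1 + 1) * v.
  by rewrite h mulr0 addr_ge0// ?mulr_ge0//; lra.
have p0 : 0 < n%:R + 1 + 1 + 1 :> R by lra.
by move: vle vge; rewrite !(ler_pM2l p0) => -> ->.
Qed.

Lemma koebe_coef_ge0 (alpha : R) n : 1 <= alpha <= 2 -> 0 <= koebe_coef alpha n.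
Proof.
move=> a12; case: n => [|n]; first by rewrite koebe_coef0.
by have /andP[] := koebe_coef_bounds n a12.
Qed.

Definition koebe_psum (alpha : R) N : {poly R[i]} :=
  \sum_(n < N) (koebe_coef alpha n)%:C *: 'X^n.

(* The truncation error in the differential equation (1 - z^2) f' = 2 alpha f. *)
Lemma koebe_psum_defect (alpha : R) N :
  (1 - 'X^2) * (koebe_psum alpha N.+1)^`() - (2 * alpha)%:C *: koebe_psum alpha N.+1 =
  - ((N.+1%:R * koebe_coef alpha N.+1)%:C *: 'X^N +
     (N%:R * koebe_coef alpha N)%:C *: 'X^(N.+1)).
Proof.
elim: N => [|N ih].
  rewrite /koebe_psum big_ord1 koebe_coef0 koebe_coef1 mul0r scale0r addr0 scale1r.
  by rewrite expr0 derivC mulr0 sub0r mul1r.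
have -> : koebe_psum alpha N.+2 = koebe_psum alpha N.+1 + (koebe_coef alpha N.+1)%:C *: 'X^(N.+1).
  by rewrite /koebe_psum big_ord_recr.
rewrite derivD derivZ derivXn /= mulrDr scalerDr opprD addrACA ih.
have -> : N.+2%:R * koebe_coef alpha N.+2 = 2 * alpha * koebe_coef alpha N.+1 +
   N%:R * koebe_coef alpha N by exact: koebe_coef_recurrence.
rewrite -!mul_polyC !rmorphD !rmorphM !rmorph_nat -mulr_natr !exprS expr0 mulr1.
rewrite ?rmorph_nat.
ring.
Qed.

Lemma horner_koebe_psum (alpha : R) N z :
  (koebe_psum alpha N).[z] = psum (fun n => (koebe_coef alpha n)%:C) z N.
Proof.
rewrite /koebe_psum horner_sum; apply: eq_bigr => i _.
by rewrite hornerZ hornerXn.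
Qed.

End KoebeSeries.

(** * The extremal map is the sum of its Taylor series *)

Section KoebeConvergence.
Context {R : realType}.
Local Open Scope complex_scope.
Implicit Types (z w : R[i]).

Lemma sector_mapN (alpha : R) z : sector_map alpha 1 z * sector_map (- alpha) 1 z = 1.
Proof.
rewrite !sector_mapE -cexpD.
have -> : (- alpha)%:C = - alpha%:C :> R[i] by rewrite rmorphN.
by rewrite mulNr subrr cexp0.
Qed.

Lemma sector_mapN_bound (alpha rho : R) z : 0 <= alpha -> cmod z <= rho -> rho < 1 ->
  cmod (sector_map (- alpha) 1 z) <= expR (alpha * (ln 2 - ln (1 - rho))).
Proof.
move=> a0 zr r1; have zd : cmod z < 1 by apply: le_lt_trans r1.
have [[h1 h2] _] := one_addN_neq0 zd.
rewrite sector_mapE cmod_cexp ler_expR /Log !reM !reD !imD !reN !imN /= mul0r subr0.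
rewrite mulNr -mulrN opprB; apply: ler_wpM2l => //; apply: lerB.
  rewrite ler_ln ?posrE ?cmod_gt0//.
  by have := cmodB 1 z; rewrite cmod1; lra.
rewrite ler_ln ?posrE ?cmod_gt0 ?subr_gt0//.
by have := cmod_ge_sub 1 z; rewrite cmod1; lra.
Qed.

(** The inverse of the map is an integrating factor: for a partial sum P, the derivative of E = P /
    f is [koebe_psum_defect] divided by f (1 - z^2), of size N^2 |z|^N. So E z tends to E 0 = 1. *)
Lemma koebe_series (alpha : R) : 1 <= alpha <= 2 ->
  ps (fun n => (koebe_coef alpha n)%:C) (sector_map alpha 1).
Proof.
move=> a12 z z1; have /andP[a1 a2] := a12.
set rho := cmod z; pose psi x := sector_map (- alpha) 1 x.
pose M := expR (alpha * (ln 2 - ln (1 - rho))) / (1 - rho ^+ 2).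
have r0 : 0 <= rho by exact: cmod_ge0.
have r2 : 0 < 1 - rho ^+ 2 by have : rho ^+ 2 < 1; [rewrite expr_lt1|lra].
have M0 : 0 <= M by rewrite divr_ge0 ?expR_ge0// ltW.
pose Phi := cmod (sector_map alpha 1 z).
apply/climS => e e0.
have K0 : 0 < Phi * M * 8 + 1.
  by rewrite ltr_wpDl// mulr_ge0// mulr_ge0// cmod_ge0.
have rho1 : 0 <= rho < 1 by rewrite r0.
have [N0 HN0] := nat_pow_geom_small 2 rho1 (divr_gt0 e0 K0).
exists N0 => N N0N; have := HN0 N.+1 (leqW N0N).
rewrite -horner_koebe_psum; set P := koebe_psum alpha N.+1.
pose E x := P.[x] * psi x.
pose E' x := psi x / (1 - x ^+ 2) * ((1 - 'X^2) * P^`() - (2 * alpha)%:C *: P).[x].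
have dE x : cmod x < 1 -> sderiv E x (E' x).
  move=> x1; have := sderivM (sderiv_poly P x) (@sderiv_sector_map1 R (- alpha) x x1).
  congr (sderiv _ _ _); rewrite /E' -/(psi x).
  rewrite hornerD hornerN hornerZ hornerM hornerD hornerN hornerC hornerXn.
  have [[_ _] h3] := one_addN_neq0 x1.
  have -> : (2 * - alpha)%:C = - (2 * alpha)%:C :> R[i] by rewrite mulrN rmorphN.
  by field.
(* The factor 8 comes from the two monomials of the defect, each with a coefficient at most 4 (N +
   1)^2. *)
have bE x : cmod x <= rho -> cmod (E' x) <= M * (8 * N.+1%:R ^+ 2 * rho ^+ N).
  move=> xr; have x1 : cmod x < 1 by apply: le_lt_trans z1.
  have [[_ _] h3] := one_addN_neq0 x1.
  rewrite /E' koebe_psum_defect cmodM; apply: ler_pM; rewrite ?cmod_ge0//.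
    rewrite cmod_div; apply: ler_pM; rewrite ?cmod_ge0 ?invr_ge0 ?cmod_ge0//.
      by apply: sector_mapN_bound => //; lra.
    rewrite lef_pV2 ?posrE ?cmod_gt0//.
    have := cmod_ge_sub 1 (- x ^+ 2); rewrite cmod1 cmodN cmodX.
    have : cmod x ^+ 2 <= rho ^+ 2 by rewrite lerXn2r ?nnegrE ?cmod_ge0.
    lra.
  rewrite hornerN cmodN hornerD !hornerZ !hornerXn.
  have /andP[A0 A1] := koebe_coef_bounds N a12.
  have [B0 B1] : 0 <= N%:R * koebe_coef alpha N /\ N%:R * koebe_coef alpha N <= 4 * N.+1%:R ^+ 2.
    case: (N) => [|n]; first by rewrite mul0r; split=> //; rewrite mulr_ge0// sqr_ge0.
    have /andP[b0 b1] := koebe_coef_bounds n a12; split; first exact: mulr_ge0.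
    have n0 : (0 : R) <= n.+1%:R by [].
    have e2 : n.+2%:R = n.+1%:R + 1 :> R by rewrite natr1.
    rewrite e2; have : n.+1%:R * koebe_coef alpha n.+1 <= n.+1%:R * (4 * n.+1%:R) by apply: ler_wpM2l.
    by rewrite expr2; set u := n.+1%:R in n0 *; nra.
  have A2 : N.+1%:R * koebe_coef alpha N.+1 <= 4 * N.+1%:R ^+ 2.
    by rewrite expr2 mulrCA; apply: ler_wpM2l.
  apply: le_trans (cmodD _ _) _; rewrite !cmodM !cmod_real !cmodX !ger0_norm//; last exact: mulr_ge0.
  have xN : cmod x ^+ N <= rho ^+ N by rewrite lerXn2r ?nnegrE ?cmod_ge0.
  have xN1 : cmod x ^+ N.+1 <= rho ^+ N.
    rewrite exprS; apply: le_trans (_ : 1 * cmod x ^+ N <= _); last by rewrite mul1r.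
    by apply: ler_wpM2r; rewrite ?exprn_ge0 ?cmod_ge0// ltW.
  have -> : 8 * N.+1%:R ^+ 2 * rho ^+ N = 4 * N.+1%:R ^+ 2 * rho ^+ N + 4 * N.+1%:R ^+ 2 * rho ^+ N :> R by ring.
  by apply: lerD; apply: ler_pM => //; rewrite ?mulr_ge0 ?exprn_ge0 ?cmod_ge0.
have := @mean_value_segment R E E' 0 z (M * (8 * N.+1%:R ^+ 2 * rho ^+ N)).
rewrite add0r => mv.
have /mv mvE : forall t : R, 0 <= t <= 1 -> sderiv E (0 + t%:C * z) (E' (0 + t%:C * z)) /\
    cmod (E' (0 + t%:C * z)) <= M * (8 * N.+1%:R ^+ 2 * rho ^+ N).
  move=> t /andP[t0 t1]; have tz : cmod (0 + t%:C * z) <= rho.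
    by rewrite add0r cmodM cmod_real ger0_norm// ler_piMl.
  by split; [apply: dE; exact: le_lt_trans z1|exact: bE].
have E0 : E 0 = 1.
  rewrite /E /psi sector_map0 mulr1 /P horner_koebe_psum /psum big_ord_recl big1.
    by rewrite koebe_coef0 expr0 mulr1 addr0.
  by move=> i _; rewrite lift0 expr0n mulr0.
rewrite ltr_pdivlMr// => small.
have -> : P.[z] - sector_map alpha 1 z = sector_map alpha 1 z * (E z - E 0).
  by rewrite E0 /E mulrBr mulr1 mulrCA sector_mapN mulr1.
rewrite cmodM -/Phi; apply: le_lt_trans small; rewrite -/rho in mvE.
apply: le_trans (_ : Phi * (M * (8 * N.+1%:R ^+ 2 * rho ^+ N) * rho) <= _).
  by apply: ler_wpM2l => //; exact: cmod_ge0.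
have -> : Phi * (M * (8 * N.+1%:R ^+ 2 * rho ^+ N) * rho) =
  N.+1%:R ^+ 2 * rho ^+ N.+1 * (Phi * M * 8) by rewrite [rho ^+ N.+1]exprS; ring.
by apply: ler_wpM2l; [rewrite mulr_ge0 ?exprn_ge0|rewrite lerDl].
Qed.

Lemma psum_realE (A : nat -> R) (x : R) N :
  psum (fun n => (A n)%:C) x%:C N = (\sum_(n < N) A n * x ^+ n)%:C.
Proof.
by rewrite rmorph_sum; apply: eq_bigr => i _; rewrite rmorphM rmorphXn.
Qed.

Lemma koebe_partial_sum_le (alpha x : R) N : 1 <= alpha <= 2 -> 0 <= x < 1 ->
  \sum_(n < N) koebe_coef alpha n.+1 * x ^+ n.+1 <= ((1 + x) / (1 - x)) `^ alpha - 1.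
Proof.
move=> a12 x01; have /andP[x0 x1] := x01.
have xd : cmod x%:C < 1 by rewrite cmod_real ger0_norm.
have := koebe_series a12 xd; rewrite sector_map_real// => H.
rewrite lerBrDl; set F := _ `^ _.
have -> : 1 + \sum_(n < N) koebe_coef alpha n.+1 * x ^+ n.+1 =
    \sum_(n < N.+1) koebe_coef alpha n * x ^+ n.
  by rewrite big_ord_recl koebe_coef0 expr0 mulr1.
rewrite leNgt; apply/negP => lt.
have d0 : 0 < \sum_(n < N.+1) koebe_coef alpha n * x ^+ n - F by rewrite subr_gt0.
have [M HM] := H _ d0; have := HM (maxn M N.+1) (leq_maxl _ _).
rewrite psum_realE -rmorphB cmod_real; apply/negP; rewrite -leNgt.
apply: le_trans (ler_norm _); rewrite lerD2r.
rewrite -(big_mkord xpredT (fun n => koebe_coef alpha n * x ^+ n)).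
rewrite -(big_mkord xpredT (fun n => koebe_coef alpha n * x ^+ n)).
rewrite (@big_cat_nat _ _ _ N.+1 _ (maxn M N.+1))//= ?leq_maxr//.
by rewrite lerDl; apply: sumr_ge0 => i _; rewrite mulr_ge0 ?exprn_ge0 ?koebe_coef_ge0.
Qed.

End KoebeConvergence.

(** * Existence and uniqueness of the radius *)

Section Radius.
Context {R : realType}.
Variables (K t alpha : R) (m : nat).
Hypotheses (hK : 1 <= K) (ha : 1 <= alpha <= 2) (ht : 0 <= t <= 1) (hm : (0 < m)%N).
Implicit Types (x y r : R).

Lemma koebe_ratio_lt x y : 0 <= x -> x < y -> y < 1 -> (1 + x) / (1 - x) < (1 + y) / (1 - y).
Proof.
move=> x0 xy y1; rewrite ltr_pdivrMr; last lra.
by rewrite mulrAC ltr_pdivlMr; [nra|lra].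
Qed.

Lemma f_lt x y : 0 <= x -> x < y -> y < 1 -> f_ alpha x < f_ alpha y.
Proof.
case/andP: ha => a1 a2 x0 xy y1; rewrite /f_ ltr_pM2l ?invr_gt0; last lra.
rewrite ltrD2r gt0_ltr_powR//; first lra.
- by rewrite nnegrE divr_ge0; lra.
- by rewrite nnegrE divr_ge0; lra.
- exact: koebe_ratio_lt.
Qed.

Lemma f_le x y : 0 <= x -> x <= y -> y < 1 -> f_ alpha x <= f_ alpha y.
Proof.
move=> x0; rewrite le_eqVlt => /orP[/eqP->//|xy] y1.
exact/ltW/f_lt.
Qed.

Lemma f_0 : f_ alpha 0 = 0.
Proof. by rewrite /f_ addr0 subr0 divr1 powR1 subrr mulr0. Qed.

(** At 1/2 the quotient (1 + x) / (1 - x) is 3, and 3^alpha - 1 >= 2. *)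
Lemma f_half : (2 * alpha)^-1 < f_ alpha (1 / 2).
Proof.
case/andP: ha => a1 a2; rewrite /f_ -[ltLHS]mulr1 ltr_pM2l ?invr_gt0; last lra.
have -> : (1 + 1 / 2) / (1 - 1 / 2) = 3 :> R by field.
have : 3 `^ 1 <= 3 `^ alpha :> R by apply: ler_powR => //; lra.
rewrite powRr1//; lra.
Qed.

Definition radius_fun r := t * f_ alpha (r ^+ m) + 2 * K * (1 - t) / (K + 1) * f_ alpha r.

Let c_ge1 : 1 <= 2 * K / (K + 1).
Proof. by have h := hK; rewrite ler_pdivlMr; lra. Qed.

Lemma radius_funE r : radius_fun r =
  t * f_ alpha (r ^+ m) + 2 * K / (K + 1) * (1 - t) * f_ alpha r.
Proof. by rewrite /radius_fun; congr (_ + _ * _); ring. Qed.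

Lemma radius_fun_lt x y : 0 <= x -> x < y -> y < 1 -> radius_fun x < radius_fun y.
Proof.
move=> x0 xy y1; have /andP[t0 t1] := ht; rewrite !radius_funE.
have h1 := f_lt x0 xy y1.
have h2 : f_ alpha (x ^+ m) < f_ alpha (y ^+ m).
  have y0 : 0 <= y by lra.
  apply: f_lt; rewrite ?exprn_ge0//; first by rewrite ltrXn2r// -lt0n.
  by rewrite expr_lt1.
set u := f_ _ _ in h1 h2 *; set u' := f_ _ _ in h1 *.
set v := f_ _ _ in h2 *; set v' := f_ _ _ in h2 *; set c := 2 * K / _; have cg : 1 <= c := c_ge1.
(* For t = 0 strictness has to come from the second summand, otherwise the first one provides it. *)
have [t00|tn0] := eqVneq t 0.
  rewrite t00 !mul0r !add0r subr0 mulr1 ltr_pM2l//; lra.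
have tp : 0 < t by rewrite lt_def tn0.
apply: ltr_leD; first by rewrite ltr_pM2l.
by apply: ler_wpM2l; [apply: mulr_ge0; lra|exact: ltW].
Qed.

Lemma radius_fun_le x y : 0 <= x -> x <= y -> y < 1 -> radius_fun x <= radius_fun y.
Proof.
move=> x0; rewrite le_eqVlt => /orP[/eqP->//|xy] y1.
exact/ltW/radius_fun_lt.
Qed.

(** Lets the continuity of the real function follow from the smoothness of [sector_map]. *)
Lemma f_sector x : 0 <= x < 1 ->
  f_ alpha x = (2 * alpha)^-1 * (Re (sector_map alpha 1 (real_complex R x)) - 1).
Proof. by move=> x01; rewrite sector_map_real. Qed.

Local Open Scope complex_scope.

Lemma radius_exists : exists2 r : R, 0 < r < 1 & radius_fun r = (2 * alpha)^-1.
Proof.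
have m1 : (1 : R) <= m%:R by rewrite ler1n.
have m0 : (0 : R) < m%:R by lra.
have [a1 a2] := andP ha; have [t0 t1] := andP ht.
(* By Bernoulli's inequality y^m >= 1/2 as well, so [f_half] bounds both summands from below. *)
pose y : R := 1 - (2 * m%:R)^-1.
have i0 : 0 < (2 * m%:R)^-1 :> R by rewrite invr_gt0; lra.
have i1 : (2 * m%:R)^-1 <= 1 / 2 :> R by rewrite mul1r lef_pV2 ?posrE; lra.
have y1 : y < 1 by rewrite /y; lra.
have y2 : 1 / 2 <= y by rewrite /y; lra.
have ym : 1 / 2 <= y ^+ m.
  apply: le_trans (@bernoulli_sub R (2 * m%:R)^-1 m _); last by lra.
  have -> : m%:R * (2 * m%:R)^-1 = 1 / 2 :> R by field; rewrite gt_eqF.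
  lra.
have ym1 : y ^+ m < 1 by rewrite expr_lt1//; lra.
have big : (2 * alpha)^-1 <= radius_fun y.
  rewrite radius_funE.
  have h := f_half.
  have h1 : f_ alpha (1 / 2) <= f_ alpha y by apply: f_le => //; lra.
  have h2 : f_ alpha (1 / 2) <= f_ alpha (y ^+ m) by apply: f_le => //; lra.
  set i := (2 * alpha)^-1 in h *.
  have ip : 0 < i by rewrite invr_gt0; lra.
  have g1 : t * i <= t * f_ alpha (y ^+ m) by apply: ler_wpM2l; lra.
  have g2 : 1 * ((1 - t) * i) <= 2 * K / (K + 1) * ((1 - t) * f_ alpha y).
    apply: ler_pM => //; first by apply: mulr_ge0; lra.
    by apply: ler_wpM2l; lra.
  by rewrite -mulrA; lra.
pose phi := sector_map alpha (1 : R[i]).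
pose c : R := 2 * K * (1 - t) / (K + 1).
(* The factor 'i moves the real value into the imaginary part, which is what
   [smooth_continuous_segment] speaks of. *)
pose F z := 'i * (((2 * alpha)^-1)%:C * (t%:C * (phi (z ^+ m) - 1) + c%:C * (phi z - 1))).
pose G (s : R) := Im (F (0 + s%:C * (y%:C - 0))).
have Freal (s : R) : 0 <= s <= 1 -> G s = radius_fun (s * y).
  move=> /andP[s0 s1]; have sy0 : 0 <= s * y by rewrite mulr_ge0//; lra.
  have sy1 : s * y < 1 by apply: le_lt_trans y1; rewrite ler_piMl//; lra.
  rewrite /G; have -> : 0 + s%:C * (y%:C - 0) = (s * y)%:C :> R[i] by rewrite add0r subr0 rmorphM.
  rewrite /F /radius_fun -/c -rmorphXn !f_sector ?sy0 ?exprn_ge0 ?expr_lt1//.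
  rewrite /phi !sector_map_real ?sy0 ?exprn_ge0 ?expr_lt1//.
  by rewrite !imM !reM !reD !imD !reM !imM !reD !imD /=; ring.
have cont : {within `[0 : R, 1], continuous G}.
  apply: smooth_continuous_segment => s /andP[s0 s1].
  have zs : cmod (0 + s%:C * (y%:C - 0)) < 1.
    rewrite add0r subr0 cmodM !cmod_real ger0_norm// ger0_norm; last lra.
    by apply: le_lt_trans y1; rewrite ler_piMl//; lra.
  have zm (z : R[i]) : cmod z < 1 -> cmod (z ^+ m) < 1.
    by move=> z1; rewrite cmodX expr_lt1 ?cmod_ge0.
  have sm k : smooth (fun z : R[i] => z ^+ k) (0 + s%:C * (y%:C - 0)).
    elim: k => [|k ih].
      rewrite (_ : (fun _ => _) = fun=> 1); first exact: smooth_cst.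
      by apply/funext => z; rewrite expr0.
    rewrite (_ : (fun _ => _) = fun z => z * z ^+ k); first exact: smoothM (smooth_id _) ih.
    by apply/funext => z; rewrite exprS.
  apply: smoothM; first exact: smooth_cst.
  apply: smoothM; first exact: smooth_cst.
  apply: smoothD; apply: smoothM; try exact: smooth_cst.
    apply: smoothB; last exact: smooth_cst.
    by apply: smooth_comp; [exact: sm|apply: smooth_sector_map1; exact: zm].
  by apply: smoothB; [exact: smooth_sector_map1|exact: smooth_cst].
have i00 : 0 < (2 * alpha)^-1 by rewrite invr_gt0; lra.
have [|s] := IVT ler01 cont (v := (2 * alpha)^-1).
  rewrite !Freal ?lexx ?ler01// mul0r mul1r /radius_fun expr0n gtn_eqF//= f_0 !mulr0 addr0.
  by rewrite ge_min le_max (ltW i00) big orbT.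
rewrite in_itv /= => s01; rewrite Freal// => E; have [s0 s1] := andP s01.
exists (s * y) => //; rewrite lt_def mulr_ge0//=; last lra.
rewrite andbT; apply/andP; split; last first.
  by apply: le_lt_trans y1; rewrite ler_piMl//; lra.
apply/eqP => sy; move: E; rewrite sy /radius_fun expr0n gtn_eqF//= f_0 !mulr0 addr0 => E.
by rewrite -E ltxx in i00.
Qed.

Lemma is_radiusE r : is_radius K m t alpha r <-> 0 < r < 1 /\ radius_fun r = (2 * alpha)^-1.
Proof.
split=> -[r01 E]; split => //; first by apply/eqP; rewrite -subr_eq0; apply/eqP.
by rewrite -/(radius_fun r) E subrr.
Qed.

Lemma radius_unique : exists! r : R, is_radius K m t alpha r.
Proof.
have [r r01 E] := radius_exists; exists r; split; first exact/is_radiusE.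
move=> s /is_radiusE[/andP[s0 s1] E']; have /andP[r0 r1] := r01.
have [lt|gt|//] := ltgtP r s.
  by have := radius_fun_lt (ltW r0) lt s1; rewrite E E' ltxx.
by have := radius_fun_lt (ltW s0) gt r1; rewrite E E' ltxx.
Qed.

End Radius.

(** * The Bohr inequality up to the radius *)

Section Forward.
Context {R : realType}.
Local Open Scope complex_scope.
Implicit Types (z w q c l : R[i]) (W : set R[i]) (f h g : R[i] -> R[i]) (a b : nat -> R[i]).

Lemma fulljet_scale_shift f a c q : fulljet f a ->
  fulljet (fun x => (f x - q) * c) (fun n => (a n - (n == 0%N)%:R * q) * c).
Proof.
move=> fa n; have := jet_take (jetM (jetD (fa n) (jet_cst n 0 (- q))) (jet_cst n 0 c)).
congr (jet _ _ _ _); apply/polyP => i; rewrite coef_take_poly [RHS]coef_poly.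
case: ltnP => // lt; rewrite coefMC coefD coef_poly lt coefC.
by case: i {lt} => [|i] /=; rewrite ?mul1r// mul0r addr0 subr0.
Qed.

Lemma coefficient_sum_le (alpha beta r : R) W h a q N :
  1 <= alpha <= 2 -> 0 <= r <= 1 / 3 -> convexC (~` W) ->
  opening_angle_at_infinity W beta -> beta <= pi * alpha ->
  ps a h -> (forall z, cmod z < 1 -> W (h z)) ->
  (forall z, cmod z < 1 -> exists2 l, sderiv h z l & l != 0) ->
  adherent (~` W) q ->
  \sum_(n < N) cmod (a n.+1) * r ^+ n.+1 <=
  cmod (h 0 - q) * \sum_(n < N) koebe_coef alpha n.+1 * r ^+ n.+1.
Proof.
move=> a12 r3 cW op bpi ah hW dh Wq.
have sh z : cmod z < 1 -> smooth h z by move=> z1; exact: ps_smooth ah z1.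
have nWh z : cmod z < 1 -> ~ adherent (~` W) (h z).
  by move=> z1; have [m dm m0] := dh z z1; exact: image_not_adherent dm m0.
have z01 : cmod (0 : R[i]) < 1 by rewrite cmod0.
have [m dm m0] := dh 0 z01.
have [L [mu [mu2 sL L0 HL Lmu]]] := sector_log a12 cW op bpi Wq sh nWh dm m0.
have Hj := fulljet_scale_shift (h 0 - q)^-1 q (ps_fulljet ah).
have := @sector_subordination R alpha mu r (fun z => (h z - q) / (h 0 - q)) L _ N
  a12 r3 mu2 sL L0 HL Lmu Hj.
have hq : 0 < cmod (h 0 - q).
  rewrite cmod_gt0 subr_eq0; apply/eqP => E; apply: (nWh 0 z01); rewrite E; exact: Wq.
have -> : \sum_(n < N) cmod ((a n.+1 - (n.+1 == 0%N)%:R * q) / (h 0 - q)) * r ^+ n.+1 =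
    (cmod (h 0 - q))^-1 * \sum_(n < N) cmod (a n.+1) * r ^+ n.+1.
  rewrite mulr_sumr; apply: eq_bigr => i _.
  by rewrite mul0r subr0 cmod_div mulrAC mulrC.
by rewrite ler_pdivrMl.
Qed.

Lemma ps_cmod_le a h (r B : R) z : ps a h -> cmod z <= r -> cmod z < 1 ->
  (forall N, \sum_(n < N) cmod (a n.+1) * r ^+ n.+1 <= B) -> cmod (h z) <= cmod (a 0%N) + B.
Proof.
move=> ah zr z1 H; have /climS := ah z z1; apply: clim_le => N.
rewrite /psum big_ord_recl expr0 mulr1.
apply: le_trans (cmodD _ _) _; rewrite lerD2l.
apply: le_trans (cmod_sum _ _ _) (le_trans _ (H N)).
apply: ler_sum => i _; rewrite lift0 cmodM cmodX.
by apply: ler_wpM2l; rewrite ?cmod_ge0// lerXn2r ?nnegrE ?cmod_ge0// (le_trans _ zr)// cmod_ge0.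
Qed.

Lemma bohr_partial (K t alpha beta : R) m W h dh dg a b q z N :
  1 <= K -> 1 <= alpha <= 2 -> 0 <= t <= 1 -> (0 < m)%N -> convexC (~` W) ->
  opening_angle_at_infinity W beta -> beta <= pi * alpha ->
  ps a h -> ps (fun n => n.+1%:R * a n.+1) dh -> ps (fun n => n.+1%:R * b n.+1) dg ->
  (forall z, cmod z < 1 -> sderiv h z (dh z)) ->
  (forall z, cmod z < 1 -> dh z != 0) ->
  (forall z, cmod z < 1 -> cmod (dg z / dh z) <= (K - 1) / (K + 1)) -> b 0%N = 0 ->
  (forall z, cmod z < 1 -> W (h z)) -> adherent (~` W) q ->
  cmod z <= 1 / 3 -> radius_fun K t alpha m (cmod z) <= (2 * alpha)^-1 ->
  t * cmod (h (z ^+ m)) + (1 - t) * \sum_(n < N) (cmod (a n) + cmod (b n)) * cmod z ^+ n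
  <= cmod (h 0) + cmod (h 0 - q).
Proof.
move=> K1 a12 /andP[t0 t1] m0 cW op bpi ah pdh pdg dhE dh0 qc b0 hW Wq z3 rad.
have /andP[a1 a2] := a12.
set r := cmod z in z3 rad *; have r0 : 0 <= r by exact: cmod_ge0.
set D := cmod (h 0 - q); have D0 : 0 <= D by exact: cmod_ge0.
have dh' z' : cmod z' < 1 -> exists2 l, sderiv h z' l & l != 0.
  by move=> z1; exists (dh z'); [exact: dhE|exact: dh0].
pose F (x : R) := ((1 + x) / (1 - x)) `^ alpha - 1.
have S x n : 0 <= x <= 1 / 3 -> \sum_(i < n) cmod (a i.+1) * x ^+ i.+1 <= D * F x.
  move=> x3; have /andP[x0 x1] := x3.
  apply: le_trans (coefficient_sum_le n a12 x3 cW op bpi ah hW dh' Wq) _.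
  apply: ler_wpM2l => //; apply: koebe_partial_sum_le => //.
  by rewrite x0 /=; lra.
have r3 : 0 <= r <= 1 / 3 by rewrite r0.
(* As m >= 1 gives r^m <= r, the same coefficient estimate covers h (z^m). *)
have rm3 : 0 <= r ^+ m <= 1 / 3.
  apply/andP; split; first exact: exprn_ge0.
  apply: (le_trans _ z3); have r1 : r <= 1 by lra.
  by rewrite -[leRHS]expr1; apply: ler_wiXn2l.
have h0 : h 0 = a 0%N.
  by rewrite -(fulljet_at (ps_fulljet ah)).
have hz : cmod (h (z ^+ m)) <= cmod (h 0) + D * F (r ^+ m).
  rewrite h0; apply: (@ps_cmod_le a h (r ^+ m)) => //; rewrite ?cmodX//.
    by rewrite -/r; case/andP: rm3 => _ le3; apply: le_lt_trans le3 _; lra.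
  by move=> n; exact: S.
have K10 : 0 < K + 1 by lra.
have sums : \sum_(n < N) (cmod (a n) + cmod (b n)) * r ^+ n <=
    cmod (h 0) + 2 * K / (K + 1) * (D * F r).
  have F0 : 0 <= D * F r by have := S r 0%N r3; rewrite big_ord0.
  have c0 : 0 <= 2 * K / (K + 1) by rewrite divr_ge0; lra.
  case: N => [|n]; first by rewrite big_ord0 addr_ge0 ?cmod_ge0// mulr_ge0.
  rewrite big_ord_recl expr0 mulr1 b0 cmod0 addr0 h0 lerD2l.
  have := @dilatation_sum R dh dg a b _ r n pdh pdg dh0 qc r3 => BA.
  under eq_bigr do rewrite lift0 mulrDl; rewrite big_split /=.
  move: BA; set A := \sum_(i < n) cmod (a _) * _; set B := \sum_(i < n) _ * _ => BA.
  have As : A <= D * F r by exact: S.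
  apply: le_trans (_ : (1 + (K - 1) / (K + 1)) * A <= _).
    by rewrite mulrDl mul1r lerD2l.
  have -> : 1 + (K - 1) / (K + 1) = 2 * K / (K + 1) by field; rewrite gt_eqF.
  exact: ler_wpM2l.
have Ff x : F x = 2 * alpha * f_ alpha x.
  by rewrite /f_ mulrA divff ?mul1r// gt_eqF//; lra.
apply: le_trans (lerD (ler_wpM2l t0 hz) (ler_wpM2l _ sums)) _; first by lra.
rewrite !Ff.
(* Both estimates combine into |h 0| plus 2 alpha D times the left side of the radius equation,
   which is at most 1 / (2 alpha). *)
have -> : t * (cmod (h 0) + D * (2 * alpha * f_ alpha (r ^+ m))) +
  (1 - t) * (cmod (h 0) + 2 * K / (K + 1) * (D * (2 * alpha * f_ alpha r))) =
  cmod (h 0) + D * (2 * alpha) * radius_fun K t alpha m r.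
  by rewrite /radius_fun; ring.
rewrite lerD2l; apply: le_trans (ler_wpM2l _ rad) _.
  by apply: mulr_ge0 => //; lra.
by rewrite mulfK// gt_eqF//; lra.
Qed.

Lemma bohr_forward (K t alpha rho : R) m :
  1 <= K -> 1 <= alpha <= 2 -> 0 <= t <= 1 -> (0 < m)%N -> rho <= 1 / 3 ->
  radius_fun K t alpha m rho <= (2 * alpha)^-1 -> bohr_inequality K m t alpha rho.
Proof.
move=> K1 a12 t01 m0 rho3 rad f h g a b phi [_ [_ /power_seriesP ah] [_ /power_seriesP bg b0] qc].
move=> [_ _ cW [beta op bpi]] [w [_ w0 wD hw]] z zD zrho.
set W := phi @` disk in cW op *; have {}cW : convexC (~` W) by exact/convex_setP.
have [dh pdh dhE] := ps_sderiv ah.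
have [dg pdg dgE] := ps_sderiv bg.
have D1h x : cmod x < 1 -> derive1 h x = dh x by move=> /dhE /sderiv_derive1[].
have D1g x : cmod x < 1 -> derive1 g x = dg x by move=> /dgE /sderiv_derive1[].
have dh0 x : cmod x < 1 -> dh x != 0 by move=> x1; have [] := qc x x1; rewrite D1h.
have qc' x : cmod x < 1 -> cmod (dg x / dh x) <= (K - 1) / (K + 1).
  by move=> x1; have [] := qc x x1; rewrite /dilatation D1h// D1g.
have hW x : cmod x < 1 -> W (h x).
  by move=> x1; rewrite hw//; exists (w x) => //; exact: wD.
have z01 : cmod (0 : R[i]) < 1 by rewrite cmod0.
have h0 : h 0 = phi 0 by rewrite hw// w0.
have /andP[t0 t1] := t01; have z0 : 0 <= cmod z by exact: cmod_ge0.
have radz : radius_fun K t alpha m (cmod z) <= (2 * alpha)^-1.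
  by apply: le_trans rad; apply: radius_fun_le => //; lra.
pose S N := \sum_(n < N) (cmod (a n) + cmod (b n)) * cmod z ^+ n.
have partial N : t * cmod (h (z ^+ m)) + (1 - t) * S N <=
    cmod (phi 0) + dist_to (phi 0) (boundary W).
  (* The complement reaches infinity, so it is nonempty and W has a boundary point; over an empty
     boundary the infimum would take its default value. *)
  have [c nWc _] := op.1 0.
  have [q0 Bq0] := boundary_nonempty (hW 0 z01) nWc.
  rewrite -lerBlDl; apply: lb_le_inf; first by exists (cmod (phi 0 - q0)); exists q0.
  move=> _ [q Bq <-]; rewrite lerBlDl -h0.
  apply: (@bohr_partial K t alpha beta m W h dh dg a b q z N) => //.
    exact: boundary_adherent.
  exact: le_trans rho3.
have nn n : (0 <= ((cmod (a n) + cmod (b n)) * cmod z ^+ n)%:E)%E.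
  by rewrite lee_fin mulr_ge0 ?addr_ge0 ?exprn_ge0 ?cmod_ge0.
rewrite -nneseriesZl//.
have cv : cvgn (fun n => (\sum_(0 <= i < n) ((1 - t)%:E * ((cmod (a i) + cmod (b i)) * cmod z ^+ i)%:E))%E).
  apply: is_cvg_nneseries => n _ _; apply: mule_ge0 => //.
  by rewrite lee_fin; lra.
apply: le_trans (leeD2l _ (_ : _ <= (cmod (phi 0) + dist_to (phi 0) (boundary W) -
    t * cmod (h (z ^+ m)))%:E)%E) _; last first.
  by rewrite -EFinD lee_fin addrC subrK.
apply: lime_le => //; near=> n.
under eq_bigr do rewrite -EFinM.
rewrite sumEFin lee_fin lerBrDl -mulr_sumr big_mkord; exact: partial.
Unshelve. all: by end_near.
Qed.

End Forward.

(** * The extremal map sends the disk onto an admissible sector *)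

Section Sector.
Context {R : realType}.
Local Open Scope complex_scope.
Implicit Types (z w q c u v s : R[i]).
Variable alpha : R.
Hypothesis ha : 1 <= alpha <= 2.

Let a_ge1 : 1 <= alpha. Proof. by case/andP: ha. Qed.
Let a_le2 : alpha <= 2. Proof. by case/andP: ha. Qed.

Let phi := sector_map alpha (1 : R[i]).
(** Half the opening angle of the sector. *)
Let eta := pi / 2 * alpha.
Let ell z := Log (1 + z) - Log (1 - z).

Let eta_ge : pi / 2 <= eta.
Proof. by rewrite /eta ler_peMr// divr_ge0// pi_ge0. Qed.

Let eta_le : eta <= pi.
Proof.
have : pi * alpha <= pi * 2 by rewrite ler_pM2l ?pi_gt0//; exact: a_le2.
by rewrite /eta; lra.
Qed.

Lemma cayley_Re_gt0 z : cmod z < 1 -> 0 < Re ((1 + z) / (1 - z)).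
Proof.
move=> z1; have [[_ h2] _] := one_addN_neq0 z1.
set v := _ / _.
have : cmod (v - 1) < cmod (v + 1).
  have -> : v - 1 = z * (2 / (1 - z)) by rewrite /v; field.
  have -> : v + 1 = 2 / (1 - z) by rewrite /v; field.
  by rewrite cmodM gtr_pMl// cmod_gt0 mulf_neq0 ?invr_eq0 ?pnatr_eq0.
rewrite -(@ltr_pXn2r _ 2) ?nnegrE ?cmod_ge0// !cmod_sqr !reD !imD !reN !imN /=.
by rewrite -subr_gt0 (_ : _ - _ = 4 * Re v); [lra|ring].
Qed.

Lemma cexp_ell z : cmod z < 1 -> cexp (ell z) = (1 + z) / (1 - z).
Proof.
move=> z1; have z1' : cmod (- z) < 1 by rewrite cmodN.
by rewrite /ell cexpB !cexp_Log//; apply: slit_Re_gt0; exact: Re_1D_gt0.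
Qed.

Lemma Im_ell z : cmod z < 1 -> `|Im (ell z)| < pi / 2.
Proof.
move=> z1; have z1' : cmod (- z) < 1 by rewrite cmodN.
have h1 := Im_Log_Re_gt0 (Re_1D_gt0 z1); have h2 := Im_Log_Re_gt0 (Re_1D_gt0 z1').
have lpi : `|Im (ell z)| < pi.
  by rewrite /ell imD imN; apply: le_lt_trans (ler_normB _ _) _; lra.
rewrite -(cexpK lpi) cexp_ell//; apply: Im_Log_Re_gt0; exact: cayley_Re_gt0.
Qed.

Lemma Log_cayley v : 0 < Re v ->
  exists2 z, cmod z < 1 & ell z = Log v.
Proof.
move=> v0; have v1 : v + 1 != 0.
  by apply/eqP => /(congr1 (@Re R)); rewrite reD /=; lra.
pose z := (v - 1) / (v + 1).
have z1 : cmod z < 1.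
  rewrite /z cmod_div ltr_pdivrMr ?cmod_gt0// mul1r.
  rewrite -(@ltr_pXn2r _ 2) ?nnegrE ?cmod_ge0// !cmod_sqr !reD !imD !reN !imN /=.
  by rewrite -subr_gt0 (_ : _ - _ = 4 * Re v); [lra|ring].
exists z => //; have lpi := Im_ell z1.
have lpi' : `|Im (ell z)| < pi by apply: lt_trans lpi _; have := pi_gt0 R; lra.
rewrite -(cexpK lpi') cexp_ell//; congr Log.
have [[_ h2] _] := one_addN_neq0 z1.
apply: (canLR (mulfK h2)).
by rewrite /z; field.
Qed.

(** [ell] maps the disk onto the strip |Im s| < pi / 2, and multiplication by alpha widens it to |Im
    s| < eta. *)
Lemma sector_imageP u : (phi @` disk (R := R)) u <->
  exists2 s, u = cexp s & `|Im s| < eta.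
Proof.
have a0 : 0 < alpha by have := a_ge1 => ?; lra.
split=> [[z z1 <-]|[s -> sb]].
  exists (alpha%:C * ell z); first exact: sector_mapE.
  rewrite imM /= mul0r addr0 normrM gtr0_norm// mulrC ltr_pM2r//; exact: Im_ell.
pose s' := (alpha^-1)%:C * s.
have sb' : `|Im s'| < pi / 2.
  rewrite /s' imM /= mul0r addr0 normrM gtr0_norm ?invr_gt0//.
  by rewrite mulrC ltr_pdivrMr.
have [z z1 ez] := Log_cayley (Re_cexp_gt0 sb').
exists z => //; rewrite /phi sector_mapE -/(ell z) ez cexpK.
  by rewrite /s' mulrA -rmorphM divff ?gt_eqF// mul1r.
by apply: lt_trans sb' _; have := pi_gt0 R; lra.
Qed.

Lemma sector_image_polar (rho t : R) : 0 < rho -> - pi <= t <= pi ->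
  (phi @` disk (R := R)) (polar rho t) <-> `|t| < eta.
Proof.
move=> r0 tpi; have E : polar rho t = cexp (ln rho +i* t) by rewrite /cexp /= lnK.
rewrite E; split=> [/sector_imageP[s us sb]|tb]; last by apply/sector_imageP; exists (ln rho +i* t).
have -> : t = Im (ln rho +i* t) by [].
rewrite (cexp_inj _ us)//=.
apply: le_lt_trans (ler_normB _ _) _; rewrite mulr2n.
have : `|t| <= pi by rewrite ler_norml.
by have := eta_le => ? ?; lra.
Qed.

Lemma sector_map_inj : set_inj disk phi.
Proof.
have a0 : 0 < alpha by have := a_ge1 => ?; lra.
move=> z w; rewrite !inE => z1 w1; rewrite /phi !sector_mapE -/(ell z) -/(ell w) => /cexp_inj E.
(* Injectivity rests on alpha <= 2: two heights in the widened strip differ by less than alpha pi <=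
   2 pi. *)
have /E : `|Im (alpha%:C * ell z) - Im (alpha%:C * ell w)| < pi *+ 2.
  rewrite !imM /= !mul0r !addr0 -mulrBr normrM gtr0_norm//.
  have : `|Im (ell z) - Im (ell w)| < pi.
    by apply: le_lt_trans (ler_normB _ _) _; have := Im_ell z1; have := Im_ell w1; lra.
  move=> lt; rewrite mulr2n; have := pi_gt0 R => p0; have := a_le2 => a2.
  have : alpha * `|Im (ell z) - Im (ell w)| < alpha * pi by rewrite ltr_pM2l.
  have : alpha * pi <= 2 * pi by rewrite ler_pM2r.
  lra.
have an0 : alpha%:C != 0 by rewrite -cmod_gt0 cmod_real normr_gt0 gt_eqF.
move=> /(mulfI an0) /(congr1 cexp); rewrite !cexp_ell// => /eqP.
have [[_ h2] _] := one_addN_neq0 z1; have [[_ h2'] _] := one_addN_neq0 w1.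
rewrite eqr_div// => /eqP H.
have n2 : (2 : R[i]) != 0 by rewrite pnatr_eq0.
apply: (mulfI n2); apply/eqP; rewrite -subr_eq0.
have -> : 2 * z - 2 * w = (1 + z) * (1 - w) - (1 + w) * (1 - z) by ring.
by rewrite H subrr.
Qed.

Let W := phi @` disk (R := R).

(** The second inequality says sin (eta - p) <= 0 for p = |arg u|. For eta = pi this alone would
    admit the positive axis, p = 0, which Re u <= 0 removes. *)
Lemma sector_complementP u : ~ W u <->
  Re u <= 0 /\ Re u * sin eta - `|Im u| * cos eta <= 0.
Proof.
have pi0 := pi_gt0 R; have el := eta_le; have eg := eta_ge.
have [->|u0] := eqVneq u 0.
  rewrite /= normr0 !mul0r subrr lexx; split => // _ /sector_imageP[s /eqP].
  by rewrite eq_sym (negbTE (cexp_neq0 _)).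
have up : 0 < cmod u by rewrite cmod_gt0.
have [t /andP[t1 t2] uE] := polar_form u0.
rewrite uE; have tpi : - pi <= t <= pi by rewrite ltW.
have WE : W (polar (cmod u) t) <-> `|t| < eta by exact: sector_image_polar.
have abst : `|t| <= pi by rewrite ler_norml.
have abst0 : 0 <= `|t| by [].
have -> : Re (polar (cmod u) t) = cmod u * cos `|t| by rewrite /= cos_norm.
have -> : `|Im (polar (cmod u) t)| = cmod u * sin `|t|.
  rewrite /= normrM gtr0_norm//; congr (_ * _); have [t0|t0] := leP 0 t.
    by rewrite !ger0_norm ?sin_ge0_pi// t0.
  have st : 0 <= sin (- t) by apply: sin_ge0_pi; lra.
  by rewrite [in RHS]ltr0_norm// -{1}[t]opprK sinN normrN ger0_norm.
move: WE abst abst0; set p := `|t| => WE p2 p1.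
have -> : cmod u * cos p * sin eta - cmod u * sin p * cos eta = cmod u * sin (eta - p).
  by rewrite sinB; ring.
rewrite !pmulr_rle0//; split=> [nW|[cp sp]].
  have ep : eta <= p by rewrite leNgt; apply/negP => /WE.
  split.
    have : 0 <= sin (p - pi / 2) by apply: sin_ge0_pi; lra.
    by rewrite sinB cos_pihalf sin_pihalf mulr0 mulr1 sub0r oppr_ge0.
  have : 0 <= sin (p - eta) by apply: sin_ge0_pi; lra.
  by rewrite -opprB sinN oppr_ge0.
move=> /WE pe; have [p0|pn0] := eqVneq p 0.
  by move: cp; rewrite p0 cos0 ler10.
have p0 : 0 < p by rewrite lt_def pn0.
by move: sp; rewrite leNgt sin_gt0_pi//; apply/andP; split; lra.
Qed.

(** For alpha >= 1 the angle eta is at least pi / 2, so cos eta <= 0 and both inequalities bound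
    convex functions of u. *)
Lemma sector_complement_convex : convexC (~` W).
Proof.
have pi0 := pi_gt0 R; have el := eta_le; have eg := eta_ge.
have s0 : 0 <= sin eta by apply: sin_ge0_pi; lra.
have c0 : cos eta <= 0.
  have : 0 <= sin (eta - pi / 2) by apply: sin_ge0_pi; lra.
  by rewrite sinB cos_pihalf sin_pihalf mulr0 mulr1 sub0r oppr_ge0.
move=> z w t /andP[t0 t1] /sector_complementP[z1 z2] /sector_complementP[w1 w2].
apply/sector_complementP.
have -> : Re (t%:C * z + (1 - t)%:C * w) = t * Re z + (1 - t) * Re w.
  by rewrite reD !reM /=; ring.
have -> : Im (t%:C * z + (1 - t)%:C * w) = t * Im z + (1 - t) * Im w.
  by rewrite imD !imM /=; ring.
have x1 : t * Re z <= 0 by rewrite mulr_ge0_le0.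
have x2 : (1 - t) * Re w <= 0 by rewrite mulr_ge0_le0// subr_ge0.
split; first by lra.
have tri : `|t * Im z + (1 - t) * Im w| <= t * `|Im z| + (1 - t) * `|Im w|.
  apply: le_trans (ler_normD _ _) _.
  by rewrite !normrM (ger0_norm t0) (ger0_norm (_ : 0 <= 1 - t)) ?subr_ge0.
have y1 : t * (Re z * sin eta - `|Im z| * cos eta) <= 0 by rewrite mulr_ge0_le0.
have y2 : (1 - t) * (Re w * sin eta - `|Im w| * cos eta) <= 0.
  by rewrite mulr_ge0_le0// subr_ge0.
have : `|t * Im z + (1 - t) * Im w| * - cos eta <=
    (t * `|Im z| + (1 - t) * `|Im w|) * - cos eta by rewrite ler_wpM2r ?oppr_ge0.
lra.
Qed.

Lemma sector_opening_angle : opening_angle_at_infinity W (pi * alpha).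
Proof.
have pi0 := pi_gt0 R; have el := eta_le; have eg := eta_ge.
have WP (rho t : R) : 0 < rho -> - pi <= t <= pi -> W (polar rho t) <-> `|t| < eta.
  exact: sector_image_polar.
split=> [M|].
  have M0 : 0 < `|M| + 1 by rewrite ltr_wpDl.
  exists (polar (`|M| + 1) pi); last first.
    by rewrite cmod_polar gtr0_norm//; have := ler_norm M; lra.
  move=> /WP; rewrite M0 gtr0_norm// lexx andbT => /(_ isT).
  have -> : - pi <= pi :> R by lra.
  by move=> /(_ isT); lra.
apply: cvg_near_cst; exists 0; split=> // rho rho0.
rewrite /arc_measure (_ : [set _ | _] = `]- eta, eta[%classic).
  rewrite lebesgue_measure_itv /= lte_fin; case: ifP => [_|/negP[]]; last lra.
  by rewrite -EFinD; congr (_%:E); rewrite /eta; lra.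
apply/seteqP; split=> t /=; rewrite in_itv /= -ltr_norml.
  by move=> [/andP[t1 t2]] /WP; apply=> //; rewrite ltW.
move=> te; have tpi : - pi < t < pi by rewrite -ltr_norml; apply: lt_le_trans te _.
have /andP[t1 t2] := tpi; rewrite t1 ltW//; split => //.
by apply/WP => //; rewrite !ltW.
Qed.

Lemma sector_map_cvg_infty :
  cmod (phi z) @[z --> within disk (nbhs (1 : R[i]))] --> +oo.
Proof.
apply/cvgryPgt => A; rewrite near_withinE; apply/nbhs_cmodP.
pose B := Num.max A 1; have B0 : 0 < B by rewrite lt_max ltr01 orbT.
(* Radius 1/2 keeps |1 + z| >= 1, and radius 1 / B makes 1 / |1 - z| exceed B; the exponent alpha >=
   1 only helps, since B >= 1. *)
exists (Num.min (1 / 2) (B^-1)); first by rewrite lt_min invr_gt0 B0 andbT; lra.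
move=> z; rewrite lt_min => /andP[z2 zB] z1; rewrite /phi sector_mapE.
have [[h1 h2] _] := one_addN_neq0 z1.
have p2 : 0 < cmod (1 - z) by rewrite cmod_gt0.
rewrite cmodC in z2 zB.
have q1 : 1 <= cmod (1 + z).
  have := cmod_ge_sub 2 (z - 1); rewrite (_ : 2 + (z - 1) = 1 + z); last by ring.
  have -> : cmod (2 : R[i]) = 2 by rewrite cmod_nat.
  by rewrite (cmodC z); lra.
rewrite cmod_cexp reM /= mul0r subr0.
have lB : A <= B by rewrite le_max lexx.
apply: le_lt_trans lB _; rewrite -[ltLHS]lnK ?posrE// ltr_expR.
have l1 : 0 <= ln (cmod (1 + z)) by rewrite ln_ge0.
have l2 : ln B < - ln (cmod (1 - z)).
  rewrite -lnV ?posrE// ltr_ln ?posrE ?invr_gt0//.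
  by rewrite -[ltLHS]invrK ltf_pV2 ?posrE ?invr_gt0.
have lB0 : 0 <= ln B by rewrite ln_ge0// le_max lexx orbT.
apply: lt_le_trans (_ : 1 * (ln (cmod (1 + z)) - ln (cmod (1 - z))) <= _); first by lra.
by apply: ler_wpM2r; [lra|exact: a_ge1].
Qed.

Lemma sector_map_concave : concave_univalent alpha phi.
Proof.
split.
- split; last exact: sector_map_inj.
  by move=> z z1; have [] := sderiv_derive1 (sderiv_sector_map1 alpha z1).
- exact: sector_map_cvg_infty.
- exact/convex_setP/sector_complement_convex.
- by exists (pi * alpha) => //; exact: sector_opening_angle.
Qed.

(** The vertex 0 is a boundary point at distance 1. An upper bound suffices, as it makes the right
    side of the Bohr inequality at most 2. *)
Lemma sector_image_dist : dist_to 1 (boundary W) <= 1.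
Proof.
have B0 : boundary W 0.
  split.
    move=> V /nbhs_cmodP[e e0 Ve]; exists (e / 2)%:C.
    have e2 : 0 < e / 2 by rewrite divr_gt0.
    split; last by apply: Ve; rewrite subr0 cmod_real gtr0_norm//; lra.
    apply/sector_imageP; exists (ln (e / 2))%:C; first by rewrite cexp_real lnK.
    have := eta_ge; have := pi_gt0 R => p h; rewrite /= normr0; lra.
  move=> /interior_subset/sector_imageP[s /eqP].
  by rewrite eq_sym (negbTE (cexp_neq0 _)).
rewrite -[leRHS](@cmod1 R) -[X in cmod X]subr0.
apply: inf_lbound; last by exists 0.
by exists 0 => _ [p _ <-]; exact: cmod_ge0.
Qed.

End Sector.

(** * Failure of the inequality beyond the radius *)

Section Sharpness.
Context {R : realType}.
Local Open Scope complex_scope.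

Lemma bohr_sharp (K t alpha r r' : R) (m : nat) :
  1 <= K -> 1 <= alpha <= 2 -> 0 <= t <= 1 -> (0 < m)%N ->
  is_radius K m t alpha r -> r < r' -> ~ bohr_inequality K m t alpha r'.
Proof.
move=> K1 a12 t01 m0 /is_radiusE[/andP[r0 r1] rad] rr' bohr.
have /andP[a1 a2] := a12; have /andP[t0 t1] := t01.
(* As r' may exceed 1, the minimum keeps the test point inside the disk. *)
pose x := (r + Num.min r' 1) / 2.
have rmin : r < Num.min r' 1 by rewrite lt_min rr'.
have xr : r < x by rewrite /x; lra.
have xm : x < Num.min r' 1 by rewrite /x; lra.
move: xm; rewrite lt_min => /andP[xr' x1]; have x0 : 0 < x by lra.
have x01 : 0 <= x < 1 by rewrite ltW.
have xm01 : 0 <= x ^+ m < 1 by rewrite exprn_ge0 ?(ltW x0)// expr_lt1// ltW.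
have radx : (2 * alpha)^-1 < radius_fun K t alpha m x.
  by rewrite -rad; apply: radius_fun_lt => //; exact: ltW.
pose phi := sector_map alpha (1 : R[i]).
pose k : R := (K - 1) / (K + 1).
have K10 : 0 < K + 1 by lra.
have k0 : 0 <= k by rewrite divr_ge0; lra.
have k1 : k < 1 by rewrite /k ltr_pdivrMr//; lra.
pose g (z : R[i]) := k%:C * (phi z - 1).
pose A n : R[i] := (koebe_coef alpha n)%:C.
pose b n : R[i] := if n is 0 then 0 else k%:C * A n.
have pphi : ps A phi by exact: koebe_series.
have dphi z : cmod z < 1 -> sderiv phi z (phi z * ((2 * alpha)%:C / (1 - z ^+ 2))).
  by move=> z1; exact: sderiv_sector_map1.
have dg z : cmod z < 1 -> sderiv g z (k%:C * (phi z * ((2 * alpha)%:C / (1 - z ^+ 2)))).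
  move=> z1; have := sderivM (sderiv_cst k%:C z) (sderivB (dphi z z1) (sderiv_cst 1 z)).
  by congr (sderiv _ _ _); ring.
have pg : ps b g.
  move=> z z1; apply/climS.
  have /climS H := pphi z z1.
  apply: clim_ext (climM k%:C (climD H (clim_cst (- 1)))) => n.
  rewrite /psum !big_ord_recl /= mul0r add0r /A koebe_coef0 expr0 mulr1 addrAC subrr add0r mulr_sumr.
  by apply: eq_bigr => i _; rewrite mulrA.
have dphi0 z : cmod z < 1 -> phi z * ((2 * alpha)%:C / (1 - z ^+ 2)) != 0.
  move=> z1; have [_ h3] := one_addN_neq0 z1.
  apply: mulf_neq0; first exact: sector_map_neq0.
  apply: mulf_neq0; last by rewrite invr_eq0.
  by rewrite -cmod_gt0 cmod_real normr_gt0 gt_eqF//; lra.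
have qc : qc_harmonic K (fun z => phi z + (g z)^*) phi g A b.
  split => //.
  - split; last exact/power_seriesP.
    by move=> z z1; have [] := sderiv_derive1 (dphi z z1).
  - split=> //; last exact/power_seriesP.
    by move=> z z1; have [] := sderiv_derive1 (dg z z1).
  - move=> y y1; have [_ E1] := sderiv_derive1 (dphi y y1).
    have [_ E2] := sderiv_derive1 (dg y y1).
    rewrite /dilatation E1 E2 mulfK; last exact: dphi0.
    rewrite cmod_real (ger0_norm k0); split=> //; exact: dphi0.
have sub : subordinate phi phi.
  by exists id; split.
have xC : cmod x%:C = x by rewrite cmod_real gtr0_norm.
have := bohr _ _ _ _ _ _ qc (sector_map_concave a12) sub x%:C.
have xD : disk x%:C by change (cmod x%:C < 1); rewrite xC.
have xle : cmod x%:C <= r' by rewrite xC ltW.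
move=> /(_ xD xle); rewrite xC.
set B := (_ + dist_to _ _); have B2 : B <= 2.
  rewrite /B /phi sector_map0 cmod1.
  have := sector_image_dist a12; lra.
rewrite -rmorphXn /phi sector_map_real// cmod_real ger0_norm ?powR_ge0//.
set F1 := _ `^ _; set Sg := (\sum_(0 <= n <oo) _)%E => ineq.
have Ff y : ((1 + y) / (1 - y)) `^ alpha = 1 + 2 * alpha * f_ alpha y.
  by rewrite /f_ mulrA divff ?mul1r ?gt_eqF//; lra.
pose S N := \sum_(n < N) koebe_coef alpha n * x ^+ n.
have ineqN N : t * F1 + (1 - t) * (S N.+1 + k * (S N.+1 - 1)) <= 2.
  apply: le_trans _ B2; rewrite -lee_fin; apply: le_trans _ ineq.
  rewrite EFinD EFinM; apply: leeD2l; rewrite EFinM; apply: lee_wpmul2l.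
    by rewrite lee_fin; lra.
  apply: le_trans (nneseries_lim_ge N.+1 _); last first.
    move=> n _ _; rewrite lee_fin mulr_ge0 ?addr_ge0 ?exprn_ge0 ?cmod_ge0//; exact: ltW.
  rewrite sumEFin lee_fin big_mkord.
  have tE i : (cmod (A i) + cmod (b i)) * x ^+ i =
      koebe_coef alpha i * x ^+ i + k * (if i is 0 then 0 else koebe_coef alpha i * x ^+ i).
    have Ai j : cmod (A j) = koebe_coef alpha j.
      by rewrite /A cmod_real ger0_norm// koebe_coef_ge0.
    rewrite Ai; case: i => [|i]; first by rewrite cmod0 addr0 mulr0 addr0.
    by rewrite cmodM Ai cmod_real (ger0_norm k0); ring.
  under eq_bigr do rewrite tE.
  rewrite big_split /= -mulr_sumr lerD2l; apply: ler_wpM2l => //.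
  rewrite /S !big_ord_recl koebe_coef0 expr0 mulr1 addrAC subrr !add0r.
  by rewrite le_eqVlt; apply/orP; left; apply/eqP; apply: eq_bigr => i _; rewrite lift0.
have Slim : clim (fun N => (S N)%:C) (((1 + x) / (1 - x)) `^ alpha)%:C.
  have xd : cmod x%:C < 1 by rewrite xC.
  have := pphi _ xd; rewrite /phi sector_map_real//.
  by apply: clim_ext => N; rewrite /A psum_realE.
have := radx; rewrite radius_funE; set c := 2 * K / (K + 1).
have ck : c = 1 + k by rewrite /c /k; field; rewrite gt_eqF.
rewrite -div1r ltr_pdivrMr; last lra.
(* d is the amount by which the left side of the inequality at x, with full sums, exceeds 2; a
   partial sum within d / (c + 1) of its limit already yields the contradiction. *)
move=> gap; pose d := 2 * alpha * (t * f_ alpha (x ^+ m) + c * (1 - t) * f_ alpha x) - 1.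
have d0 : 0 < d by rewrite /d; lra.
have c3 : 0 < c + 1 by rewrite ck; lra.
have [N0 HN0] := Slim _ (divr_gt0 d0 c3).
have := HN0 N0.+1 (leqnSn _); rewrite -rmorphB cmod_real ltr_pdivlMr// => near.
have := ineqN N0; rewrite /F1 !Ff => le2.
set s := S N0.+1 in near le2.
rewrite Ff in near; set e := `|s - _| in near.
have e0 : 0 <= e by rewrite /e.
have s_ge : 2 * alpha * f_ alpha x - e <= s - 1.
  by have := lerNnormlW (lexx e); lra.
have h1 : (1 - t) * (c * (2 * alpha * f_ alpha x - e)) <= (1 - t) * (c * (s - 1)).
  by apply: ler_wpM2l; [lra|apply: ler_wpM2l => //; lra].
have h2 : (1 - t) * (c * e) <= 1 * (e * (c + 1)).
  by apply: ler_pM; [lra|apply: mulr_ge0; lra|lra|rewrite mulrC; apply: ler_wpM2l; lra].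
have E1 : s + k * (s - 1) = 1 + c * (s - 1) by rewrite ck; ring.
by rewrite E1 in le2; rewrite /d in near d0; lra.
Qed.

End Sharpness.

Theorem theorem4p1 (R : realType) (K alpha t : R) (m : nat)
    (hK : 1 <= K) (halpha : 1 <= alpha <= 2) (ht : 0 <= t <= 1)
    (hm : (0 < m)%N) :
  (exists! r : R, is_radius K m t alpha r) /\
  forall r : R, is_radius K m t alpha r ->
    bohr_inequality K m t alpha (Num.min (1 / 3) r) /\
    (r <= 1 / 3 ->
       forall r' : R, r < r' -> ~ bohr_inequality K m t alpha r').
Proof.
split; first exact: radius_unique.
move=> r rr; split; last by move=> _ r' rr'; exact: bohr_sharp rr rr'.
have /is_radiusE[/andP[r0 r1] rad] := rr.
apply: bohr_forward => //; first by rewrite ge_min lexx.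
rewrite -rad; apply: radius_fun_le => //; last by rewrite ge_min lexx orbT.
by rewrite le_min; apply/andP; split; lra.
Qed.
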